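(* Let $0\le t<T$ and let $i_1,i_2\in\{1,\ldots,m\}$ with $i_1\ne i_2$. Let $A_{T,t}^{(i_1i_2)}$ be the Levy stochastic area, and for $q\in\mathbb{N}$ let $$ A_{T,t}^{(i_1i_2)q}=\frac{T-t}{2}\sum_{i=1}^{q}\frac{1}{\sqrt{4i^2-1}}\left(\zeta_{i-1}^{(i_1)}\zeta_{i}^{(i_2)}-\zeta_i^{(i_1)}\zeta_{i-1}^{(i_2)}\right), $$ where $\zeta_j^{(i)}=\int_t^T\phi_j(s)d{\bf w}_s^{(i)}$ and $\{\phi_j\}_{j=0}^\infty$ is the orthonormal Legendre system on $[t,T]$, and let $$ \hat A_{T,t}^{(i_1i_2)q}=\frac{T-t}{2\pi}\sum_{r=1}^{q}\frac1r\left(\hat\zeta_{2r}^{(i_1)}\hat\zeta_{2r-1}^{(i_2)}-\hat\zeta_{2r-1}^{(i_1)}\hat\zeta_{2r}^{(i_2)}+\sqrt2\left(\hat\zeta_{2r-1}^{(i_1)}\hat\zeta_{0}^{(i_2)}-\hat\zeta_{0}^{(i_1)}\hat\zeta_{2r-1}^{(i_2)}\right)\right), $$ where $\hat\zeta_j^{(i)}=\int_t^T\hat\phi_j(s)d{\bf w}_s^{(i)}$ and $\{\hat\phi_j\}_{j=0}^\infty$ is the orthonormal trigonometric system on $[t,T]$. Then: (i) for every $n\in\mathbb{N}$, $$ {\sf M}\left\{\left(A_{T,t}^{(i_1i_2)}-A_{T,t}^{(i_1i_2)q}\right)^{2n}\right\}\to0\quad\text{and}\quad{\sf M}\left\{\left(A_{T,t}^{(i_1i_2)}-\hat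 A_{T,t}^{(i_1i_2)q}\right)^{2n}\right\}\to0\qquad\text{as } q\to\infty; $$ (ii) $A_{T,t}^{(i_1i_2)q}\to A_{T,t}^{(i_1i_2)}$ and $\hat A_{T,t}^{(i_1i_2)q}\to A_{T,t}^{(i_1i_2)}$ with probability 1 as $q\to\infty$.
   Context: $(\Omega,{\rm F},{\sf P})$ is a complete probability space with a nondecreasing right-continuous family of $\sigma$-algebras $\{{\rm F}_s\}$ of ${\rm F}$, and ${\bf w}_s$ is a standard $m$-dimensional Wiener process, adapted to $\{{\rm F}_s\}$, with independent components ${\bf w}_s^{(i)}$, $i=1,\ldots,m$. All stochastic integrals with respect to ${\bf w}^{(i)}$ are Ito integrals, and ${\sf M}$ denotes mathematical expectation. The Levy stochastic area is $$ A_{T,t}^{(i_1i_2)}=\frac12\left(I_{T,t}^{(i_1i_2)}-I_{T,t}^{(i_2i_1)}\right),\qquad I_{T,t}^{(ij)}=\int\limits_t^T\int\limits_t^s d{\bf w}_{\tau}^{(i)}d{\bf w}_s^{(j)}. $$ The orthonormal Legendre system on $[t,T]$ is $$ \phi_j(s)=\sqrt{\frac{2j+1}{T-t}}\,P_j\!\left(\left(s-t-\frac{T-t}{2}\right)\frac{2}{T-t}\right),\qquad j=0,1,2,\ldots, $$ with $P_j$ the $j$-th Legendre polynomial (normalized by $P_j(1)=1$). The orthonormal trigonometric system on $[t,T]$ is $$ \hat\phi_0(s)=\frac{1}{\sqrt{T-t}},\quad \hat\phi_{2r-1}(s)=\frac{\sqrt2}{\sqrt{T-t}}\sin\frac{2\pi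 r(s-t)}{T-t},\quad \hat\phi_{2r}(s)=\frac{\sqrt2}{\sqrt{T-t}}\cos\frac{2\pi r(s-t)}{T-t},\qquad r=1,2,\ldots $$ *)

(* Defs.v *)
From HB Require Import structures.
From mathcomp Require Import all_boot all_order all_algebra.
From mathcomp Require Import all_classical all_reals all_analysis.

Set Implicit Arguments.
Unset Strict Implicit.
Unset Printing Implicit Defensive.

Import Order.TTheory GRing.Theory Num.Theory.
Import numFieldNormedType.Exports.

Local Open Scope classical_set_scope.
Local Open Scope ring_scope.

Section StochasticIntegral.
Context {R : realType} {d : measure_display} {Om : measurableType d}.
Variable P : probability Om R.

(* Measurability of X with respect to a family G of events (a sub-sigma-algebra
   of the one carried by Om). *)
Definition adapted_to (G : set (set Om)) (X : Om -> R) : Prop :=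
  preimage_set_system setT X measurable `<=` G.

Definition sigma_gen (I : Type) (D : set I) (X : I -> Om -> R) : set (set Om) :=
  <<s \bigcup_(i in D) preimage_set_system setT (X i) measurable >>.

Definition independent2 (G H : set (set Om)) : Prop :=
  forall A B, G A -> H B -> P (A `&` B) = (P A * P B)%E.

(* Mutual independence of finitely many sigma-algebras; the product rule for
   subfamilies is obtained by taking some of the A i to be the whole space. *)
Definition mutually_independent (I : finType) (G : I -> set (set Om)) : Prop :=
  forall A : I -> set Om, (forall i, G i (A i)) ->
    P (\bigcap_i A i) = (\prod_(i : I) P (A i))%E.

(* Time is [0, +oo[; the values of a process at negative times are never used. *)
Record is_filtration (F : R -> set (set Om)) : Prop := IsFiltration {
  filtration_sigma_algebra : forall s : R, 0 <= s -> sigma_algebra setT (F s) ;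
  filtration_measurable : forall s : R, 0 <= s -> F s `<=` measurable ;
  filtration_nondecreasing : forall (s u : R), 0 <= s -> s <= u -> F s `<=` F u ;
  filtration_right_continuous : forall s : R, 0 <= s ->
    F s = \bigcap_(u in [set u | s < u]) F u }.

(* Standard m-dimensional Wiener process relative to the filtration F: it is
   adapted and its vector increments after time s are independent of F s.
   The second argument of normal_prob is the standard deviation. *)
Record is_wiener (F : R -> set (set Om)) (m : nat) (w : 'I_m -> R -> Om -> R)
    : Prop := IsWiener {
  wiener_adapted : forall i (s : R), 0 <= s -> adapted_to (F s) (w i s) ;
  wiener_start : forall i, {ae P, forall x, w i 0 x = 0} ;
  wiener_continuous : forall i,
    {ae P, forall x, {within `[0, +oo[, continuous (fun s => w i s x)}} ;
  wiener_increment_normal : forall i (s u : R), 0 <= s -> s < u ->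
    forall B : set R, measurable B ->
      P ((w i u \- w i s) @^-1` B) = normal_prob 0 (Num.sqrt (u - s)) B ;
  wiener_increment_independent : forall (s u : R), 0 <= s -> s < u ->
    independent2 (F s) (sigma_gen setT (fun i => w i u \- w i s)) ;
  wiener_components_independent :
    mutually_independent (fun i => sigma_gen [set s | 0 <= s] (w i)) }.

(* The process equal to step_val k on [step_time k, step_time k.+1[
   for k < step_size, and to 0 elsewhere. *)
Record step_process := StepProcess {
  step_size : nat ;
  step_time : nat -> R ;
  step_val : nat -> Om -> R }.

Definition step_eval (xi : step_process) (s : R) (x : Om) : R :=
  \sum_(k < step_size xi)
    step_val xi k x * \1_(`[step_time xi k, step_time xi k.+1[) s.

Definition step_integral (w : R -> Om -> R) (xi : step_process) (x : Om) : R :=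
  \sum_(k < step_size xi)
    step_val xi k x * (w (step_time xi k.+1) x - w (step_time xi k) x).

Record is_admissible_step (F : R -> set (set Om)) (a b : R) (xi : step_process)
    : Prop := IsAdmissibleStep {
  step_first : step_time xi 0%N = a ;
  step_last : step_time xi (step_size xi) = b ;
  step_increasing : forall k, (k < step_size xi)%N ->
    step_time xi k < step_time xi k.+1 ;
  step_adapted : forall k, (k < step_size xi)%N ->
    adapted_to (F (step_time xi k)) (step_val xi k) ;
  step_square_integrable : forall k, (k < step_size xi)%N ->
    ('E_P[(fun x => step_val xi k x ^+ 2)%R] < +oo)%E }.

Record is_ito_integrand (F : R -> set (set Om)) (a b : R) (f : R -> Om -> R)
    : Prop := IsItoIntegrand {
  integrand_measurable :
    measurable_fun (`[a, b] `*` [set: Om]) (fun z : R * Om => f z.1 z.2) ;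
  integrand_adapted : forall s, a <= s <= b -> adapted_to (F s) (f s) ;
  integrand_square_integrable :
    (\int[lebesgue_measure]_(s in `[a, b]) 'E_P[(fun x => f s x ^+ 2)%R]
       < +oo)%E }.

(* The random variable X is a version of the Ito integral of f dw over [a, b]:
   the mean-square limit of the integrals of adapted step processes
   approximating f in L^2([a, b] x Om). The integral is determined only up to
   almost sure equality, whence a relation rather than a function. *)
Definition is_ito_integral (F : R -> set (set Om)) (w : R -> Om -> R) (a b : R)
    (f : R -> Om -> R) (X : Om -> R) : Prop :=
  [/\ is_ito_integrand F a b f,
      measurable_fun setT X
    & exists xi : nat -> step_process,
      [/\ forall N, is_admissible_step F a b (xi N),
          (\int[lebesgue_measure]_(s in `[a, b])
             'E_P[(fun x => (step_eval (xi N) s x - f s x) ^+ 2)%R])%E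
            @[N --> \oo] --> 0%E
        & ('E_P[(fun x => (X x - step_integral w (xi N) x) ^+ 2)%R])%E
            @[N --> \oo] --> 0%E ] ].

(* X is a version of \int_t^T \int_t^s dw1_tau dw2_s. *)
Definition is_iterated_ito_integral (F : R -> set (set Om))
    (w1 w2 : R -> Om -> R) (t T : R) (X : Om -> R) : Prop :=
  exists J : R -> Om -> R,
    (forall s, t <= s <= T ->
       is_ito_integral F w1 t s (fun _ _ => 1) (J s)) /\
    is_ito_integral F w2 t T J X.

Definition is_levy_area (F : R -> set (set Om)) (m : nat)
    (w : 'I_m -> R -> Om -> R) (t T : R) (i1 i2 : 'I_m) (A : Om -> R) : Prop :=
  exists I12 I21 : Om -> R,
    [/\ is_iterated_ito_integral F (w i1) (w i2) t T I12,
        is_iterated_ito_integral F (w i2) (w i1) t T I21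
      & A = fun x => 2^-1 * (I12 x - I21 x)].

End StochasticIntegral.

Section OrthonormalSystems.
Context {R : realType}.

(* Rodrigues' formula, normalized so that the value at 1 is 1. *)
Definition legendre_poly (j : nat) : {poly R} :=
  ((2 ^ j * j`!)%N%:R)^-1 *: ((('X ^+ 2 - 1) ^+ j)^`(j)).

Definition legendre_system (t T : R) (j : nat) (s : R) : R :=
  Num.sqrt ((2 * j + 1)%N%:R / (T - t)) *
  (legendre_poly j).[(s - t - (T - t) / 2) * (2 / (T - t))].

(* uphalf j = r both for j = 2r - 1 and for j = 2r. *)
Definition trig_system (t T : R) (j : nat) (s : R) : R :=
  let arg := 2 * pi * (uphalf j)%:R * (s - t) / (T - t) in
  if j == 0%N then (Num.sqrt (T - t))^-1
  else Num.sqrt 2 / Num.sqrt (T - t) * (if odd j then sin arg else cos arg).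

End OrthonormalSystems.

Section Approximations.
Context {R : realType} {Om : Type} {m : nat}.
Implicit Type zeta : 'I_m -> nat -> Om -> R.

Definition levy_area_legendre (t T : R) zeta (i1 i2 : 'I_m) (q : nat) (x : Om)
    : R :=
  (T - t) / 2 *
  \sum_(1 <= i < q.+1)
    (Num.sqrt (4 * i%:R ^+ 2 - 1))^-1 *
    (zeta i1 i.-1 x * zeta i2 i x - zeta i1 i x * zeta i2 i.-1 x).

Definition levy_area_trig (t T : R) zeta (i1 i2 : 'I_m) (q : nat) (x : Om)
    : R :=
  (T - t) / (2 * pi) *
  \sum_(1 <= r < q.+1)
    (r%:R)^-1 *
    (zeta i1 (2 * r)%N x * zeta i2 (2 * r).-1 x
     - zeta i1 (2 * r).-1 x * zeta i2 (2 * r)%N x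
     + Num.sqrt 2 *
       (zeta i1 (2 * r).-1 x * zeta i2 0%N x
        - zeta i1 0%N x * zeta i2 (2 * r).-1 x)).

End Approximations.

(* Main.v *)
Require Import Defs.
From HB Require Import structures.
From mathcomp Require Import all_boot all_order all_algebra.
From mathcomp Require Import all_classical all_reals all_analysis.
From mathcomp Require Import measurable_realfun zify ring lra.

Set Implicit Arguments.
Unset Strict Implicit.
Unset Printing Implicit Defensive.

Import Order.TTheory GRing.Theory Num.Theory.
Import numFieldNormedType.Exports.

Local Open Scope classical_set_scope.
Local Open Scope ring_scope.

(** The Levy area is the double stochastic integral of the kernel sgn(y - x) / 2
    with respect to dw1(x) dw2(y), and each truncated expansion is the double
    integral of a truncated orthogonal expansion of that kernel, a sum of
    multiples beta p of the kernels
    phi p.1 (x) phi p.2 (y) - phi p.2 (x) phi p.1 (y) ([skew_sum]). The error is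
    therefore the double integral of the remaining part of the kernel, and its
    variance is the square of an L^2 norm, which by Pythagoras equals
    (T - t)^2 / 4 - 2 * sum of beta p ^ 2. It is enough to show that

    - this number is at most (T - t)^2 / q for the q-th expansion of either
      system ([legendre_coef_sum], where the sum telescopes, and
      [trig_coef_sum_le], where a quantitative form of zeta(2) = pi^2 / 6 is
      needed: [sum_inv_sqr_ge]);
    - the moment of order 2n of the error is at most a constant depending on n
      times the n-th power of this number ([levy_area_moment_le]).

    The moments of order 2n of the error are then O(q^(-n)), which is the
    convergence in mean; for n = 2 they are summable in q, so the fourth power of
    the error tends to zero almost surely ([mean_summable_cvg]).

    The moment bound is obtained by discretization. On a uniform grid the double
    integral becomes a bilinear form in the increments of the two components,
    whose coefficients are the values of the kernel at the nodes
    ([kernel_bilinearE]). The components being independent, the mean over the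
    second one can be taken with the first held fixed; a linear form in the
    increments is a centred normal variable, and what is left is the mean of a
    power of a weighted sum of squares of linear forms in the increments of the
    first component, which Jensen's inequality reduces to normal moments again
    ([grid_bilinear_moment_le]). When the grid is refined, the norm of the
    discretized kernel converges as a Riemann sum ([area_kernel_norm_cvg]), and
    the bilinear forms converge almost surely to the error along the grids with
    (r + 1)^2 steps ([kernel_bilinear_cvg]); Fatou's lemma concludes.

    The convergence of the bilinear forms rests on the Ito isometry for finite
    families of blocks, that is, of adapted coefficients on possibly overlapping
    intervals ([ito_isometry]): the sums over the grid are compared with the step
    processes that define the Ito integrals ([ito_integral_approx]). *)

(** * Means of integrable and square integrable random variables *)

Section Mean.
Context {R : realType} {d : measure_display} {Om : measurableType d}.
Variable P : probability Om R.
Implicit Types X Y : Om -> R.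

Definition inL1 X := P.-integrable setT (EFin \o X).
Definition mean X : R := fine ('E_P[X])%E.

Lemma inL1_measurable X : inL1 X -> measurable_fun setT X.
Proof. by move=> /integrableP[/measurable_EFinP]. Qed.

Lemma meanE X : inL1 X -> ('E_P[X] = (mean X)%:E)%E.
Proof.
move=> iX; rewrite /mean fineK// unlock.
exact: integrable_fin_num.
Qed.

Lemma eq_inL1 X Y : X =1 Y -> inL1 X -> inL1 Y.
Proof. by move=> /funext ->. Qed.

Lemma eq_mean X Y : X =1 Y -> mean X = mean Y.
Proof. by move=> /funext ->. Qed.

Lemma le_inL1 X Y : measurable_fun setT X -> inL1 Y ->
  (forall x, `|X x| <= Y x) -> inL1 X.
Proof.
move=> mX iY XY; apply: le_integrable iY => //; first exact/measurable_EFinP.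
by move=> x _ /=; rewrite lee_fin (le_trans (XY x))// ler_norm.
Qed.

Lemma inL1D X Y : inL1 X -> inL1 Y ->
  inL1 (fun x => X x + Y x).
Proof.
by move=> iX iY; apply: eq_integrable (integrableD measurableT iX iY).
Qed.

Lemma inL1Z (k : R) X : inL1 X -> inL1 (fun x => k * X x).
Proof. by move=> iX; exact: (integrableZl measurableT k iX). Qed.

Lemma inL1_cst (k : R) : inL1 (fun _ => k).
Proof. exact: finite_measure_integrable_cst. Qed.

Lemma inL1_sum (I : Type) (s : seq I) (X : I -> Om -> R) :
  (forall i, inL1 (X i)) -> inL1 (fun x => \sum_(i <- s) X i x).
Proof.
move=> iX; elim: s => [|i s ih].
  by apply: (eq_inL1 _ (inL1_cst 0)) => x; rewrite big_nil.
by apply: (eq_inL1 _ (inL1D (iX i) ih)) => x; rewrite big_cons.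
Qed.

Lemma meanD X Y : inL1 X -> inL1 Y ->
  mean (fun x => X x + Y x) = mean X + mean Y.
Proof.
move=> iX iY; rewrite /mean !unlock -fineD; try exact: integrable_fin_num.
by congr fine; rewrite -integralD//; exact: eq_integral.
Qed.

Lemma meanZ (k : R) X : inL1 X -> mean (fun x => k * X x) = k * mean X.
Proof.
move=> iX; rewrite /mean !unlock; under eq_integral do rewrite EFinM.
by rewrite (integralZl measurableT iX) fineM//; exact: integrable_fin_num.
Qed.

Lemma mean_cst (k : R) : mean (fun _ => k) = k.
Proof. by rewrite /mean expectation_cst. Qed.

Lemma meanB X Y : inL1 X -> inL1 Y ->
  mean (fun x => X x - Y x) = mean X - mean Y.
Proof.
move=> iX iY; rewrite -[in RHS](mulN1r (mean Y)) -meanZ// -meanD//.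
  by apply: eq_mean => x; rewrite mulN1r.
exact: inL1Z.
Qed.

Lemma mean_sum (I : Type) (s : seq I) (X : I -> Om -> R) :
  (forall i, inL1 (X i)) ->
  mean (fun x => \sum_(i <- s) X i x) = \sum_(i <- s) mean (X i).
Proof.
move=> iX; elim: s => [|i s ih].
  rewrite big_nil -[RHS](mean_cst 0).
  by apply: eq_mean => x; rewrite big_nil.
rewrite big_cons -ih -meanD//; last exact: inL1_sum.
by apply: eq_mean => x; rewrite big_cons.
Qed.

Lemma mean_ge0 X : (forall x, 0 <= X x) -> 0 <= mean X.
Proof. by move=> X0; apply/fine_ge0/expectation_ge0. Qed.

Lemma le_mean X Y : inL1 X -> inL1 Y -> (forall x, X x <= Y x) ->
  mean X <= mean Y.
Proof.
move=> iX iY XY; rewrite -subr_ge0 -meanB//.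
by apply: mean_ge0 => x; rewrite subr_ge0.
Qed.

Definition inL2 X :=
  measurable_fun setT X /\ inL1 (fun x => X x ^+ 2).

Lemma ltoo_inL2 X : measurable_fun setT X ->
  ('E_P[(fun x => X x ^+ 2)%R] < +oo)%E -> inL2 X.
Proof.
move=> mX X2; split=> //; apply/integrableP; split.
  exact/measurable_EFinP/measurable_funX.
apply: le_lt_trans X2; rewrite unlock le_eqVlt; apply/orP; left; apply/eqP.
by apply: eq_integral => x _ /=; rewrite ger0_norm// sqr_ge0.
Qed.

Lemma inL2M X Y : inL2 X -> inL2 Y ->
  inL1 (fun x => X x * Y x).
Proof.
move=> [mX iX] [mY iY]; apply: (le_inL1 _ (inL1D iX iY)) => [|x].
  exact: measurable_funM.
rewrite normrM -[X x ^+ 2]real_normK ?num_real// -[Y x ^+ 2]real_normK ?num_real//.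
by have := sqr_ge0 (`|X x| - `|Y x|); have := sqr_ge0 (`|X x| + `|Y x|); nra.
Qed.

Lemma inL2_cst (k : R) : inL2 (fun _ => k).
Proof. by split => //; exact: inL1_cst. Qed.

Lemma inL2D X Y : inL2 X -> inL2 Y ->
  inL2 (fun x => X x + Y x).
Proof.
move=> iX iY; split; first by apply: measurable_funD; [case: iX|case: iY].
have XY := inL2M iX iY; move: iX iY => [_ iX] [_ iY].
apply: (eq_inL1 _ (inL1D (inL1D iX iY) (inL1Z 2 XY))) => x.
by ring.
Qed.

Lemma inL2Z (k : R) X : inL2 X -> inL2 (fun x => k * X x).
Proof.
move=> [mX iX]; split; first exact: measurable_funM.
by apply: (eq_inL1 _ (inL1Z (k ^+ 2) iX)) => x; rewrite exprMn.
Qed.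

Lemma inL2_sum (I : Type) (s : seq I) (Q : pred I) (X : I -> Om -> R) :
  (forall i, Q i -> inL2 (X i)) ->
  inL2 (fun x => \sum_(i <- s | Q i) X i x).
Proof.
move=> iX; elim: s => [|i s ih].
  have [m0 i0] := inL2_cst 0.
  by split; under eq_fun do rewrite big_nil.
have [Qi|nQi] := boolP (Q i).
  have [mS iS] := inL2D (iX _ Qi) ih.
  by split; under eq_fun do rewrite big_cons Qi.
by have [mS iS] := ih; split; under eq_fun do rewrite big_cons (negbTE nQi).
Qed.

(** Stated for expectations with values in the extended reals, so that it serves
    to prove that its left-hand side is finite. *)
Lemma expectation_sqrD_le X Y :
  measurable_fun setT X -> measurable_fun setT Y ->
  ('E_P[(fun x => (X x + Y x) ^+ 2)%R] <=
   2%:E * 'E_P[(fun x => X x ^+ 2)%R] + 2%:E * 'E_P[(fun x => Y x ^+ 2)%R])%E.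
Proof.
move=> mX mY; rewrite unlock.
have m2 (Z : Om -> R) : measurable_fun setT Z ->
    measurable_fun setT (fun x => (Z x ^+ 2)%:E).
  by move=> mZ; exact/measurable_EFinP/measurable_funX.
rewrite -ge0_integralZl//=; [|exact: m2|by move=> x _; rewrite lee_fin sqr_ge0].
rewrite -ge0_integralZl//=; [|exact: m2|by move=> x _; rewrite lee_fin sqr_ge0].
rewrite -ge0_integralD//=.
- apply: ge0_le_integral => //=.
  + by move=> x _; rewrite lee_fin sqr_ge0.
  + by apply: m2; exact: measurable_funD.
  + by apply: emeasurable_funD; apply: measurable_funeM; exact: m2.
  + move=> x _; rewrite -!EFinM -EFinD lee_fin.
    by have := sqr_ge0 (X x - Y x); nra.
- by move=> x _; rewrite mule_ge0// lee_fin sqr_ge0.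
- by apply: measurable_funeM; exact: m2.
- by move=> x _; rewrite mule_ge0// lee_fin sqr_ge0.
- by apply: measurable_funeM; exact: m2.
Qed.

End Mean.

(** * Independence and means of products *)

Section Adapted.
Context {R : realType} {d : measure_display} {Om : measurableType d}.
Implicit Types (G : set (set Om)) (X Y : Om -> R).

Lemma adapted_toP G X :
  adapted_to G X <-> forall B : set R, measurable B -> G (X @^-1` B).
Proof.
split=> [GX B mB|GX _ [B mB <-]]; last by rewrite setTI; exact: GX.
by apply: GX; exists B => //; rewrite setTI.
Qed.

Lemma adapted_toE G X : sigma_algebra setT G ->
  adapted_to G X <-> measurable_fun (setT : set (g_sigma_algebraType G)) X.
Proof.
move=> sG; have GE : <<s G >> = G by exact: sigma_algebra_id.
split=> [/adapted_toP GX _ B mB|mX].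
  by rewrite setTI /measurable/= /measurable/= GE; exact: GX.
apply/adapted_toP => B mB; have := mX measurableT _ mB.
by rewrite setTI /measurable/= /measurable/= GE.
Qed.

Lemma adapted_cst G (k : R) : sigma_algebra setT G ->
  adapted_to G (fun _ => k).
Proof. by move=> sG; apply/adapted_toE. Qed.

Lemma adaptedD G X Y : sigma_algebra setT G -> adapted_to G X ->
  adapted_to G Y -> adapted_to G (fun x => X x + Y x).
Proof.
move=> sG /(adapted_toE _ sG) mX /(adapted_toE _ sG) mY.
by apply/(adapted_toE _ sG); exact: measurable_funD.
Qed.

Lemma adaptedM G X Y : sigma_algebra setT G -> adapted_to G X ->
  adapted_to G Y -> adapted_to G (fun x => X x * Y x).
Proof.
move=> sG /(adapted_toE _ sG) mX /(adapted_toE _ sG) mY.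
by apply/(adapted_toE _ sG); exact: measurable_funM.
Qed.

Lemma adaptedB G X Y : sigma_algebra setT G -> adapted_to G X ->
  adapted_to G Y -> adapted_to G (fun x => X x - Y x).
Proof.
move=> sG /(adapted_toE _ sG) mX /(adapted_toE _ sG) mY.
by apply/(adapted_toE _ sG); exact: measurable_funB.
Qed.

Lemma adaptedX G X n : sigma_algebra setT G -> adapted_to G X ->
  adapted_to G (fun x => X x ^+ n).
Proof.
move=> sG /(adapted_toE _ sG) mX.
by apply/(adapted_toE _ sG); exact: measurable_funX.
Qed.

Lemma adapted_sum G (I : Type) (s : seq I) (X : I -> Om -> R) :
  sigma_algebra setT G -> (forall i, adapted_to G (X i)) ->
  adapted_to G (fun x => \sum_(i <- s) X i x).
Proof.
move=> sG GX; elim: s => [|i s ih].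
  by under eq_fun do rewrite big_nil; exact: adapted_cst.
by under eq_fun do rewrite big_cons; exact: adaptedD.
Qed.

Lemma adapted_prod G (I : Type) (s : seq I) (X : I -> Om -> R) :
  sigma_algebra setT G -> (forall i, adapted_to G (X i)) ->
  adapted_to G (fun x => \prod_(i <- s) X i x).
Proof.
move=> sG GX; elim: s => [|i s ih].
  by under eq_fun do rewrite big_nil; exact: adapted_cst.
by under eq_fun do rewrite big_cons; exact: adaptedM.
Qed.

Lemma adapted_measurable G X : G `<=` measurable -> adapted_to G X ->
  measurable_fun setT X.
Proof. by move=> Gm /adapted_toP GX _ B mB; rewrite setTI; exact/Gm/GX. Qed.

Lemma adapted_sub G G' X : G `<=` G' -> adapted_to G X -> adapted_to G' X.
Proof. by move=> GG' GX A /GX /GG'. Qed.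

End Adapted.

Section Independence.
Context {R : realType} {d : measure_display} {Om : measurableType d}.
Variable P : probability Om R.
Implicit Types X Y : Om -> R.

(** Under independence the law of the pair is the product of the laws, and
    Fubini applies. *)
Lemma independent_meanM (G H : set (set Om)) X Y :
  independent2 P G H -> adapted_to G X -> adapted_to H Y ->
  inL1 P X -> inL1 P Y ->
  inL1 P (fun x => X x * Y x) /\
  mean P (fun x => X x * Y x) = mean P X * mean P Y.
Proof.
move=> GH GX HY iX iY.
have mX := inL1_measurable iX; have mY := inL1_measurable iY.
pose X' : {mfun Om >-> R} := HB.pack X (isMeasurableFun.Build _ _ _ _ _ mX).
pose Y' : {mfun Om >-> R} := HB.pack Y (isMeasurableFun.Build _ _ _ _ _ mY).
have mXY : measurable_fun setT (fun x => (X x, Y x)) by exact: measurable_fun_pair.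
pose XY : {mfun Om >-> (R * R)%type} :=
  HB.pack (fun x => (X x, Y x)) (isMeasurableFun.Build _ _ _ _ _ mXY).
pose m1 := distribution P X'; pose m2 := distribution P Y'.
have lawE : forall B, measurable B -> (m1 \x m2)%E B = distribution P XY B.
  apply: product_measure_unique => A B mA mB.
  apply: (GH (X @^-1` A) (Y @^-1` B)).
  - by move/adapted_toP : GX; exact.
  - by move/adapted_toP : HY; exact.
have mM : measurable_fun setT (fun z : R * R => (z.1 * z.2)%:E).
  by apply/measurable_EFinP/measurable_funM.
have mean1 (Z : Om -> R) (mZ : measurable_fun setT Z)
    (Z' := HB.pack Z (isMeasurableFun.Build _ _ _ _ _ mZ) : {mfun Om >-> R}) :
    inL1 P Z -> (\int[distribution P Z']_y y%:E = (mean P Z)%:E)%E.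
  move=> iZ; rewrite (@integral_distribution _ _ _ _ _ P Z' EFin).
  - by rewrite -meanE// unlock.
  - by exact/measurable_EFinP.
  - exact: iZ.
have abs1 (Z : Om -> R) (mZ : measurable_fun setT Z)
    (Z' := HB.pack Z (isMeasurableFun.Build _ _ _ _ _ mZ) : {mfun Om >-> R}) :
    inL1 P Z ->
    (\int[distribution P Z']_y `|y|%:E < +oo)%E.
  move=> iZ; rewrite (@ge0_integral_distribution _ _ _ _ _ P Z'
    (fun y => `|y|%:E))//; first by move/integrableP : iZ => [_].
  by apply/measurable_EFinP; exact: normr_measurable.
have iM : (m1 \x m2)%E.-integrable setT (fun z : R * R => (z.1 * z.2)%:E).
  have inner x : (\int[m2]_y `|(x * y)%:E| = `|x|%:E * \int[m2]_y `|y|%:E)%E.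
    rewrite -ge0_integralZl//=.
    - by apply: eq_integral => y _; rewrite normrM EFinM.
    - by apply/measurable_EFinP; exact: normr_measurable.
  apply/integrable12ltyP => //=.
  under eq_integral do rewrite inner.
  rewrite ge0_integralZr//=.
  - rewrite lte_mul_pinfty//; [exact: integral_ge0| |exact: abs1].
    by rewrite ge0_fin_numE; [exact: abs1|exact: integral_ge0].
  - by apply/measurable_EFinP; exact: normr_measurable.
  - exact: integral_ge0.
have iXY : inL1 P (fun x => X x * Y x).
  apply/integrableP; split; first exact/measurable_EFinP/measurable_funM.
  rewrite -(@ge0_integral_distribution _ _ _ _ _ P XY
    (fun z => `|z.1 * z.2|%:E))//; last first.
    exact/measurable_EFinP/measurableT_comp/measurable_EFinP.
  rewrite (eq_measure_integral (m1 \x m2)%E); last first.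
    by move=> A mA _; exact/esym/lawE.
  by move/integrableP : iM => [_].
split=> //; apply/EFin_inj; rewrite -meanE// EFinM.
rewrite unlock -(@integral_distribution _ _ _ _ _ P XY
  (fun z => (z.1 * z.2)%:E))//.
rewrite (eq_measure_integral (m1 \x m2)%E); last first.
    by move=> A mA _; exact/esym/lawE.
rewrite -(integral12_prod_meas1 iM) /fubini_F/=.
have int1 (Z : Om -> R) (mZ : measurable_fun setT Z)
    (Z' := HB.pack Z (isMeasurableFun.Build _ _ _ _ _ mZ) : {mfun Om >-> R}) :
    inL1 P Z -> (distribution P Z').-integrable setT (EFin : R -> \bar R).
  move=> iZ; apply/integrableP; split; last exact: abs1.
  exact/measurable_EFinP.
under eq_integral => x _ do
  (under eq_integral do rewrite EFinM;
    rewrite (integralZl measurableT (int1 _ mY iY))// (mean1 _ mY iY)).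
by rewrite (integralZr measurableT (int1 _ mX iX))// (mean1 _ mX iX).
Qed.

End Independence.

(** * Moments of the centred normal distribution *)

Section Calculus.
Context {R : realType}.
Implicit Types (f F : R -> R) (x y a b : R).

Lemma is_derive_continuous F f : (forall x, is_derive x 1 F (f x)) ->
  continuous F.
Proof.
move=> dF x; apply: differentiable_continuous; apply/derivable1_diffP.
by have := dF x; case.
Qed.

Lemma FTC_is_derive F f a b : a < b -> continuous f ->
  (forall x, is_derive x 1 F (f x)) ->
  (\int[lebesgue_measure]_(x in `[a, b]) (f x)%:E = (F b - F a)%:E)%E.
Proof.
move=> ab cf dF; have cF := is_derive_continuous dF.
rewrite EFinB; apply: continuous_FTC2 => //.
- exact: continuous_subspaceT.
- split.
  + by move=> x _; have := dF x; case.
  + exact/cvg_at_right_filter/cF.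
  + exact/cvg_at_left_filter/cF.
- by move=> x _; rewrite derive1E; have [] := dF x.
Qed.

Lemma is_derive_MVT F f a b : a <= b ->
  (forall x, is_derive x 1 F (f x)) ->
  exists2 c, a <= c <= b & F b - F a = f c * (b - a).
Proof.
move=> ab dF; have [c cab e] := MVT_segment ab (fun x _ => dF x)
  (continuous_subspaceT (is_derive_continuous dF)).
by exists c => //; rewrite in_itv/= in cab.
Qed.

End Calculus.

Section NormalMoments.
Context {R : realType}.
Notation mu := (@lebesgue_measure R).

(** The moment of order n of the centred normal law of variance v, that is,
    (n - 1)!! * v ^ (n / 2) for even n and 0 for odd n. *)
Fixpoint gauss_moment (v : R) (n : nat) {struct n} : R :=
  match n with
  | 0 => 1
  | 1 => 0
  | (k.+1 as m).+1 => m%:R * v * gauss_moment v k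
  end.

Lemma gauss_momentSS v n :
  gauss_moment v n.+2 = n.+1%:R * v * gauss_moment v n.
Proof. by []. Qed.

Lemma integral_normal_prob (m s : R) (f : R -> \bar R) :
  (normal_prob m s).-integrable setT f ->
  (\int[normal_prob m s]_x f x = \int[mu]_x (f x * (normal_pdf m s x)%:E))%E.
Proof.
move=> intf; have domN := normal_prob_dominates m s.
have mf := measurable_int _ intf.
rewrite -(Radon_Nikodym_change_of_variables domN)//=.
apply: ae_eq_integral => //.
- apply: emeasurable_funM => //; exact: (measurable_int mu).
- apply: emeasurable_funM => //; apply/measurable_EFinP.
  exact: measurable_normal_pdf.
- apply: ae_eqe_mul2l => /=; rewrite Radon_NikodymE//=.
  case: cid => /= h [h1 h2 h3].
  apply: integral_ae_eq => //=.
  + by apply/measurable_EFinP; exact: measurable_normal_pdf.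
  + by move=> E _ mE; rewrite -h3.
Qed.

Lemma expR_pow_le (y : R) n : 0 <= y -> y ^+ n <= n`!%:R * expR y.
Proof.
move=> y0; case: n => [|n].
  by rewrite expr0 fact0 mul1r -[leLHS]expR0 ler_expR.
have := expR_ge1Dxn n y0.
rewrite -ler_pdivrMl ?ltr0n ?fact_gt0// mulrC => /(le_trans _); apply.
by rewrite lerDr.
Qed.

(** With y = x^2 / (4 s^2) the Gaussian factor exp (- 2 y) is exp (- y) ^ 2: one
    factor absorbs the power of x and the other is a Gaussian of variance
    2 s^2. *)
Lemma normal_fun_pow_le (s x : R) n : 0 < s ->
  `|x| ^+ n * normal_fun 0 s x <=
  (1 + (4 * s ^+ 2) ^+ n * n`!%:R) * normal_fun 0 (Num.sqrt 2 * s) x.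
Proof.
move=> s0; rewrite /normal_fun subr0.
set y := x ^+ 2 / (4 * s ^+ 2).
have s2 : 4 * s ^+ 2 != 0 by rewrite mulf_neq0// expf_neq0// gt_eqF.
have y0 : 0 <= y by rewrite divr_ge0 ?sqr_ge0// mulr_ge0// sqr_ge0.
have -> : - x ^+ 2 / (s ^+ 2 *+ 2) = - y - y.
  by rewrite /y -mulr_natl; field; rewrite gt_eqF.
have -> : - x ^+ 2 / ((Num.sqrt 2 * s) ^+ 2 *+ 2) = - y.
  rewrite /y exprMn sqr_sqrtr// -mulr_natl; field; by rewrite gt_eqF.
rewrite expRD mulrA ler_wpM2r ?expR_ge0//.
have xy : x ^+ 2 = 4 * s ^+ 2 * y by rewrite /y mulrC divfK.
have x1 : `|x| ^+ n <= 1 + (x ^+ 2) ^+ n.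
  rewrite -real_normK ?num_real// -exprM mulnC exprM.
  by have := sqr_ge0 (`|x| ^+ n - 1); have := exprn_ge0 n (normr_ge0 x); nra.
apply: (@le_trans _ _ ((1 + (x ^+ 2) ^+ n) * expR (- y))).
  by rewrite ler_wpM2r ?expR_ge0.
rewrite mulrDl mul1r lerD//.
  by rewrite -[leRHS]expR0 ler_expR oppr_le0.
have ey : y ^+ n * expR (- y) <= n`!%:R.
  by rewrite expRN ler_pdivrMr ?expR_gt0// expR_pow_le.
by rewrite xy exprMn -mulrA ler_wpM2l// exprn_ge0// mulr_ge0// sqr_ge0.
Qed.

Lemma normal_fun_integrable (s : R) n : 0 < s ->
  mu.-integrable setT (fun x => (x ^+ n * normal_fun 0 s x)%:E).
Proof.
move=> s0; set C := 1 + (4 * s ^+ 2) ^+ n * n`!%:R.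
set s' := Num.sqrt 2 * s.
have s'0 : s' != 0 by rewrite gt_eqF// mulr_gt0// sqrtr_gt0.
have iN : mu.-integrable setT (fun x => (C / normal_peak s')%:E *
    (normal_pdf 0 s' x)%:E)%E.
  by apply: integrableZl => //; exact: integrable_normal_pdf.
apply: le_integrable iN => //.
  apply/measurable_EFinP/measurable_funM; first exact: measurable_funX.
  exact: measurable_normal_fun.
move=> x _; rewrite -EFinM !abse_EFin lee_fin normal_pdfE//.
rewrite mulrA divfK ?gt_eqF ?normal_peak_gt0//.
rewrite !normrM normrX [`|normal_fun _ _ _|]ger0_norm ?normal_fun_ge0//.
rewrite [`|normal_fun _ _ _|]ger0_norm ?normal_fun_ge0//.
apply: (le_trans (normal_fun_pow_le x n s0)).
by rewrite ler_wpM2r ?normal_fun_ge0// ler_norm.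
Qed.

Lemma integral_symmetric_itv_cvg (g : R -> R) :
  mu.-integrable setT (EFin \o g) ->
  (\int[mu]_(x in `[(- n.+1%:R)%R, n.+1%:R%R]) (g x)%:E)%E @[n --> \oo] -->
  (\int[mu]_x (g x)%:E)%E.
Proof.
move=> ig; have mg := measurable_int _ ig.
pose gn n x := ((g \_ `[- n.+1%:R, n.+1%:R]%classic) x)%:E : \bar R.
have gnE n : (\int[mu]_(x in `[(- n.+1%:R)%R, n.+1%:R%R]) (g x)%:E =
    \int[mu]_x gn n x)%E.
  by rewrite integral_mkcond; apply: eq_integral => x _; rewrite restrict_EFin.
under eq_fun do rewrite gnE.
have mgn n : measurable_fun setT (gn n).
  apply/measurable_EFinP/(measurable_restrictT _ _).1 => //.
  by apply: measurable_funTS; exact/measurable_EFinP.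
have gn_cvg : {ae mu, forall x, setT x -> gn n x @[n --> \oo] --> (g x)%:E}.
  apply: aeW => x _; apply: cvg_near_cst; near=> n.
  rewrite /gn patchE ifT// inE/= in_itv/= -ler_norml.
  apply: ltW; apply: (@lt_le_trans _ _ n%:R); last by rewrite ler_nat.
  by near: n; exact: nbhs_infty_gtr.
have gn_le : {ae mu, forall x, forall n, setT x -> (`|gn n x| <= `|g x|%:E)%E}.
  apply: aeW => x n _; rewrite /gn patchE /=; case: ifPn => // _.
  by rewrite normr0 lee_fin.
have ig' : mu.-integrable setT (fun x => `|g x|%:E) by exact: integrable_abse ig.
by have [_ _] := @dominated_convergence _ _ _ mu setT measurableT gn (EFin \o g)
  _ mgn mg gn_cvg ig' gn_le.
Unshelve. all: by end_near. Qed.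

Lemma integral_is_derive_eq0 (G g : R -> R) :
  (forall x : R, is_derive x 1 G (g x)) -> continuous g ->
  mu.-integrable setT (EFin \o g) ->
  (G n.+1%:R - G (- n.+1%:R)) @[n --> \oo] --> (0 : R) ->
  (\int[mu]_x (g x)%:E = 0)%E.
Proof.
move=> dG cg ig G0; have := integral_symmetric_itv_cvg ig.
have gE (k : nat) : (\int[mu]_(x in `[(- k.+1%:R)%R, k.+1%:R%R]) (g x)%:E =
    (G k.+1%:R - G (- k.+1%:R))%:E)%E.
  by apply: FTC_is_derive => //; rewrite gtrN.
under eq_fun do rewrite gE.
move/(@cvg_unique _ (@ereal_hausdorff R)); apply.
by apply: cvg_EFin G0; exact: nearW.
Qed.

Lemma normal_fun_is_derive0 (s x : R) : 0 < s ->
  is_derive x 1 (normal_fun 0 s) (- (s ^- 2 * (x * normal_fun 0 s x))).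
Proof.
move=> s0.
have dq : is_derive x 1 (fun y : R => - (y - 0) ^+ 2 / (s ^+ 2 *+ 2))
    (- (s ^- 2 * x)).
  apply: is_derive_eq; rewrite /GRing.scale/= !subr0 -mulr_natl.
  by field; rewrite gt_eqF.
have := @is_derive1_comp _ expR _ _ _ _ (is_derive_expR _) dq.
by move/is_derive_eq; apply; rewrite mulrC mulNr -mulrA.
Qed.

Lemma continuous_pow_normal_fun (s : R) k :
  continuous (fun x : R => x ^+ k * normal_fun 0 s x).
Proof.
move=> x; apply: cvgM; first exact: exprn_continuous.
apply: (cvg_comp _ expR); last exact: continuous_expR.
apply: cvgM; last exact: cvg_cst.
apply: cvgN; under eq_fun do rewrite subr0; rewrite subr0.
exact: exprn_continuous.
Qed.

Lemma normal_fun_is_derive (s x : R) n : 0 < s ->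
  is_derive x 1 (fun y => y ^+ n.+1 * normal_fun 0 s y)
    (n.+1%:R * (x ^+ n * normal_fun 0 s x)
     - s ^- 2 * (x ^+ n.+2 * normal_fun 0 s x)).
Proof.
move=> s0.
have dN := normal_fun_is_derive0 x s0.
have dX : is_derive x 1 (fun y : R => y ^+ n.+1) (n.+1%:R * x ^+ n).
  apply: DeriveDef; first exact: exprn_derivable.
  by rewrite exp_derive /GRing.scale/= mulr1.
have := @is_deriveM _ _ (fun y : R => y ^+ n.+1) (normal_fun 0 s) x 1 _ _ dX dN.
move=> /is_derive_eq; apply; rewrite /GRing.scale/= !exprS.
by ring.
Qed.

Lemma normal_fun_moment_rec (s : R) n : 0 < s ->
  (\int[mu]_x (x ^+ n.+2 * normal_fun 0 s x)%:E =
   (n.+1%:R * s ^+ 2)%:E * \int[mu]_x (x ^+ n * normal_fun 0 s x)%:E)%E.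
Proof.
move=> s0; set h := fun (k : nat) x => x ^+ k * normal_fun 0 s x.
have ih k : mu.-integrable setT (EFin \o h k) by exact: normal_fun_integrable.
pose g x := n.+1%:R * h n x - s ^- 2 * h n.+2 x.
have ig : mu.-integrable setT (EFin \o g).
  by apply: eq_integrable (integrableB measurableT
    (integrableZl measurableT n.+1%:R (ih n))
    (integrableZl measurableT (s ^- 2) (ih n.+2))).
have ch k : continuous (h k) by exact: continuous_pow_normal_fun.
have cg : continuous g.
  by move=> x; apply: cvgB; (apply: cvgM; [exact: cvg_cst|exact: ch]).
pose C := 1 + (4 * s ^+ 2) ^+ n.+2 * n.+2`!%:R.
have h_le x : 0 < `|x| -> `|h n.+1 x| <= C * `|x|^-1.
  move=> x0; rewrite ler_pdivlMr// /h normrM normrX.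
  rewrite [`|normal_fun _ _ _|]ger0_norm ?normal_fun_ge0// mulrAC -exprSr.
  apply: (le_trans (normal_fun_pow_le x n.+2 s0)).
  rewrite ler_piMr//.
    by rewrite addr_ge0// mulr_ge0// exprn_ge0// mulr_ge0// sqr_ge0.
  rewrite -[leRHS]expR0 ler_expR mulNr oppr_le0 divr_ge0// ?sqr_ge0//.
  by rewrite mulrn_wge0// sqr_ge0.
have h_cvg : (h n.+1 k.+1%:R - h n.+1 (- k.+1%:R)) @[k --> \oo] --> (0 : R).
  apply/norm_cvg0P; apply: (@squeeze_cvgr _ _ _ _ (fun=> 0) (fun k => 2 * C * harmonic k)).
  - apply: nearW => k; rewrite normr_ge0/= (le_trans (ler_normB _ _))//.
    have k0 : 0 < `|k.+1%:R : R| by rewrite normr_gt0.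
    have k0' : 0 < `|- k.+1%:R : R| by rewrite normrN.
    have := h_le _ k0; have := h_le _ k0'; rewrite normrN /harmonic/=.
    rewrite [`|k.+1%:R|]ger0_norm// -mulrA; set c := C * _ => h1 h2.
    by rewrite mulr_natl mulr2n lerD.
  - exact: cvg_cst.
  - rewrite -[X in _ --> X](mulr0 (2 * C)); apply: cvgM; first exact: cvg_cst.
    exact: cvg_harmonic.
have int_g : (\int[mu]_x (g x)%:E = 0)%E.
  by apply: integral_is_derive_eq0 h_cvg => // x; exact: normal_fun_is_derive.
have fin k := integrable_fin_num measurableT (ih k).
have : (\int[mu]_x (g x)%:E =
    n.+1%:R%:E * (\int[mu]_x (h n x)%:E) - (s ^- 2)%:E * (\int[mu]_x (h n.+2 x)%:E))%E.
  rewrite -(integralZl measurableT (ih n)) -(integralZl measurableT (ih n.+2)).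
  by rewrite -integralB//; exact: integrableZl.
rewrite int_g -(fineK (fin n)) -(fineK (fin n.+2)) -!EFinM -EFinB => -[e].
congr EFin; apply: (mulfI (x := s ^- 2)); first by rewrite invr_neq0// expf_neq0// gt_eqF.
move/eqP: e; rewrite eq_sym subr_eq0 => /eqP <-.
by field; rewrite gt_eqF.
Qed.

(** Integration by parts against the density gives the recursion
    E Z^(n+2) = (n+1) s^2 E Z^n. *)
Lemma normal_prob_moment (s : R) n : 0 < s ->
  (normal_prob 0 s).-integrable setT (fun x => (x ^+ n)%:E) /\
  (\int[normal_prob 0 s]_x (x ^+ n)%:E = (gauss_moment (s ^+ 2) n)%:E)%E.
Proof.
move=> s0; have s'0 : s != 0 by rewrite gt_eqF.
have pE (f : R) x : (f%:E * (normal_pdf 0 s x)%:E =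
    (normal_peak s)%:E * (f * normal_fun 0 s x)%:E)%E.
  by rewrite normal_pdfE// -!EFinM mulrCA.
have int_pow k : (normal_prob 0 s).-integrable setT (fun x => (x ^+ k)%:E).
  pose fn (j : nat) (x : R) := (`|x| ^+ k * \1_(`[(- j%:R : R), j%:R]%classic) x)%:E.
  have mfn j : measurable_fun setT (fn j).
    apply/measurable_EFinP/measurable_funM; last exact: measurable_indic.
    by apply: measurable_funX; exact: normr_measurable.
  have fn0 j x : (0 <= fn j x)%E by rewrite lee_fin mulr_ge0.
  have fn_le j x : (fn j x <= (`|x| ^+ k)%:E)%E.
    by rewrite lee_fin ler_piMr// indicE lern1 leq_b1.
  have ifn j : (normal_prob 0 s).-integrable setT (fn j).
    have ij : (normal_prob 0 s).-integrable setT (cst (j%:R ^+ k)%:E).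
      exact: finite_measure_integrable_cst.
    apply: le_integrable ij; [exact: measurableT|exact: mfn|move=> x _].
    rewrite gee0_abs// lee_fin /=.
    rewrite [leRHS]ger0_norm ?exprn_ge0// indicE.
    case: (boolP (x \in _)) => [|_]; last by rewrite mulr0 exprn_ge0.
    rewrite inE/= in_itv/= -ler_norml => xj.
    by rewrite mulr1 lerXn2r// nnegrE.
  have fn_int j : (\int[normal_prob 0 s]_x fn j x <=
      (normal_peak s)%:E * \int[mu]_x `|(x ^+ k * normal_fun 0 s x)%:E|)%E.
    rewrite integral_normal_prob// -integralZl//; last first.
      exact/integrable_abse/normal_fun_integrable.
    have mabs : measurable_fun setT
        (fun x : R => `|(x ^+ k * normal_fun 0 s x)%:E|%E).
      apply: measurableT_comp => //.
      exact: (measurable_int mu (normal_fun_integrable k s0)).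
    apply: ge0_le_integral => //.
    - move=> x _; apply: mule_ge0; first exact: fn0.
      by rewrite lee_fin normal_pdf_ge0.
    - apply: emeasurable_funM; first exact: mfn.
      by apply/measurable_EFinP; exact: measurable_normal_pdf.
    - exact: measurable_funeM.
    - move=> x _; rewrite /fn pE lee_fin.
      rewrite ler_wpM2l ?normal_peak_ge0// normrM normrX.
      rewrite [X in _ <= _ * X]ger0_norm ?normal_fun_ge0//.
      by rewrite ler_wpM2r ?normal_fun_ge0// -lee_fin fn_le.
  apply/integrableP; split; first exact/measurable_EFinP/measurable_funX.
  have fn_nd x : setT x -> {homo fn^~ x : i j / (i <= j)%N >-> (i <= j)%E}.
    move=> _ i j ij; rewrite lee_fin ler_wpM2l ?exprn_ge0//.
    rewrite !indicE; case: (boolP (x \in _)) => //.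
    rewrite inE/= in_itv/= -ler_norml => xi.
    rewrite mem_set//= in_itv/= -ler_norml (le_trans xi)// ler_nat//.
  have fn_lim x : (`|(x ^+ k)%:E| = limn (fn^~ x))%E.
    apply/esym/cvg_lim => //; apply: cvg_near_cst; near=> j.
    rewrite /fn indicE mem_set ?mulr1/= ?normrX// in_itv/= -ler_norml.
    by apply: ltW; near: j; exact: nbhs_infty_gtr.
  under eq_integral do rewrite fn_lim.
  apply: (@le_lt_trans _ _ ((normal_peak s)%:E *
      \int[mu]_x `|(x ^+ k * normal_fun 0 s x)%:E|)%E).
    have cv := cvg_monotone_convergence (mu := normal_prob 0 s) measurableT mfn
      (fun j x _ => fn0 j x) fn_nd.
    rewrite -(cvg_lim _ cv)//; apply: lime_le; first by apply/cvg_ex; eexists; exact: cv.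
    exact: nearW.
  have [_ fin] := integrableP _ _ _ (normal_fun_integrable k s0).
  rewrite lte_mul_pinfty// ?lee_fin ?normal_peak_ge0//.
split=> //.
have int_powE k : (\int[normal_prob 0 s]_x (x ^+ k)%:E =
    (normal_peak s)%:E * \int[mu]_x (x ^+ k * normal_fun 0 s x)%:E)%E.
  rewrite integral_normal_prob//.
  under eq_integral do rewrite pE.
  by rewrite integralZl//; exact: normal_fun_integrable.
elim/ltn_ind: n => -[|[|n]] ih.
- under eq_integral do rewrite expr0.
  by rewrite integral_cst//= probability_setT mule1.
- rewrite int_powE [X in (_ * X)%E](_ : _ = 0%E) ?mule0//=.
  apply: (@integral_is_derive_eq0 (fun x => - s ^+ 2 * normal_fun 0 s x)).
  + move=> x; have := @is_deriveZ _ _ _ _ (- s ^+ 2) x 1 _ (normal_fun_is_derive0 x s0).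
    move/is_derive_eq; apply.
    by rewrite /GRing.scale/= expr1; field.
  + exact: continuous_pow_normal_fun.
  + exact: normal_fun_integrable.
  + apply: cvg_near_cst; apply: nearW => k.
    by rewrite /normal_fun !subr0 sqrrN subrr.
- rewrite int_powE normal_fun_moment_rec// muleCA -int_powE ih// gauss_momentSS.
Unshelve. all: by end_near. Qed.

End NormalMoments.

(** * Increments of a Wiener process *)

Section Increments.
Context {R : realType} {d : measure_display} {Om : measurableType d}.
Context {P : probability Om R} {F : R -> set (set Om)} {m : nat}
  {w : 'I_m -> R -> Om -> R}.
Hypotheses (hF : is_filtration F) (hw : is_wiener P F w).
Implicit Types (i j : 'I_m) (a b c u s : R) (U V : Om -> R).

Definition incr i a b : Om -> R := fun x => w i b x - w i a x.

Lemma adapted_wiener i s u : 0 <= s -> s <= u -> adapted_to (F u) (w i s).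
Proof.
move=> s0 su; apply: (adapted_sub (filtration_nondecreasing hF s0 su)).
exact: (wiener_adapted hw).
Qed.

Lemma adapted_incr i a b u : 0 <= a -> a <= u -> 0 <= b -> b <= u ->
  adapted_to (F u) (incr i a b).
Proof.
move=> a0 au b0 bu; apply: adaptedB; try exact: adapted_wiener.
by apply: (filtration_sigma_algebra hF); exact: le_trans au.
Qed.

Lemma adapted_F_measurable s U : 0 <= s -> adapted_to (F s) U ->
  measurable_fun setT U.
Proof.
by move=> s0; apply: adapted_measurable; exact: (filtration_measurable hF).
Qed.

Lemma measurable_wiener i s : 0 <= s -> measurable_fun setT (w i s).
Proof.
by move=> s0; apply: (@adapted_F_measurable s) => //; exact: adapted_wiener.
Qed.

Lemma measurable_incr i a b : 0 <= a -> 0 <= b ->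
  measurable_fun setT (incr i a b).
Proof. by move=> a0 b0; apply: measurable_funB; exact: measurable_wiener. Qed.

Lemma incr_moment i a b n : 0 <= a -> a <= b ->
  inL1 P (fun x => incr i a b x ^+ n) /\
  mean P (fun x => incr i a b x ^+ n) = gauss_moment (b - a) n.
Proof.
move=> a0; rewrite le_eqVlt => /predU1P[<-|ab].
  have e x : incr i a a x ^+ n = gauss_moment (a - a) n.
    rewrite /incr !subrr.
    case: n => [|[|n]]; rewrite ?expr0 ?expr1// gauss_momentSS.
    by rewrite expr0n mulr0 mul0r.
  split; first exact: (eq_inL1 _ (inL1_cst P (gauss_moment (a - a) n))).
  by rewrite (eq_mean _ e) mean_cst.
have s0 : 0 < Num.sqrt (b - a) by rewrite sqrtr_gt0 subr_gt0.
have b0 : 0 <= b by rewrite (le_trans a0)// ltW.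
have mX := measurable_incr i a0 b0.
pose X : {mfun Om >-> measurableTypeR R} :=
  HB.pack (incr i a b : Om -> measurableTypeR R)
    (isMeasurableFun.Build _ _ Om (measurableTypeR R) (incr i a b) mX).
have [iN] := normal_prob_moment n s0.
rewrite sqr_sqrtr ?subr_ge0; last exact: ltW.
have law (B : set R) : measurable B ->
    distribution P X B = normal_prob 0 (Num.sqrt (b - a)) B.
  by move=> mB; exact: (wiener_increment_normal hw i a0 ab mB).
have iX : inL1 P (fun x => incr i a b x ^+ n).
  apply/integrableP; split; first exact/measurable_EFinP/measurable_funX.
  rewrite -(@ge0_integral_distribution _ _ _ _ _ P X
    (fun y => `|y ^+ n|%:E)); last 2 first.
  - apply/measurable_EFinP/measurableT_comp; first exact: normr_measurable.
    exact: measurable_funX.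
  - by move=> y; rewrite lee_fin.
  have -> : (\int[distribution P X]_y `|y ^+ n|%:E =
      \int[normal_prob 0 (Num.sqrt (b - a))]_y `|(y ^+ n)%:E|)%E.
    by apply: eq_measure_integral => B mB _; exact: law.
  by move/integrableP : iN => [_].
split=> //; apply: EFin_inj; rewrite -meanE// unlock -b1.
rewrite -(@integral_distribution _ _ _ _ _ P X (fun y => (y ^+ n)%:E))//.
- by apply: eq_measure_integral => B mB _; exact: law.
- by apply/measurable_EFinP; exact: measurable_funX.
Qed.

(** The increment after time a is independent of F a; the degenerate case
    a = b is included. *)
Lemma incr_meanM i a b U n : 0 <= a -> a <= b ->
  adapted_to (F a) U -> inL1 P U ->
  inL1 P (fun x => U x * incr i a b x ^+ n) /\
  mean P (fun x => U x * incr i a b x ^+ n) =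
    mean P U * gauss_moment (b - a) n.
Proof.
move=> a0 ab aU iU; have [iX eX] := incr_moment i n a0 ab.
move: ab; rewrite le_eqVlt => /predU1P[ab|ab]; last first.
  rewrite -eX; apply: (independent_meanM
    (wiener_increment_independent hw a0 ab)) => //.
  apply: adaptedX; first exact: smallest_sigma_algebra.
  move=> A hA; apply: sub_sigma_algebra; exists i => //.
have e x : U x * incr i a b x ^+ n = gauss_moment (b - a) n * U x.
  rewrite mulrC /incr -ab !subrr; congr (_ * _).
  case: n {iX eX} => [|[|n]]; rewrite ?expr0 ?expr1// gauss_momentSS.
  by rewrite expr0n mulr0 mul0r.
split; first exact: (eq_inL1 (fun x => esym (e x)) (inL1Z _ iU)).
by rewrite (eq_mean _ e) meanZ// mulrC.
Qed.

Lemma incr_mean0 i a b U : 0 <= a -> a <= b ->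
  adapted_to (F a) U -> inL1 P U ->
  inL1 P (fun x => U x * incr i a b x) /\
  mean P (fun x => U x * incr i a b x) = 0.
Proof.
move=> a0 ab aU iU; have [] := incr_meanM i 1 a0 ab aU iU.
by rewrite /= mulr0.
Qed.

Lemma inL2_incrM i a b U : 0 <= a -> a <= b ->
  adapted_to (F a) U -> inL2 P U -> inL2 P (fun x => U x * incr i a b x).
Proof.
move=> a0 ab aU [mU iU]; split.
  by apply: measurable_funM => //; apply: measurable_incr => //; exact: le_trans ab.
have sF : sigma_algebra setT (F a) by exact: (filtration_sigma_algebra hF).
have [i2 _] := incr_meanM i 2 a0 ab (adaptedX (n:=2) sF aU) iU.
by apply: eq_inL1 i2 => x; rewrite exprMn.
Qed.

(** The length of the intersection of [a, b] and [c, e]. *)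
Definition overlap a b c e : R := Num.max 0 (Num.min b e - Num.max a c).

Lemma overlapC a b c e : overlap a b c e = overlap c e a b.
Proof. by rewrite /overlap minC [Num.max a c]maxC. Qed.

Lemma incr_cov_nested i c b e U : 0 <= c -> c <= b -> b <= e ->
  adapted_to (F c) U -> inL1 P U ->
  inL1 P (fun x => U x * incr i c b x * incr i c e x) /\
  mean P (fun x => U x * incr i c b x * incr i c e x) = mean P U * (b - c).
Proof.
move=> c0 cb be aU iU; have b0 := le_trans c0 cb.
have [i2 e2] := incr_meanM i 2 c0 cb aU iU.
have [i1 _] := incr_mean0 i c0 cb aU iU.
have aU1 : adapted_to (F b) (fun x => U x * incr i c b x).
  apply: adaptedM; first exact: (filtration_sigma_algebra hF).
    exact: (adapted_sub (filtration_nondecreasing hF c0 cb)).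
  exact: adapted_incr.
have [i3 e3] := incr_mean0 i b0 be aU1 i1.
have eqX x : U x * incr i c b x ^+ 2 + U x * incr i c b x * incr i b e x =
    U x * incr i c b x * incr i c e x.
  by rewrite /incr; ring.
split; first exact: (eq_inL1 eqX (inL1D i2 i3)).
by rewrite -(eq_mean _ eqX) meanD// e2 e3 addr0 /= !mul1r mulr1.
Qed.

Lemma incr_cov_start i c b e U : 0 <= c -> c <= b -> c <= e ->
  adapted_to (F c) U -> inL1 P U ->
  inL1 P (fun x => U x * incr i c b x * incr i c e x) /\
  mean P (fun x => U x * incr i c b x * incr i c e x) =
    mean P U * (Num.min b e - c).
Proof.
move=> c0 cb ce aU iU; case: (leP b e) => be; first exact: incr_cov_nested.
have [i1 e1] := incr_cov_nested i c0 ce (ltW be) aU iU.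
have eqX x : U x * incr i c e x * incr i c b x =
  U x * incr i c b x * incr i c e x by ring.
by split; [exact: (eq_inL1 eqX)|rewrite -(eq_mean _ eqX)].
Qed.

(** The first increment is split at time c: its part before c, multiplied by U
    and V, is known at time c and is thus orthogonal to the second increment. *)
Lemma incr_cov_le i a b c e U V : 0 <= a -> a <= b -> a <= c -> c <= e ->
  adapted_to (F a) U -> inL2 P U -> adapted_to (F c) V -> inL2 P V ->
  mean P (fun x => U x * incr i a b x * (V x * incr i c e x)) =
    mean P (fun x => U x * V x) * overlap a b c e.
Proof.
move=> a0 ab ac ce aU iU aV iV; have c0 := le_trans a0 ac.
have sF u : 0 <= u -> sigma_algebra setT (F u).
  exact: (filtration_sigma_algebra hF).
have aUc : adapted_to (F c) U.
  exact: (adapted_sub (filtration_nondecreasing hF a0 ac)).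
have past f : a <= f -> f <= c ->
    inL1 P (fun x => U x * incr i a f x * V x * incr i c e x) /\
    mean P (fun x => U x * incr i a f x * V x * incr i c e x) = 0.
  move=> af fc; apply: incr_mean0 => //.
    apply: adaptedM => //; first exact: sF.
    apply: adaptedM => //; first exact: sF.
    by apply: adapted_incr => //; exact: le_trans af.
  by apply: inL2M => //; exact: inL2_incrM.
rewrite /overlap (max_r ac).
have [bc|cb] := leP b c.
  have [_ e0] := past _ ab bc.
  transitivity (mean P (fun x => U x * incr i a b x * V x * incr i c e x)).
    by apply: eq_mean => x; ring.
  rewrite e0 max_l ?mulr0// subr_le0.
  by rewrite ge_min bc.
have [i1 e1] := past _ ac (lexx c).
have [i2 e2] := incr_cov_start i c0 (ltW cb) ce
  (adaptedM (sF _ c0) aUc aV) (inL2M iU iV).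
rewrite max_r; last by rewrite subr_ge0 le_min (ltW cb).
rewrite -e2 -[RHS]add0r -e1 -meanD//.
by apply: eq_mean => x; rewrite /incr; ring.
Qed.

(** The elementary form of the Ito isometry. The two intervals may overlap in
    any way, which makes common refinements of partitions unnecessary. *)
Lemma incr_cov i a b c e U V : 0 <= a -> a <= b -> 0 <= c -> c <= e ->
  adapted_to (F a) U -> inL2 P U -> adapted_to (F c) V -> inL2 P V ->
  mean P (fun x => U x * incr i a b x * (V x * incr i c e x)) =
    mean P (fun x => U x * V x) * overlap a b c e.
Proof.
move=> a0 ab c0 ce aU iU aV iV; have [ac|/ltW ca] := leP a c.
  exact: incr_cov_le.
rewrite overlapC.
rewrite [in RHS](eq_mean _ (fun x => mulrC (U x) (V x))) -(incr_cov_le i c0 ce ca ab)//.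
by apply: eq_mean => x; ring.
Qed.

End Increments.

(** * The Ito isometry and approximation of Ito integrals *)

(** The integral of a nonnegative function is a supremum over the simple functions
    below it, and a larger function has more of them. This form applies to
    mean-square errors as functions of time, whose measurability is not known. *)
Lemma ge0_le_integral_nonmeas d (T : measurableType d) (R : realType)
    (mu : {measure set T -> \bar R}) (D : set T) (f g : T -> \bar R) :
  (forall x, D x -> (0 <= f x)%E) -> (forall x, D x -> (f x <= g x)%E) ->
  (\int[mu]_(x in D) f x <= \int[mu]_(x in D) g x)%E.
Proof.
move=> f0 fg; have g0 x : D x -> (0 <= g x)%E.
  by move=> Dx; exact: le_trans (f0 _ Dx) (fg _ Dx).
rewrite ge0_integralE// ge0_integralE//.
apply: le_ereal_sup => _ [h hf <-]; exists h => // x.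
apply: le_trans (hf x) _; rewrite !patchE; case: ifPn => // xD.
by apply: fg; exact: set_mem.
Qed.

Lemma indicM (R : realType) (T : Type) (A B : set T) (u : T) :
  \1_A u * \1_B u = \1_(A `&` B) u :> R.
Proof. by rewrite indicI. Qed.

Lemma integral_sum2 d (T : measurableType d) (R : realType)
    (mu : {measure set T -> \bar R}) (D : set T) (I : finType)
    (f : I -> I -> T -> R) (v : I -> I -> R) : measurable D ->
  (forall k l, mu.-integrable D (EFin \o f k l)) ->
  (forall k l, (\int[mu]_(x in D) (f k l x)%:E = (v k l)%:E)%E) ->
  (\int[mu]_(x in D) (\sum_k \sum_l f k l x)%R%:E =
   (\sum_k \sum_l v k l)%R%:E)%E.
Proof.
move=> mD fi fv.
under eq_integral do rewrite pair_big -sumEFin/=.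
rewrite (integral_sum mD (f := fun p => EFin \o f p.1 p.2))//.
by rewrite pair_big -sumEFin; apply: eq_bigr => -[k l] _ /=.
Qed.

Section Blocks.
Context {R : realType} {d : measure_display} {Om : measurableType d}.
Context {P : probability Om R} {F : R -> set (set Om)} {m : nat}
  {w : 'I_m -> R -> Om -> R}.
Hypotheses (hF : is_filtration F) (hw : is_wiener P F w).
Implicit Types (i : 'I_m) (t T u s : R) (I J : finType).

(** A finite family of blocks is a step process whose intervals may overlap and
    need not be ordered, so that the difference of two of them is again one. *)
Record block := Block
  { block_start : R ; block_end : R ; block_val : Om -> R }.

Definition block_eval I (xi : I -> block) u (x : Om) : R :=
  \sum_i block_val (xi i) x *
    \1_(`[block_start (xi i), block_end (xi i)[%classic : set R) u.

Definition block_integral I (wi : R -> Om -> R) (xi : I -> block) (x : Om) : R :=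
  \sum_i block_val (xi i) x *
    (wi (block_end (xi i)) x - wi (block_start (xi i)) x).

Record is_block t T (p : block) : Prop := IsBlock {
  block_start_ge : t <= block_start p ;
  block_le : block_start p <= block_end p ;
  block_end_le : block_end p <= T ;
  block_adapted : adapted_to (F (block_start p)) (block_val p) ;
  block_inL2 : inL2 P (block_val p) }.

Lemma itv_overlap_integral t T a b c e : t <= a -> b <= T ->
  (\int[lebesgue_measure]_(u in `[t, T])
     (\1_(`[a, b[%classic : set R) u * \1_(`[c, e[%classic : set R) u)%:E =
   (overlap a b c e)%:E)%E.
Proof.
move=> ta bT.
under eq_integral do rewrite indicM.
have E : `[a, b[%classic `&` `[c, e[%classic =
    `[Num.max a c, Num.min b e[%classic :> set R.
  apply/seteqP; split=> x /=; rewrite !in_itv/= ge_max lt_min.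
    by move=> [/andP[-> ->] /andP[-> ->]].
  by move=> /andP[/andP[-> ->] /andP[-> ->]].
rewrite E integral_indic//= (_ : _ `&` _ = `[Num.max a c, Num.min b e[%classic).
  rewrite lebesgue_measure_itv/= lte_fin /overlap.
  case: ifPn => [lt|]; first by rewrite [Num.max 0 _]max_r// subr_ge0 ltW.
  by rewrite -leNgt => le; rewrite [Num.max 0 _]max_l// subr_le0.
apply: setIidl => x/=; rewrite !in_itv/= ge_max lt_min.
move=> /andP[/andP[ax _] /andP[xb _]].
by rewrite (le_trans ta ax) (le_trans (ltW xb) bT).
Qed.

Lemma block_integral_inL2 i I (xi : I -> block) t T : 0 <= t ->
  (forall k, is_block t T (xi k)) -> inL2 P (block_integral (w i) xi).
Proof.
move=> t0 h; apply: inL2_sum => k _; have [ta ab bT aU iU] := h k.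
by apply: (inL2_incrM hF hw) => //; exact: le_trans ta.
Qed.

Lemma block_eval_inL2 I (xi : I -> block) t T u :
  (forall k, is_block t T (xi k)) -> inL2 P (block_eval xi u).
Proof.
move=> h; apply: inL2_sum => k _; have [ta ab bT aU iU] := h k.
by under eq_fun do rewrite mulrC; exact: inL2Z.
Qed.

Lemma mean_sum2 I (X : I -> I -> Om -> R) : (forall k l, inL1 P (X k l)) ->
  mean P (fun x => \sum_k \sum_l X k l x) = \sum_k \sum_l mean P (X k l).
Proof.
move=> iX; rewrite mean_sum; last by move=> k; exact: inL1_sum.
by apply: eq_bigr => k _; rewrite mean_sum.
Qed.

Lemma block_eval_mean I (xi : I -> block) t T u :
  (forall k, is_block t T (xi k)) ->
  ('E_P[(fun x => block_eval xi u x ^+ 2)%R] =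
   (\sum_k \sum_l mean P (fun x => block_val (xi k) x * block_val (xi l) x)%R *
     (\1_(`[block_start (xi k), block_end (xi k)[%classic : set R) u *
      \1_(`[block_start (xi l), block_end (xi l)[%classic : set R) u))%R%:E)%E.
Proof.
move=> h; rewrite meanE; last by case: (block_eval_inL2 u h).
have iUU k l := inL2M (block_inL2 (h k)) (block_inL2 (h l)).
congr EFin; rewrite -[RHS]/(\sum_k \sum_l _).
under [RHS]eq_bigr do under eq_bigr do rewrite mulrC -meanZ//.
rewrite -mean_sum2; last by move=> k l; exact: inL1Z.
apply: eq_mean => x; rewrite expr2 /block_eval big_distrlr/=.
by apply: eq_bigr => k _; apply: eq_bigr => l _; ring.
Qed.

(** Both sides expand into double sums over pairs of blocks, which agree term by
    term by [incr_cov]. *)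
Theorem ito_isometry i I (xi : I -> block) t T : 0 <= t ->
  (forall k, is_block t T (xi k)) ->
  ('E_P[(fun x => block_integral (w i) xi x ^+ 2)%R] =
   \int[lebesgue_measure]_(u in `[t, T])
     'E_P[(fun x => block_eval xi u x ^+ 2)%R])%E.
Proof.
move=> t0 h; have iUU k l := inL2M (block_inL2 (h k)) (block_inL2 (h l)).
under eq_integral do rewrite (block_eval_mean _ h).
pose v k l := mean P (fun x => block_val (xi k) x * block_val (xi l) x) *
  overlap (block_start (xi k)) (block_end (xi k))
    (block_start (xi l)) (block_end (xi l)).
have i1 (k l : I) : lebesgue_measure.-integrable `[t, T]
    (fun u => (\1_(`[block_start (xi k), block_end (xi k)[%classic : set R) u *
       \1_(`[block_start (xi l), block_end (xi l)[%classic : set R) u)%:E).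
  have ia : lebesgue_measure.-integrable `[t, T]
      (EFin \o (\1_(`[block_start (xi k), block_end (xi k)[%classic : set R))).
    exact: integrableS (integrable_indic_itv _ _ true true).
  apply: le_integrable ia; first exact: measurable_itv.
    by apply/measurable_EFinP/measurable_funM; exact: measurable_indic.
  move=> u _; rewrite lee_fin /= normrM ler_piMr//.
  by rewrite indicE ger0_norm// lern1 leq_b1.
rewrite (integral_sum2 (v := v))//; last 2 first.
- move=> k l; exact: (integrableZl _
    (mean P (fun x => block_val (xi k) x * block_val (xi l) x)) (i1 k l)).
- move=> k l; under eq_integral do rewrite EFinM.
  rewrite integralZl// itv_overlap_integral//.
    exact: block_start_ge (h k).
  exact: block_end_le (h k).
rewrite meanE; last by case: (block_integral_inL2 i t0 h).
congr EFin.
pose X k x := block_val (xi k) x * incr (w := w) i (block_start (xi k)) (block_end (xi k)) x.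
have iX k : inL2 P (X k).
  have [ta ab bT aU iU] := h k.
  by apply: (inL2_incrM hF hw) => //; exact: le_trans ta.
transitivity (mean P (fun x => \sum_k \sum_l X k x * X l x)).
  by apply: eq_mean => x; rewrite expr2 /block_integral big_distrlr.
rewrite mean_sum2; last by move=> k l; exact: inL2M.
apply: eq_bigr => k _; apply: eq_bigr => l _.
have [ta ab bT aU iU] := h k; have [tc ce eT aV iV] := h l.
by apply: (incr_cov hF hw) => //; [exact: le_trans ta|exact: le_trans tc].
Qed.

(** The family carrying the difference of two families. *)
Definition block_sub I J (xi : I -> block) (eta : J -> block) (k : I + J) :=
  match k with
  | inl k => xi k
  | inr k => Block (block_start (eta k)) (block_end (eta k))
               (fun x => - block_val (eta k) x)
  end.

Lemma is_block_sub I J (xi : I -> block) (eta : J -> block) t T : 0 <= t ->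
  (forall k, is_block t T (xi k)) -> (forall k, is_block t T (eta k)) ->
  forall k, is_block t T (block_sub xi eta k).
Proof.
move=> t0 hxi heta [k|k] //=; have [ta ab bT aU iU] := heta k.
have e : (fun x => -1 * block_val (eta k) x) = (fun x => - block_val (eta k) x).
  by apply/funext => x; rewrite mulN1r.
have sF : sigma_algebra setT (F (block_start (eta k))).
  by apply: (filtration_sigma_algebra hF); exact: le_trans ta.
split => //=; rewrite -e; last exact: inL2Z.
by apply: adaptedM => //; exact: adapted_cst.
Qed.

Lemma block_eval_sub I J (xi : I -> block) (eta : J -> block) u x :
  block_eval (block_sub xi eta) u x = block_eval xi u x - block_eval eta u x.
Proof.
rewrite /block_eval big_sumType/= -sumrN; congr (_ + _).
by apply: eq_bigr => k _; rewrite mulNr.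
Qed.

Lemma block_integral_sub I J (xi : I -> block) (eta : J -> block) wi x :
  block_integral wi (block_sub xi eta) x =
  block_integral wi xi x - block_integral wi eta x.
Proof.
rewrite /block_integral big_sumType/= -sumrN; congr (_ + _).
by apply: eq_bigr => k _; rewrite mulNr.
Qed.

Definition step_block (xi : step_process) (k : 'I_(step_size xi)) : block :=
  Block (step_time xi k) (step_time xi k.+1) (step_val xi k).

Lemma step_time_le t T xi j k : is_admissible_step P F t T xi ->
  (j <= k <= step_size xi)%N -> step_time xi j <= step_time xi k.
Proof.
move=> hxi /andP[]; elim: k => [|k ih]; first by rewrite leqn0 => /eqP ->.
rewrite leq_eqVlt ltnS => /predU1P[-> //|jk] kn.
by rewrite (le_trans (ih jk (ltnW kn)))// ltW// (step_increasing hxi).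
Qed.

Lemma is_block_step t T xi : 0 <= t -> is_admissible_step P F t T xi ->
  forall k, is_block t T (@step_block xi k).
Proof.
move=> t0 hxi k.
have tk : t <= step_time xi k.
  by rewrite -(step_first hxi) (step_time_le hxi)//= ltnW.
have aU := step_adapted hxi (ltn_ord k).
split => //=.
- by rewrite ltW// (step_increasing hxi).
- by rewrite -(step_last hxi) (step_time_le hxi)// leqnn andbT.
- apply: ltoo_inL2; last exact: (step_square_integrable hxi).
  by apply: (adapted_F_measurable hF _ aU); exact: le_trans tk.
Qed.

(** By the isometry, a family of blocks uniformly mean-square close to the
    integrand has an integral close to the Ito integral. The limit defining the
    Ito integral is only known along some sequence of step processes; each of
    them is compared with the given family. *)
Theorem ito_integral_approx i t T (f : R -> Om -> R) (X : Om -> R) I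
    (eta : I -> block) (eps : R) : 0 <= t -> t <= T -> 0 <= eps ->
  is_ito_integral P F (w i) t T f X ->
  (forall k, is_block t T (eta k)) ->
  (forall u, t <= u < T ->
    ('E_P[(fun x => (block_eval eta u x - f u x) ^+ 2)%R] <= eps%:E)%E) ->
  ('E_P[(fun x => (X x - block_integral (w i) eta x) ^+ 2)%R]
     <= (4 * eps * (T - t))%:E)%E.
Proof.
move=> t0 tT eps0 [fI mX [xi [hxi cvg_eval cvg_int]]] heta feta.
have hb N := is_block_step t0 (hxi N).
have hs N := is_block_sub t0 (hb N) heta.
pose e N u := ('E_P[(fun x => (step_eval (xi N) u x - f u x) ^+ 2)%R])%E.
pose S x := block_integral (w i) eta x.
have mS : measurable_fun setT S by have [] := block_integral_inL2 i t0 heta.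
have bound N : ('E_P[(fun x => (X x - S x) ^+ 2)%R] <=
    2%:E * 'E_P[(fun x => (X x - step_integral (w i) (xi N) x) ^+ 2)%R] +
    (4%:E * (\int[lebesgue_measure]_(u in `[t, T]) e N u) +
     (4 * eps * (T - t))%:E))%E.
  have [mN _] := block_integral_inL2 i t0 (hb N).
  have le0 := expectation_sqrD_le P
    (measurable_funB mX mN) (measurable_funB mN mS).
  have XSE : (fun x => ((X \- block_integral (w i) (@step_block (xi N))) x +
        (block_integral (w i) (@step_block (xi N)) \- S) x) ^+ 2) =
      (fun x => (X x - S x) ^+ 2).
    by apply/funext => x /=; rewrite addrA subrK.
  rewrite XSE in le0; apply: (le_trans le0).
  apply: leeD; first exact: lexx.
  have -> : (fun x => (block_integral (w i) (@step_block (xi N)) \- S) x ^+ 2) =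
      (fun x => block_integral (w i) (block_sub (@step_block (xi N)) eta) x ^+ 2).
    by apply/funext => x; rewrite block_integral_sub.
  rewrite (ito_isometry i t0 (hs N)).
  have [hr mhr hE] : exists2 hr : R -> R, measurable_fun setT hr &
      forall u, ('E_P[(fun x => block_eval
        (block_sub (@step_block (xi N)) eta) u x ^+ 2)%R] = (hr u)%:E)%E.
    eexists; last by move=> u; exact: (block_eval_mean u (hs N)).
    apply: measurable_sum => k; apply: measurable_sum => l.
    apply: measurable_funM => //; apply: measurable_funM; exact: measurable_indic.
  (* g minorizes the mean-square error e N of the step process and is
     measurable in time *)
  pose g u := Num.max 0 (hr u / 2 - eps).
  have mg : measurable_fun setT (EFin \o g).
    apply/measurable_EFinP/measurable_maxr => //.
    by apply: measurable_funB => //; exact: measurable_funM.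
  have g0 u : 0 <= g u by rewrite le_max lexx.
  have hg u : hr u <= 2 * g u + 2 * eps.
    have : hr u / 2 - eps <= g u by rewrite le_max lexx orbT.
    by lra.
  have ge u : `[t, T]%classic u -> ((g u)%:E <= e N u)%E.
    rewrite /= in_itv/= => /andP[tu]; rewrite le_eqVlt => /predU1P[->|uT].
      (* the intervals are open on the right, so every family vanishes at T *)
      have -> : g T = 0.
        have h0 : hr T = 0.
          apply: EFin_inj; rewrite -hE.
          transitivity (('E_P[cst 0%R])%E : \bar R); last exact: expectation_cst.
          congr expectation.
          apply/funext => x; rewrite /block_eval big1 ?expr0n// => k _.
          have [_ _ bT _ _] := hs N k.
          rewrite indicE memNset ?mulr0//= in_itv/= => /andP[_].
          by rewrite ltNge bT.
        by rewrite /g h0 mul0r sub0r max_l// oppr_le0.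
      by apply: expectation_ge0 => x; exact: sqr_ge0.
    have u0 : 0 <= u := le_trans t0 tu.
    have mf : measurable_fun setT (f u).
      apply: (adapted_F_measurable hF u0).
      by apply: (integrand_adapted fI); rewrite tu ltW.
    have mxi := (block_eval_inL2 u (hb N)).1.
    have meta := (block_eval_inL2 u heta).1.
    have le1 := expectation_sqrD_le P
      (measurable_funB mxi mf) (measurable_funB mf meta).
    have fe : ('E_P[(fun x => (f u \- block_eval eta u)%R x ^+ 2)%R] <= eps%:E)%E.
      apply: le_trans (feta u _); last by rewrite tu uT.
      rewrite le_eqVlt; apply/orP; left; apply/eqP; congr expectation.
      by apply/funext => x /=; rewrite -sqrrN opprB.
    have h2 : ((hr u)%:E <= 2%:E * e N u + 2%:E * eps%:E)%E.
      rewrite -hE; apply: le_trans (leeD2l _ (lee_wpmul2l _ fe)) => //.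
      apply: le_trans le1; rewrite le_eqVlt; apply/orP; left; apply/eqP.
      congr expectation; apply/funext => x.
      by rewrite block_eval_sub /= addrA subrK.
    have e0 : (0 <= e N u)%E by apply: expectation_ge0 => x; exact: sqr_ge0.
    case: (e N u) h2 e0 => [r| |]; last by [].
      rewrite -!EFinM -EFinD !lee_fin => h2 r0.
      by rewrite ge_max r0/=; lra.
    by move=> _ _; exact: leey.
  have int_g : (\int[lebesgue_measure]_(u in `[t, T]) (g u)%:E <=
      \int[lebesgue_measure]_(u in `[t, T]) e N u)%E.
    by apply: ge0_le_integral_nonmeas => // u _; rewrite lee_fin.
  apply: (@le_trans _ _ (2%:E * (2%:E * (\int[lebesgue_measure]_(u in `[t, T])
      (g u)%:E) + (2 * eps * (T - t))%:E))%E).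
    rewrite lee_wpmul2l//.
    apply: (@le_trans _ _ (\int[lebesgue_measure]_(u in `[t, T])
        (2%:E * (g u)%:E + (2 * eps)%:E))%E).
      apply: ge0_le_integral_nonmeas => u _.
        by apply: expectation_ge0 => x; exact: sqr_ge0.
      by rewrite hE -EFinM -EFinD lee_fin.
    have eps2 : 0 <= 2 * eps by rewrite mulr_ge0.
    rewrite ge0_integralD//=; last 2 first.
    - by move=> u _; rewrite -EFinM lee_fin mulr_ge0.
    - by apply: measurable_funeM; exact: measurable_funTS.
    rewrite ge0_integralZl//=; last 2 first.
    - exact: measurable_funTS.
    - by move=> u _; rewrite lee_fin.
    apply: leeD => //.
    rewrite integral_cst//= lebesgue_measure_itv/= lte_fin.
    case: ifPn => _; first by rewrite -EFinB -EFinM.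
    by rewrite mule0 lee_fin mulr_ge0// subr_ge0.
  rewrite ge0_muleDr; last 2 first.
  - by rewrite mule_ge0// integral_ge0// => u _; rewrite lee_fin.
  - by rewrite lee_fin !mulr_ge0// subr_ge0.
  apply: leeD; last by rewrite -EFinM lee_fin; lra.
  by rewrite muleA -EFinM (_ : 2 * 2 = 4 :> R) ?lee_wpmul2l//; lra.
have cvg_bound : (2%:E * 'E_P[(fun x => (X x - step_integral (w i) (xi N) x) ^+ 2)%R] +
    (4%:E * (\int[lebesgue_measure]_(u in `[t, T]) e N u) +
     (4 * eps * (T - t))%:E))%E @[N --> \oo] --> (4 * eps * (T - t))%:E.
  rewrite -[X in _ --> X]add0e -[X in _ --> (X + _)%E](mule0 2%:E).
  apply: cvgeD => //; first by apply: cvgeZl.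
  rewrite -[X in _ --> X]add0e -[X in _ --> (X + _)%E](mule0 4%:E).
  by apply: cvgeD => //; [apply: cvgeZl|exact: cvg_cst].
rewrite -(cvg_lim _ cvg_bound)//; apply: lime_ge.
  by apply/cvg_ex; eexists; exact: cvg_bound.
exact: nearW.
Qed.

End Blocks.

(** * Moments of bilinear forms in the increments *)

Section GaussMoment.
Context {R : realType}.
Implicit Types u v c : R.

Lemma gauss_moment_scale c v n :
  gauss_moment (c ^+ 2 * v) n = c ^+ n * gauss_moment v n.
Proof.
elim/ltn_ind: n => -[|[|n]] ih.
- by rewrite expr0 mul1r.
- by rewrite /= mulr0.
- by rewrite !gauss_momentSS ih// !exprS; ring.
Qed.

(** Umbrally, the moments of the sum of two independent centred normal
    variables are those of a normal variable whose variance is the sum. *)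
Lemma gauss_momentD u v n :
  \sum_(j < n.+1) 'C(n, j)%:R * gauss_moment u (n - j) * gauss_moment v j =
  gauss_moment (u + v) n.
Proof.
elim/ltn_ind: n => -[|[|n]] ih.
- by rewrite big_ord1 /= !mulr1.
- by rewrite !big_ord_recl big_ord0 /= !(mulr0, mul0r, mulr1, addr0).
have gmS w k : gauss_moment w k.+1 = k%:R * w * gauss_moment w k.-1.
  by case: k => [|k] //=; rewrite !mul0r.
rewrite gauss_momentSS -ih//.
pose f j : R := gauss_moment u (n.+2 - j) * gauss_moment v j.
have split_sum : \sum_(j < n.+3) 'C(n.+2, j)%:R * f j =
    \sum_(j < n.+2) 'C(n.+1, j)%:R * f j +
    \sum_(j < n.+2) 'C(n.+1, j)%:R * f j.+1.
  rewrite big_ord_recl bin0 mul1r.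
  under eq_bigr do rewrite /= binS natrD mulrDl.
  rewrite big_split/= [X in _ + (X + _)]big_ord_recr/= bin_small// mul0r addr0.
  rewrite addrA; congr (_ + _).
  by rewrite [RHS]big_ord_recl bin0 mul1r.
under eq_bigr do rewrite -mulrA.
have key (a b c k x y z : R) : a * b = k * c ->
    a * (b * x * y * z) = k * x * (c * y * z).
  by move=> e; transitivity (a * b * (x * y * z)); [|rewrite e]; ring.
rewrite split_sum mulrDr mulrDl; congr (_ + _).
- rewrite big_ord_recr/= /f binn [gauss_moment u (n.+2 - n.+1)](_ : _ = 0); last first.
    by rewrite subSn// subnn.
  rewrite mul0r mulr0 addr0 mulr_sumr; apply: eq_bigr => j _.
  have jn : (j <= n)%N by rewrite -ltnS.
  have e : 'C(n.+1, j)%:R * (n.+1 - j)%:R = n.+1%:R * 'C(n, j)%:R :> R.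
    by rewrite -!natrM mulnC mul_bin_down.
  rewrite (subSn (leqW jn)) gmS (subSn jn) /= -(subSn jn).
  exact: key.
- rewrite big_ord_recl /f /= mulr0 mulr0 add0r mulr_sumr; apply: eq_bigr => j _.
  have e : 'C(n.+1, j.+1)%:R * j.+1%:R = n.+1%:R * 'C(n, j)%:R :> R.
    by rewrite -!natrM mulnC -mul_bin_diag.
  rewrite [gauss_moment u _ * _]mulrC [X in _ = _ * X]mulrAC.
  exact: key.
Qed.

Lemma gauss_moment_ge0 v n : 0 <= v -> 0 <= gauss_moment v n.
Proof.
move=> v0; elim/ltn_ind: n => -[|[|n]] ih //=.
by rewrite !mulr_ge0// ih.
Qed.

Lemma gauss_moment_even v n :
  0 <= v -> gauss_moment v (2 * n) = gauss_moment 1 (2 * n) * v ^+ n.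
Proof.
move=> v0; rewrite -[in LHS](sqr_sqrtr v0) -[_ ^+ 2]mulr1 gauss_moment_scale.
by rewrite exprM sqr_sqrtr// mulrC.
Qed.

End GaussMoment.

Section PowerMean.
Context {R : realType}.

(** A convex function lies above its tangents. *)
Lemma expr_tangent_le (x y : R) n : 0 <= x -> 0 <= y ->
  y ^+ n.+1 + n.+1%:R * y ^+ n * (x - y) <= x ^+ n.+1.
Proof.
move=> x0 y0; elim: n => [|n ih]; first by rewrite !expr1 expr0; lra.
rewrite [x ^+ n.+2]exprS; apply: le_trans (ler_wpM2l x0 ih).
rewrite -subr_ge0 [leRHS](_ : _ = n.+1%:R * y ^+ n * (x - y) ^+ 2).
  by rewrite mulr_ge0 ?sqr_ge0// mulr_ge0// exprn_ge0.
by rewrite !exprS -[n.+2%:R]natr1; ring.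
Qed.

(** Jensen's inequality for the power function. *)
Lemma power_mean_le (I : finType) (v x : I -> R) n :
  (forall i, 0 <= v i) -> (forall i, 0 <= x i) ->
  (\sum_i v i * x i) ^+ n.+1 <=
  (\sum_i v i) ^+ n * \sum_i v i * x i ^+ n.+1.
Proof.
move=> v0 x0; set V := \sum_i v i; set S := \sum_i v i * x i.
have V0 : 0 <= V by exact: sumr_ge0.
have S0 : 0 <= S by apply: sumr_ge0 => i _; rewrite mulr_ge0.
move: V0; rewrite le_eqVlt => /predU1P[V0|V0].
  have -> : S = 0.
    apply: big1 => i _; suff -> : v i = 0 by rewrite mul0r.
    apply/eqP; rewrite eq_le v0 andbT V0 /V (bigD1 i)//= lerDl.
    by apply: sumr_ge0.
  rewrite expr0n/= mulr_ge0 ?exprn_ge0 -?V0// sumr_ge0// => i _.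
  by rewrite mulr_ge0// exprn_ge0.
pose y := S / V; have y0 : 0 <= y by rewrite divr_ge0// ltW.
have Vn : V != 0 by rewrite gt_eqF.
have : \sum_i v i * (y ^+ n.+1 + n.+1%:R * y ^+ n * (x i - y)) <=
    \sum_i v i * x i ^+ n.+1.
  by apply: ler_sum => i _; rewrite ler_wpM2l// expr_tangent_le.
have -> : \sum_i v i * (y ^+ n.+1 + n.+1%:R * y ^+ n * (x i - y)) =
    V * y ^+ n.+1.
  transitivity (\sum_i (v i * (y ^+ n.+1 - n.+1%:R * y ^+ n * y) +
      n.+1%:R * y ^+ n * (v i * x i))).
    by apply: eq_bigr => i _; ring.
  rewrite big_split/= -mulr_suml -mulr_sumr -/V -/S.
  have -> : S = V * y by rewrite /y mulrC divfK.
  by ring.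
move=> h; rewrite (_ : S ^+ n.+1 = V ^+ n * (V * y ^+ n.+1)).
  by rewrite ler_wpM2l// exprn_ge0// ltW.
by rewrite mulrA -exprSr -exprMn /y mulrCA divff// mulr1.
Qed.

End PowerMean.

Section AllMoments.
Context {R : realType} {d : measure_display} {Om : measurableType d}.
Variable P : probability Om R.
Implicit Types X Y : Om -> R.

(** The random variables having all moments form an algebra, which makes the
    integrability of polynomials in the increments automatic. *)
Definition all_moments X :=
  measurable_fun setT X /\ forall n, inL1 P (fun x => X x ^+ (2 * n)).

Lemma all_momentsM X Y : all_moments X -> all_moments Y ->
  all_moments (fun x => X x * Y x).
Proof.
move=> [mX iX] [mY iY]; split; first exact: measurable_funM.
move=> n; have mXY : measurable_fun setT (fun x => (X x * Y x) ^+ (2 * n)).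
  by apply: measurable_funX; exact: measurable_funM.
apply: (le_inL1 mXY (inL1D (iX (2 * n)%N) (iY (2 * n)%N))) => x.
rewrite [(2 * (2 * n))%N]mulnC ![_ ^+ (2 * n * 2)]exprM exprMn.
have ev (z : R) : 0 <= z ^+ (2 * n) by rewrite exprM exprn_ge0// sqr_ge0.
have := ev (X x); have := ev (Y x); set a := X x ^+ _; set b := Y x ^+ _ => b0 a0.
by rewrite ger0_norm ?mulr_ge0//; have := sqr_ge0 (a - b); nra.
Qed.

Lemma all_momentsD X Y : all_moments X -> all_moments Y ->
  all_moments (fun x => X x + Y x).
Proof.
move=> [mX iX] [mY iY]; split; first exact: measurable_funD.
move=> n; have mXY : measurable_fun setT (fun x => (X x + Y x) ^+ (2 * n)).
  by apply: measurable_funX; exact: measurable_funD.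
apply: (le_inL1 mXY (inL1Z (4 ^+ n) (inL1D (iX n) (iY n)))) => x.
rewrite !exprM ger0_norm; last by apply: exprn_ge0; exact: sqr_ge0.
wlog xy : X Y {mX mY iX iY mXY} / X x ^+ 2 <= Y x ^+ 2.
  move=> H; have [/H//|/ltW yx] := leP (X x ^+ 2) (Y x ^+ 2).
  by rewrite [X x + _]addrC [_ ^+ n + _]addrC; exact: H.
apply: (@le_trans _ _ ((4 * Y x ^+ 2) ^+ n)).
  have e : (X x + Y x) ^+ 2 = 2 * X x ^+ 2 + 2 * Y x ^+ 2 - (X x - Y x) ^+ 2.
    by ring.
  have XY0 := sqr_ge0 (X x - Y x).
  apply: lerXn2r; rewrite ?nnegrE ?sqr_ge0//; last by lra.
  by rewrite mulr_ge0// sqr_ge0.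
by rewrite exprMn ler_wpM2l ?exprn_ge0// lerDr exprn_ge0// sqr_ge0.
Qed.

Lemma all_moments_cst (c : R) : all_moments (fun _ => c).
Proof. by split => // n; exact: inL1_cst. Qed.

Lemma all_moments_sum (I : Type) (s : seq I) (X : I -> Om -> R) :
  (forall i, all_moments (X i)) -> all_moments (fun x => \sum_(i <- s) X i x).
Proof.
move=> h; elim: s => [|i s ih].
  by under eq_fun do rewrite big_nil; exact: all_moments_cst.
by under eq_fun do rewrite big_cons; exact: all_momentsD.
Qed.

Lemma all_moments_prod (I : Type) (s : seq I) (X : I -> Om -> R) :
  (forall i, all_moments (X i)) -> all_moments (fun x => \prod_(i <- s) X i x).
Proof.
move=> h; elim: s => [|i s ih].
  by under eq_fun do rewrite big_nil; exact: all_moments_cst.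
by under eq_fun do rewrite big_cons; exact: all_momentsM.
Qed.

Lemma all_momentsX X n : all_moments X -> all_moments (fun x => X x ^+ n).
Proof.
move=> h; elim: n => [|n ih].
  by under eq_fun do rewrite expr0; exact: all_moments_cst.
by under eq_fun do rewrite exprS; exact: all_momentsM.
Qed.

Lemma all_moments_inL1 X : all_moments X -> inL1 P X.
Proof.
move=> [mX iX]; apply: (le_inL1 mX (inL1D (inL1_cst P 1) (iX 1%N))) => x.
rewrite muln1 -[X x ^+ 2]real_normK ?num_real//.
by have := sqr_ge0 (`|X x| - 1); have := normr_ge0 (X x); nra.
Qed.

End AllMoments.

Section Chaos.
Context {R : realType} {d : measure_display} {Om : measurableType d}.
Context {P : probability Om R} {F : R -> set (set Om)} {m : nat}
  {w : 'I_m -> R -> Om -> R}.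
Hypotheses (hF : is_filtration F) (hw : is_wiener P F w).
Context {t h : R}.
Hypotheses (t0 : 0 <= t) (h_gt0 : 0 < h).
Implicit Types (i : 'I_m) (j k l n N : nat).

Definition grid_incr i k : Om -> R :=
  incr (w := w) i (t + k%:R * h) (t + k.+1%:R * h).

Let h0 : 0 <= h := ltW h_gt0.

Let time_ge0 k : 0 <= t + k%:R * h.
Proof. by rewrite addr_ge0// mulr_ge0. Qed.

Let time_le k l : (k <= l)%N -> t + k%:R * h <= t + l%:R * h.
Proof. by move=> kl; rewrite lerD2l ler_wpM2r// ler_nat. Qed.

Let stepE k : t + k.+1%:R * h - (t + k%:R * h) = h.
Proof. by rewrite -natr1; ring. Qed.

Lemma grid_incr_all_moments i k : all_moments P (grid_incr i k).
Proof.
split; first exact: (measurable_incr hF hw).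
move=> n; exact: (incr_moment hF hw i (2 * n) (time_ge0 k) (time_le (leqnSn k))).1.
Qed.

Lemma grid_incr_past i (c : nat -> R) N :
  adapted_to (F (t + N%:R * h)) (fun x => \sum_(k < N) c k * grid_incr i k x).
Proof.
have sF : sigma_algebra setT (F (t + N%:R * h)).
  exact: (filtration_sigma_algebra hF).
apply: adapted_sum => // k; apply: adaptedM => //; first exact: adapted_cst.
apply: (adapted_incr hF hw); try exact: time_ge0.
  exact/time_le/ltnW.
exact/time_le/ltn_ord.
Qed.

Lemma grid_sum_all_moments i (c : nat -> R) N :
  all_moments P (fun x => \sum_(k < N) c k * grid_incr i k x).
Proof.
apply: all_moments_sum => k; apply: all_momentsM; first exact: all_moments_cst.
exact: grid_incr_all_moments.
Qed.

(** The last increment is independent of the past, so the binomial expansion is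
    the one of [gauss_momentD]. *)
Lemma grid_sum_moment i (c : nat -> R) N n :
  mean P (fun x => (\sum_(k < N) c k * grid_incr i k x) ^+ n) =
  gauss_moment (h * \sum_(k < N) c k ^+ 2) n.
Proof.
elim: N n => [|N ih] n.
  rewrite big_ord0 mulr0 -[RHS](mean_cst P); apply: eq_mean => x.
  rewrite big_ord0; case: n => [|[|n]] //.
  by rewrite gauss_momentSS mulr0 mul0r expr0n.
pose S x := \sum_(k < N) c k * grid_incr i k x.
pose D x := grid_incr i N x.
have aS k : adapted_to (F (t + N%:R * h)) (fun x => S x ^+ k).
  apply: adaptedX; last exact: grid_incr_past.
  exact: (filtration_sigma_algebra hF).
have iS k : inL1 P (fun x => S x ^+ k).
  exact/all_moments_inL1/all_momentsX/grid_sum_all_moments.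
have SD k l := incr_meanM hF hw i l (time_ge0 N) (time_le (leqnSn N)) (aS k) (iS k).
transitivity (mean P (fun x => \sum_(j < n.+1)
    ('C(n, j)%:R * c N ^+ j) * (S x ^+ (n - j) * D x ^+ j))).
  apply: eq_mean => x; rewrite big_ord_recr/= exprDn.
  by apply: eq_bigr => j _; rewrite exprMn -mulr_natl /S /D; ring.
rewrite mean_sum; last by move=> j; apply: inL1Z; case: (SD (n - j)%N j).
rewrite [in RHS]big_ord_recr/= mulrDr -gauss_momentD; apply: eq_bigr => j _.
rewrite meanZ; last by case: (SD (n - j)%N j).
rewrite (SD (n - j)%N j).2 stepE ih [h * c N ^+ 2]mulrC gauss_moment_scale.
by ring.
Qed.

(** The independence of two components is the product rule with the events of
    the other components taken to be the whole space. *)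
Lemma component_meanM i1 i2 (X Y : Om -> R) : i1 != i2 ->
  adapted_to (sigma_gen [set s | 0 <= s] (w i1)) X ->
  adapted_to (sigma_gen [set s | 0 <= s] (w i2)) Y ->
  inL1 P X -> inL1 P Y ->
  inL1 P (fun x => X x * Y x) /\
  mean P (fun x => X x * Y x) = mean P X * mean P Y.
Proof.
move=> i12; apply: independent_meanM => A B GA GB.
pose C i := if i == i1 then A else if i == i2 then B else setT.
have GC i : sigma_gen [set s | 0 <= s] (w i) (C i).
  rewrite /C; case: eqP => [->//|_]; case: eqP => [->//|_].
  have [G0 GD _] := smallest_sigma_algebra setT
    (\bigcup_(s in [set s | 0 <= s]) preimage_set_system setT (w i s) measurable).
  by have := GD _ G0; rewrite setD0.
have := wiener_components_independent hw GC.
have -> : \bigcap_i C i = A `&` B.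
  apply/seteqP; split=> [x /= hx|x [Ax Bx] i _].
    split; first by have := hx i1 I; rewrite /C eqxx.
    by have := hx i2 I; rewrite /C eqxx eq_sym (negbTE i12).
  by rewrite /C; case: ifP => // _; case: ifP.
move=> ->; rewrite (bigD1 i1)//= (bigD1 i2)/=; last by rewrite eq_sym.
rewrite big1 ?mule1; last first.
  by move=> i /andP[/negbTE i1i /negbTE i2i]; rewrite /C i1i i2i probability_setT.
by rewrite /C !eqxx eq_sym (negbTE i12).
Qed.

Lemma grid_incr_component i k :
  adapted_to (sigma_gen [set s | 0 <= s] (w i)) (grid_incr i k).
Proof.
apply: adaptedB; first exact: smallest_sigma_algebra.
- move=> A hA; apply: sub_sigma_algebra; exists (t + k.+1%:R * h) => //.
  exact: time_ge0.
- move=> A hA; apply: sub_sigma_algebra; exists (t + k%:R * h) => //.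
  exact: time_ge0.
Qed.

Definition grid_bilinear i1 i2 (a : nat -> nat -> R) N (x : Om) : R :=
  \sum_(l < N) (\sum_(k < N) a k l * grid_incr i1 k x) * grid_incr i2 l x.

(** Expanding the power of the bilinear form and using the independence of the
    two components amounts to taking the mean over the second component with
    the first one held fixed. *)
Lemma grid_bilinear_moment i1 i2 (a : nat -> nat -> R) N n : i1 != i2 ->
  mean P (fun x => grid_bilinear i1 i2 a N x ^+ n) =
  mean P (fun x => gauss_moment
    (h * \sum_(l < N) (\sum_(k < N) a k l * grid_incr i1 k x) ^+ 2) n).
Proof.
move=> i12; pose c (l : nat) x := \sum_(k < N) a k l * grid_incr i1 k x.
have expand (y z : nat -> R) : (\sum_(l < N) y l * z l) ^+ n =
    \sum_(f : {ffun 'I_n -> 'I_N}) (\prod_(r < n) y (f r)) * \prod_(r < n) z (f r).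
  rewrite -[in LHS](card_ord n) -prodr_const bigA_distr_bigA/=.
  by apply: eq_bigr => f _; rewrite big_split.
have mc (f : {ffun 'I_n -> 'I_N}) : all_moments P (fun x => \prod_(r < n) c (f r) x).
  apply: all_moments_prod => r.
  exact: (grid_sum_all_moments i1 (fun k => a k (f r)) N).
have mD (f : {ffun 'I_n -> 'I_N}) :
    all_moments P (fun x => \prod_(r < n) grid_incr i2 (f r) x).
  by apply: all_moments_prod => r; exact: grid_incr_all_moments.
have sG i : sigma_algebra setT (sigma_gen [set s | 0 <= s] (w i)).
  exact: smallest_sigma_algebra.
have adc (f : {ffun 'I_n -> 'I_N}) :
    adapted_to (sigma_gen [set s | 0 <= s] (w i1))
      (fun x => \prod_(r < n) c (f r) x).
  apply: adapted_prod => // r; apply: adapted_sum => // k.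
  by apply: adaptedM => //; [exact: adapted_cst|exact: grid_incr_component].
have adD (f : {ffun 'I_n -> 'I_N}) :
    adapted_to (sigma_gen [set s | 0 <= s] (w i2))
      (fun x => \prod_(r < n) grid_incr i2 (f r) x).
  by apply: adapted_prod => // r; exact: grid_incr_component.
have cD f := component_meanM i12 (adc f) (adD f)
  (all_moments_inL1 (mc f)) (all_moments_inL1 (mD f)).
have iD f := all_moments_inL1 (mD f).
transitivity (\sum_(f : {ffun 'I_n -> 'I_N})
    mean P (fun x => \prod_(r < n) c (f r) x) *
    mean P (fun x => \prod_(r < n) grid_incr i2 (f r) x)).
  rewrite (eq_mean _ (fun x => expand (c^~ x) (fun l => grid_incr i2 l x))).
  rewrite mean_sum; last by move=> f; case: (cD f).
  by apply: eq_bigr => f _; case: (cD f).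
transitivity (mean P (fun x => \sum_(f : {ffun 'I_n -> 'I_N})
    mean P (fun y => \prod_(r < n) grid_incr i2 (f r) y) *
    \prod_(r < n) c (f r) x)).
  rewrite mean_sum; last by move=> f; exact/inL1Z/all_moments_inL1.
  apply: eq_bigr => f _; rewrite (meanZ _ (all_moments_inL1 (mc f))).
  exact: mulrC.
apply: eq_mean => x; rewrite -(grid_sum_moment i2 (c^~ x)).
rewrite (eq_mean _ (fun y => expand (c^~ x) (fun l => grid_incr i2 l y))).
rewrite mean_sum; last by move=> f; exact: inL1Z.
apply: eq_bigr => f _; rewrite (meanZ _ (iD f)).
exact: mulrC.
Qed.

Lemma grid_bilinear_all_moments i1 i2 (a : nat -> nat -> R) N :
  all_moments P (grid_bilinear i1 i2 a N).
Proof.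
apply: all_moments_sum => l; apply: all_momentsM.
  exact: (grid_sum_all_moments i1 (fun k => a k l) N).
exact: grid_incr_all_moments.
Qed.

(** Let c l be the linear forms in the first component that multiply the
    increments of the second one, and v l their variances. Jensen's inequality
    for the weights v l bounds the power of the sum of the squares of the c l by
    a combination of the powers of c l ^ 2 / v l, whose means do not depend on
    l. *)
Theorem grid_bilinear_moment_le i1 i2 (a : nat -> nat -> R) N n : i1 != i2 ->
  mean P (fun x => grid_bilinear i1 i2 a N x ^+ (2 * n.+1)) <=
  gauss_moment 1 (2 * n.+1) ^+ 2 *
    (h ^+ 2 * \sum_(l < N) \sum_(k < N) a k l ^+ 2) ^+ n.+1.
Proof.
move=> i12; rewrite grid_bilinear_moment//.
pose c (l : 'I_N) x := \sum_(k < N) a k l * grid_incr i1 k x.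
pose v (l : 'I_N) := h * \sum_(k < N) a k l ^+ 2.
pose g := gauss_moment (1 : R) (2 * n.+1).
have g0 : 0 <= g by exact: gauss_moment_ge0.
have ssq0 (l : 'I_N) : 0 <= \sum_(k < N) a k l ^+ 2.
  by apply: sumr_ge0 => k _; exact: sqr_ge0.
have v0 (l : 'I_N) : 0 <= v l by rewrite mulr_ge0.
(* c l vanishes identically when v l does, so the quotient is harmless *)
have cv (l : 'I_N) x : c l x ^+ 2 = v l * (c l x ^+ 2 / v l).
  have [vl|vl] := eqVneq (v l) 0; last by rewrite mulrC divfK.
  have /eqP : \sum_(k < N) a k l ^+ 2 = 0.
    by move/eqP : vl; rewrite mulf_eq0 gt_eqF//= => /eqP.
  rewrite psumr_eq0; last by move=> k _; exact: sqr_ge0.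
  move=> /allP al; rewrite vl mul0r /c big1 ?expr0n// => k _.
  by have := al k (mem_index_enum k); rewrite sqrf_eq0 => /eqP ->; rewrite mul0r.
pose V := \sum_l v l.
have V0 : 0 <= V by exact: sumr_ge0.
have bound x : gauss_moment (h * \sum_(l < N) c l x ^+ 2) (2 * n.+1) <=
    \sum_l (g * h ^+ n.+1 * V ^+ n * v l / v l ^+ n.+1) * c l x ^+ (2 * n.+1).
  rewrite gauss_moment_even; last by rewrite mulr_ge0// sumr_ge0// => l _; exact: sqr_ge0.
  rewrite exprMn mulrA.
  under eq_bigr do rewrite cv.
  apply: le_trans (ler_wpM2l _ (power_mean_le n v0 _)) _.
  - by rewrite mulr_ge0// exprn_ge0.
  - by move=> l; rewrite divr_ge0// sqr_ge0.
  rewrite le_eqVlt; apply/orP; left; apply/eqP.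
  rewrite mulrA mulr_sumr; apply: eq_bigr => l _.
  by rewrite exprM expr_div_n -/g -/V; ring.
have ic (l : 'I_N) : inL1 P (fun x => c l x ^+ (2 * n.+1)).
  apply/all_moments_inL1/all_momentsX.
  exact: (grid_sum_all_moments i1 (fun k => a k l) N).
apply: (@le_trans _ _ (mean P (fun x =>
    \sum_l (g * h ^+ n.+1 * V ^+ n * v l / v l ^+ n.+1) * c l x ^+ (2 * n.+1)))).
  apply: le_mean => //; last by apply: inL1_sum => l; exact: inL1Z.
  apply: (@eq_inL1 _ _ _ _ (fun x => g * (h * \sum_(l < N) c l x ^+ 2) ^+ n.+1)).
    move=> x; rewrite [RHS]gauss_moment_even// mulr_ge0// sumr_ge0// => l _.
    exact: sqr_ge0.
  apply: inL1Z; apply/all_moments_inL1/all_momentsX/all_momentsM.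
    exact: all_moments_cst.
  apply: all_moments_sum => l; apply: all_momentsX.
  exact: (grid_sum_all_moments i1 (fun k => a k l) N).
rewrite mean_sum; last by move=> l; exact: inL1Z.
have -> : g ^+ 2 * (h ^+ 2 * \sum_(l < N) \sum_(k < N) a k l ^+ 2) ^+ n.+1 =
    \sum_l g ^+ 2 * h ^+ n.+1 * V ^+ n * v l.
  have -> : h ^+ 2 * \sum_(l < N) \sum_(k < N) a k l ^+ 2 = h * V.
    by rewrite expr2 -mulrA mulr_sumr.
  by rewrite -mulr_sumr -/V exprMn [V ^+ n.+1]exprSr; ring.
apply: ler_sum => l _; rewrite meanZ//.
rewrite (grid_sum_moment i1 (fun k => a k l)) -/(v l) gauss_moment_even// -/g.
have [->|vl] := eqVneq (v l) 0; first by rewrite !mulr0 !mul0r.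
rewrite le_eqVlt; apply/orP; left; apply/eqP.
by field; rewrite expf_neq0.
Qed.

End Chaos.

(** * Riemann sums and the norm of the kernel *)

Section Riemann.
Context {R : realType}.
Implicit Types (t T x y v : R) (f g G : R -> R) (N n k : nat).

(** The Riemann integral of g over [t, T] in the form needed here: an
    antiderivative on the whole line is available. *)
Definition is_integral t T g v : Prop :=
  exists2 G, (forall x, is_derive x 1 G (g x)) & G T - G t = v.

Definition lipschitz_bounded t T g : Prop := exists2 L : R, 0 <= L &
  forall x y, t <= x <= T -> t <= y <= T ->
    `|g x| <= L /\ `|g x - g y| <= L * `|x - y|.

Lemma eq_is_integral t T f g v : f =1 g -> is_integral t T f v ->
  is_integral t T g v.
Proof. by move=> /funext ->. Qed.

Lemma is_integralD t T f g u v : is_integral t T f u -> is_integral t T g v ->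
  is_integral t T (fun x => f x + g x) (u + v).
Proof.
move=> [A dA <-] [B dB <-]; exists (fun x => A x + B x); last by ring.
by move=> x; have := is_deriveD (dA x) (dB x).
Qed.

Lemma is_integralZ t T g (c : R) v : is_integral t T g v ->
  is_integral t T (fun x => c * g x) (c * v).
Proof.
move=> [A dA <-]; exists (fun x => c * A x); last by ring.
by move=> x; have := is_deriveZ c (dA x).
Qed.

Lemma is_integral_cst t T (c : R) : is_integral t T (fun=> c) (c * (T - t)).
Proof.
exists (fun x => c * x); last by ring.
move=> x; have := is_deriveZ c (is_derive_id x 1).
by move/is_derive_eq; apply; rewrite /GRing.scale/= mulr1.
Qed.

Lemma is_integral_le t T f g u v : t <= T ->
  (forall x, t <= x <= T -> f x <= g x) ->
  is_integral t T f u -> is_integral t T g v -> u <= v.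
Proof.
move=> tT fg [A dA <-] [B dB <-]; rewrite -subr_ge0.
have dBA x : is_derive x 1 (fun x => B x - A x) (g x - f x).
  exact: is_deriveB (dB x) (dA x).
have [c /fg cT] := is_derive_MVT tT dBA.
have -> : B T - A T - (B t - A t) = B T - B t - (A T - A t) by ring.
by move=> ->; rewrite mulr_ge0 ?subr_ge0.
Qed.

Lemma lipschitz_bounded_cst t T (c : R) : lipschitz_bounded t T (fun=> c).
Proof.
by exists `|c| => // x y _ _; rewrite subrr normr0 mulr_ge0.
Qed.

Lemma lipschitz_bounded_id t T : lipschitz_bounded t T id.
Proof.
exists (1 + `|t| + `|T|); first by rewrite !addr_ge0.
move=> x y /andP[tx xT] _; split; last first.
  by rewrite ler_peMl// -addrA lerDl addr_ge0.
rewrite ler_norml; have := ler_norm T; have := ler_norm (- t); rewrite normrN.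
by have := normr_ge0 t; have := normr_ge0 T; move=> *; apply/andP; split; lra.
Qed.

Lemma lipschitz_boundedD t T f g : lipschitz_bounded t T f ->
  lipschitz_bounded t T g -> lipschitz_bounded t T (fun x => f x + g x).
Proof.
move=> [K K0 fK] [L L0 gL]; exists (K + L); first exact: addr_ge0.
move=> x y hx hy; have [f1 f2] := fK _ _ hx hy; have [g1 g2] := gL _ _ hx hy.
split; first by apply: le_trans (ler_normD _ _) _; exact: lerD.
rewrite (_ : f x + g x - (f y + g y) = (f x - f y) + (g x - g y)); last by ring.
by rewrite mulrDl; apply: le_trans (ler_normD _ _) _; exact: lerD.
Qed.

Lemma lipschitz_boundedM t T f g : lipschitz_bounded t T f ->
  lipschitz_bounded t T g -> lipschitz_bounded t T (fun x => f x * g x).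
Proof.
move=> [K K0 fK] [L L0 gL]; exists (2 * (1 + K) * (1 + L)).
  by rewrite !mulr_ge0// addr_ge0.
move=> x y hx hy; have [f1 f2] := fK _ _ hx hy; have [g1 g2] := gL _ _ hx hy.
have [_ [gy _]] := (I, gL _ _ hy hx).
have KL : 0 <= K * L by rewrite mulr_ge0.
split.
  rewrite normrM; apply: (@le_trans _ _ (K * L)); first exact: ler_pM.
  by nra.
rewrite (_ : f x * g x - f y * g y = f x * (g x - g y) + (f x - f y) * g y); last by ring.
apply: le_trans (ler_normD _ _) _; rewrite !normrM.
have h1 : `|f x| * `|g x - g y| <= K * (L * `|x - y|) by exact: ler_pM.
have h2 : `|f x - f y| * `|g y| <= K * `|x - y| * L by exact: ler_pM.
apply: (@le_trans _ _ (2 * (K * L) * `|x - y|)); first by lra.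
by rewrite ler_wpM2r//; nra.
Qed.

Lemma lipschitz_bounded_is_derive t T f G : lipschitz_bounded t T f ->
  t <= T ->
  (forall x, is_derive x 1 G (f x)) -> lipschitz_bounded t T G.
Proof.
move=> [L L0 fL] tT dG.
have lip x y : t <= x <= T -> t <= y <= T -> `|G x - G y| <= L * `|x - y|.
  wlog yx : x y / y <= x.
    move=> H hx hy; have [|/ltW] := leP y x; first by move=> yx; exact: H.
    by move=> xy; rewrite distrC [`|x - y|]distrC; exact: H.
  move=> /andP[tx xT] /andP[ty yT].
  have [c /andP[yc cx] ->] := is_derive_MVT yx dG.
  have hc : t <= c <= T by rewrite (le_trans ty yc) (le_trans cx xT).
  by rewrite normrM ler_wpM2r//; case: (fL _ _ hc hc).
exists (`|G t| + L * (1 + (T - t))).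
  by rewrite addr_ge0// mulr_ge0// addr_ge0// subr_ge0.
have ht : t <= t <= T by rewrite lexx.
move=> x y hx hy; split.
  rewrite -[G x](subrK (G t)) addrC (le_trans (ler_normD _ _))// lerD2l.
  apply: (le_trans (lip _ _ hx ht)); rewrite ler_wpM2l//.
  move: hx => /andP[tx xT]; rewrite ger0_norm ?subr_ge0//.
  by rewrite ler_wpDl// lerB.
apply: (le_trans (lip _ _ hx hy)); rewrite ler_wpM2r//.
rewrite mulrDr mulr1 ler_wpDl// lerDl mulr_ge0// subr_ge0//.
Qed.

Section Grid.
Variables (t T : R).
Hypothesis tT : t < T.

Definition mesh N : R := (T - t) / N.+1%:R.
Definition node N k : R := t + k%:R * mesh N.

Lemma mesh_gt0 N : 0 < mesh N.
Proof. by rewrite divr_gt0// subr_gt0. Qed.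

Lemma mesh_sum N : N.+1%:R * mesh N = T - t.
Proof. by rewrite mulrC divfK. Qed.

Lemma nodeS N k : node N k.+1 = node N k + mesh N.
Proof. by rewrite /node -natr1; ring. Qed.

Lemma node_itv N k : (k <= N.+1)%N -> t <= node N k <= T.
Proof.
move=> kN; have h0 := mesh_gt0 N.
rewrite /node lerDl mulr_ge0 ?(ltW h0)//= -lerBrDl -(mesh_sum N).
by rewrite ler_wpM2r ?(ltW h0)// ler_nat.
Qed.

Lemma node_last N : node N N.+1 = T.
Proof. by rewrite /node mesh_sum; ring. Qed.

(** By the mean value theorem the error on each cell is at most
    L * mesh N ^ 2. *)
Lemma riemann_sum_le g G L N n :
  (forall x y, t <= x <= T -> t <= y <= T ->
    `|g x| <= L /\ `|g x - g y| <= L * `|x - y|) -> 0 <= L ->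
  (forall x, is_derive x 1 G (g x)) -> (n <= N.+1)%N ->
  `|mesh N * (\sum_(k < n) g (node N k)) - (G (node N n) - G t)| <=
  L * (T - t) * mesh N.
Proof.
move=> gL L0 dG; have h0 := ltW (mesh_gt0 N).
suff H n' : (n' <= N.+1)%N ->
    `|mesh N * (\sum_(k < n') g (node N k)) - (G (node N n') - G t)| <=
    n'%:R * (L * mesh N ^+ 2).
  move=> nN; apply: (le_trans (H _ nN)).
  rewrite (_ : L * _ * _ = N.+1%:R * (L * mesh N ^+ 2)).
    by rewrite ler_wpM2r ?ler_nat// mulr_ge0// exprn_ge0.
  by rewrite -(mesh_sum N); ring.
elim: n' => [|n' ih] nN.
  by rewrite big_ord0 mulr0 /node mul0r addr0 subrr subrr normr0 mul0r.
have le1 : node N n' <= node N n'.+1 by rewrite nodeS lerDl.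
have [c /andP[c1 c2] e] := is_derive_MVT le1 dG.
have hn := node_itv (ltnW nN); have hn1 := node_itv nN.
have hc : t <= c <= T.
  by case/andP: hn => ? _; case/andP: hn1 => _ ?; rewrite (le_trans _ c1)// (le_trans c2).
rewrite big_ord_recr/= mulrDr.
rewrite (_ : _ - _ = (mesh N * (\sum_(k < n') g (node N k)) - (G (node N n') - G t)) +
  mesh N * (g (node N n') - g c)); last first.
  have -> : G (node N n'.+1) = G (node N n') + g c * mesh N.
    by rewrite -[mesh N](_ : node N n'.+1 - node N n' = _) -?e ?nodeS; ring.
  by ring.
rewrite (le_trans (ler_normD _ _))// -natr1 mulrDl mul1r.
apply: lerD; first exact/ih/ltnW.
rewrite normrM ger0_norm// expr2 mulrCA ler_wpM2l//.
have [_ /le_trans] := gL _ _ hn hc; apply; rewrite ler_wpM2l//.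
by rewrite ler0_norm ?subr_le0// opprB lerBlDl -nodeS.
Qed.

Lemma mesh_cvg : mesh N @[N --> \oo] --> (0 : R).
Proof.
rewrite -[X in _ --> X](mulr0 (T - t)); apply: cvgM; first exact: cvg_cst.
exact: cvg_harmonic.
Qed.

Lemma cvg_dist_mesh (u : nat -> R) (l C : R) :
  (forall N, `|u N - l| <= C * mesh N) -> u N @[N --> \oo] --> l.
Proof.
move=> H; apply/subr_cvg0/norm_cvg0P.
apply: (@squeeze_cvgr _ _ _ _ (fun=> 0) (fun N => C * mesh N)).
- by apply: nearW => N; rewrite normr_ge0/= H.
- exact: cvg_cst.
- by rewrite -[X in _ --> X](mulr0 C); apply: cvgM; [exact: cvg_cst|exact: mesh_cvg].
Qed.

Lemma riemann_sum_cvg g v : lipschitz_bounded t T g -> is_integral t T g v ->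
  mesh N * (\sum_(k < N.+1) g (node N k)) @[N --> \oo] --> v.
Proof.
move=> [L L0 gL] [G dG <-]; apply: (@cvg_dist_mesh _ _ (L * (T - t))) => N.
by have := riemann_sum_le gL L0 dG (leqnn N.+1); rewrite node_last.
Qed.

(** The inner sums are Riemann sums of f with an error that is uniform in l, so up
    to O(mesh N) the double sum is a Riemann sum of g * (F1 - F1 t). *)
Lemma iterated_riemann_sum_cvg f F1 g v :
  lipschitz_bounded t T f -> lipschitz_bounded t T g ->
  (forall x, is_derive x 1 F1 (f x)) ->
  is_integral t T (fun y => g y * (F1 y - F1 t)) v ->
  mesh N ^+ 2 * (\sum_(l < N.+1) \sum_(k < l) f (node N k) * g (node N l))
    @[N --> \oo] --> v.
Proof.
move=> lf lg dF iv.
have lF := lipschitz_bounded_is_derive lf (ltW tT) dF.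
have lgF : lipschitz_bounded t T (fun y => g y * (F1 y - F1 t)).
  apply: lipschitz_boundedM => //; apply: lipschitz_boundedD => //.
  exact: lipschitz_bounded_cst.
have cvg1 := riemann_sum_cvg lgF iv.
move: lf lg => [L L0 fL] [K K0 gK].
pose u N := mesh N ^+ 2 *
  (\sum_(l < N.+1) \sum_(k < l) f (node N k) * g (node N l)).
pose r N := mesh N * (\sum_(k < N.+1) g (node N k) * (F1 (node N k) - F1 t)).
rewrite -[v]add0r -/u (_ : u = fun N => (u N - r N) + r N); last first.
  by apply/funext => N; rewrite subrK.
apply: cvgD => //.
apply: (@cvg_dist_mesh _ _ ((T - t) * K * (L * (T - t)))) => N.
have h0 := ltW (mesh_gt0 N).
rewrite subr0 /u /r expr2 -mulrA -mulrBr mulr_sumr -sumrB normrM ger0_norm//.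
apply: (@le_trans _ _ (mesh N * \sum_(l < N.+1) (K * (L * (T - t) * mesh N)))).
  rewrite ler_wpM2l// (le_trans (ler_norm_sum _ _ _))//; apply: ler_sum => l _.
  have hl := node_itv (ltnW (ltn_ord l)).
  rewrite -mulr_suml (_ : _ - _ = g (node N l) *
    (mesh N * (\sum_(k < l) f (node N k)) - (F1 (node N l) - F1 t))); last by ring.
  rewrite normrM; apply: ler_pM => //; first by case: (gK _ _ hl hl).
  exact: (riemann_sum_le fL L0 dF (ltnW (ltn_ord l))).
rewrite sumr_const card_ord -mulr_natl.
by rewrite -[X in X * K * _](mesh_sum N) le_eqVlt; apply/orP; left; apply/eqP; ring.
Qed.

End Grid.
End Riemann.

Lemma cvg_eq (R : realType) (u v : nat -> R) (l : R) :
  (forall N, v N = u N) -> u N @[N --> \oo] --> l -> v N @[N --> \oo] --> l.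
Proof. by move=> /funext ->. Qed.

Lemma cvg_seq_sum (R : realType) (I : eqType) (s : seq I) (f : I -> nat -> R)
    (l : I -> R) :
  (forall i, i \in s -> f i N @[N --> \oo] --> l i) ->
  \sum_(i <- s) f i N @[N --> \oo] --> \sum_(i <- s) l i.
Proof.
elim: s => [|i s ih] H.
  by under eq_fun do rewrite big_nil; rewrite big_nil; exact: cvg_cst.
under eq_fun do rewrite big_cons.
rewrite big_cons; apply: cvgD; first by apply: H; rewrite mem_head.
by apply: ih => j js; apply: H; rewrite inE js orbT.
Qed.

Section KernelNorm.
Context {R : realType} {t T : R}.
Hypothesis tT : t < T.
Variables (phi Phi : nat -> R -> R) (s : seq (nat * nat)) (beta : nat * nat -> R).

(** Evaluated at the coefficients zeta of the two components, this is the
    truncated expansion of the area; evaluated at the values of the phi i at two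
    points, it is the kernel of that expansion. *)
Definition skew_sum (z1 z2 : nat -> R) : R :=
  \sum_(p <- s) beta p * (z1 p.1 * z2 p.2 - z1 p.2 * z2 p.1).

Definition sgn_lt (k l : nat) : R := (k < l)%:R - (l < k)%:R.

(** Half the sign kernel, whose double stochastic integral is the Levy area,
    minus the kernel of the approximation. *)
Definition area_kernel N (k l : nat) : R :=
  sgn_lt k l / 2 - skew_sum (phi^~ (node t T N k)) (phi^~ (node t T N l)).

(** In the last condition c1 - c2 is the integral over x < y of
    phi p.1 (x) phi p.2 (y) - phi p.2 (x) phi p.1 (y), so that beta p is the
    coefficient of the kernel sgn(y - x) / 2 on this function. Taking p.2 < p.1
    makes the functions attached to distinct pairs orthogonal. *)
Record area_system : Prop := AreaSystem {
  sys_lipschitz : forall i, lipschitz_bounded t T (phi i) ;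
  sys_primitive : forall i (x : R), is_derive x 1 (Phi i) (phi i x) ;
  sys_orthonormal : forall i j,
    is_integral t T (fun x => phi i x * phi j x) (i == j)%:R ;
  sys_uniq : uniq s ;
  sys_ordered : forall p, p \in s -> (p.2 < p.1)%N ;
  sys_coef : forall p, p \in s -> exists c1 c2,
    [/\ is_integral t T (fun y => phi p.2 y * (Phi p.1 y - Phi p.1 t)) c1,
        is_integral t T (fun y => phi p.1 y * (Phi p.2 y - Phi p.2 t)) c2
      & c1 - c2 = 2 * beta p] }.

Hypothesis sys : area_system.

Let h N := mesh t T N.
Let ph N i k := phi i (node t T N k).
Let U N (x y : nat -> R) := \sum_(l < N.+1) \sum_(k < l) x k * y l.

Lemma sum_lt_mul N (x y : nat -> R) :
  \sum_(l < N.+1) \sum_(k < N.+1) (k < l)%:R * (x k * y l) = U N x y.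
Proof.
apply: eq_bigr => l _.
rewrite (big_ord_widen N.+1 (fun k => x k * y l)) ?(ltnW (ltn_ord l))//.
rewrite [RHS]big_mkcond; apply: eq_bigr => k _.
by case: ifP => _; rewrite ?mul1r ?mul0r.
Qed.

Lemma sum_gt_mul N (x y : nat -> R) :
  \sum_(l < N.+1) \sum_(k < N.+1) (l < k)%:R * (x k * y l) = U N y x.
Proof.
rewrite exchange_big -sum_lt_mul; apply: eq_bigr => k _; apply: eq_bigr => l _.
by rewrite [x k * y l]mulrC.
Qed.

Lemma sgn_sqr_cvg : h N ^+ 2 * (\sum_(l < N.+1) \sum_(k < N.+1) sgn_lt k l ^+ 2)
  @[N --> \oo] --> (T - t) ^+ 2.
Proof.
have i1 : is_integral t T (fun y : R => 1 * (y - t)) (2^-1 * (T - t) ^+ 2).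
  exists (fun y => 2^-1 * (y - t) ^+ 2); last by rewrite subrr; ring.
  by move=> x; apply: is_derive_eq; rewrite /GRing.scale/= -mulr_natl; field.
have c1 := iterated_riemann_sum_cvg tT (lipschitz_bounded_cst t T 1)
  (lipschitz_bounded_cst t T 1) (fun x => is_derive_id x 1) i1.
rewrite (_ : (T - t) ^+ 2 = 2^-1 * (T - t) ^+ 2 + 2^-1 * (T - t) ^+ 2); last by field.
apply: cvg_eq (cvgD c1 c1) => N; rewrite ?fctE.
rewrite -mulrDr; congr (_ * _); apply/esym.
rewrite -/(U N (fun=> 1) (fun=> 1)) -{1}sum_lt_mul -sum_gt_mul -big_split/=.
apply: eq_bigr => l _; rewrite -big_split/=; apply: eq_bigr => k _.
by rewrite /sgn_lt !mulr1; case: ltngtP => _ /=; ring.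
Qed.

Let e N (p : nat * nat) k l := ph N p.1 k * ph N p.2 l - ph N p.2 k * ph N p.1 l.

Lemma sgn_skew_cvg p : p \in s ->
  h N ^+ 2 * (\sum_(l < N.+1) \sum_(k < N.+1) sgn_lt k l * e N p k l)
  @[N --> \oo] --> 4 * beta p.
Proof.
move=> ps; have [c1 [c2 [i1 i2 e12]]] := sys_coef sys ps.
have C1 := iterated_riemann_sum_cvg tT (sys_lipschitz sys p.1)
  (sys_lipschitz sys p.2) (sys_primitive sys p.1) i1.
have C2 := iterated_riemann_sum_cvg tT (sys_lipschitz sys p.2)
  (sys_lipschitz sys p.1) (sys_primitive sys p.2) i2.
rewrite (_ : 4 * beta p = 2 * (c1 - c2)); last by rewrite e12; ring.
apply: cvg_eq (cvgM (cvg_cst (2 : R)) (cvgB C1 C2)) => N; rewrite ?fctE.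
apply/esym; rewrite -mulrBr mulrCA; congr (_ * _).
rewrite -/(U N (ph N p.1) (ph N p.2)) -/(U N (ph N p.2) (ph N p.1)).
rewrite [LHS](_ : _ = U N (ph N p.1) (ph N p.2) - U N (ph N p.2) (ph N p.1) -
  (U N (ph N p.2) (ph N p.1) - U N (ph N p.1) (ph N p.2))); last by ring.
rewrite -{1}sum_lt_mul -{1}sum_lt_mul -sum_gt_mul -[X in _ - (_ - X)]sum_gt_mul.
rewrite -!sumrB; apply: eq_bigr => l _; rewrite -!sumrB; apply: eq_bigr => k _.
by rewrite /sgn_lt /e; ring.
Qed.

Lemma gram_cvg i j : h N * (\sum_(k < N.+1) ph N i k * ph N j k)
  @[N --> \oo] --> ((i == j)%:R : R).
Proof.
apply: (riemann_sum_cvg tT _ (sys_orthonormal sys i j)).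
by apply: lipschitz_boundedM; exact: sys_lipschitz.
Qed.

Lemma skew_skew_cvg p q : p \in s -> q \in s ->
  h N ^+ 2 * (\sum_(l < N.+1) \sum_(k < N.+1) e N p k l * e N q k l)
  @[N --> \oo] --> (2 * (p == q)%:R : R).
Proof.
move=> /(sys_ordered sys) pp /(sys_ordered sys) qq.
have -> : 2 * (p == q)%:R = 2 * ((p.1 == q.1)%:R * (p.2 == q.2)%:R -
    (p.1 == q.2)%:R * (p.2 == q.1)%:R) :> R.
  case: p q pp qq => [i j] [i' j'] /= ji ji'; rewrite xpair_eqE.
  have [e1|_] := eqVneq i j'; last by rewrite mul0r subr0 -mulnb natrM.
  have [e2|_] := eqVneq j i'; last by rewrite mulr0 subr0 -mulnb natrM.
  by move: ji ji'; rewrite -e1 -e2 => a b; have := ltn_trans a b; rewrite ltnn.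
pose C i j := @gram_cvg i j.
apply: cvg_eq (cvgM (cvg_cst (2 : R)) (cvgB
  (cvgM (C p.1 q.1) (C p.2 q.2)) (cvgM (C p.1 q.2) (C p.2 q.1)))) => N.
rewrite ?fctE /=; apply/esym.
pose G i j := \sum_(k < N.+1) ph N i k * ph N j k.
rewrite -!/(G _ _).
transitivity (h N ^+ 2 * (2 * (G p.1 q.1 * G p.2 q.2 - G p.1 q.2 * G p.2 q.1))).
  by ring.
congr (_ * _).
have GG i j i' j' : G i i' * G j j' = \sum_(l < N.+1) \sum_(k < N.+1)
    ph N i k * ph N i' k * (ph N j l * ph N j' l).
  rewrite mulrC big_distrlr; apply: eq_bigr => l _; apply: eq_bigr => k _.
  exact: mulrC.
transitivity (G p.1 q.1 * G p.2 q.2 - G p.1 q.2 * G p.2 q.1 +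
  (G p.2 q.2 * G p.1 q.1 - G p.2 q.1 * G p.1 q.2)); first by ring.
rewrite !GG -!sumrB -big_split; apply: eq_bigr => l _ /=.
rewrite -!sumrB -big_split; apply: eq_bigr => k _ /=.
by rewrite /e; ring.
Qed.

(** Since the coefficients are half the projections of the sign kernel on the
    orthogonal kernels of the expansion, Pythagoras applies. *)
Theorem area_kernel_norm_cvg :
  h N ^+ 2 * (\sum_(l < N.+1) \sum_(k < N.+1) area_kernel N k l ^+ 2)
  @[N --> \oo] --> (T - t) ^+ 2 / 4 - 2 * \sum_(p <- s) beta p ^+ 2.
Proof.
have C1 : 4^-1 * (h N ^+ 2 * (\sum_(l < N.+1) \sum_(k < N.+1) sgn_lt k l ^+ 2))
    @[N --> \oo] --> 4^-1 * (T - t) ^+ 2.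
  by apply: cvgM; [exact: cvg_cst|exact: sgn_sqr_cvg].
have C2 : \sum_(p <- s) beta p *
      (h N ^+ 2 * (\sum_(l < N.+1) \sum_(k < N.+1) sgn_lt k l * e N p k l))
    @[N --> \oo] --> \sum_(p <- s) beta p * (4 * beta p).
  apply: (cvg_seq_sum (f := fun p N => _)) => p ps.
  by apply: cvgM; [exact: cvg_cst|exact: sgn_skew_cvg].
have C3 : \sum_(p <- s) \sum_(q <- s) beta p * beta q *
      (h N ^+ 2 * (\sum_(l < N.+1) \sum_(k < N.+1) e N p k l * e N q k l))
    @[N --> \oo] --> \sum_(p <- s) \sum_(q <- s) beta p * beta q * (2 * (p == q)%:R).
  apply: (cvg_seq_sum (f := fun p N => _)) => p ps.
  apply: (cvg_seq_sum (f := fun q N => _)) => q qs.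
  by apply: cvgM; [exact: cvg_cst|exact: skew_skew_cvg].
have -> : (T - t) ^+ 2 / 4 - 2 * \sum_(p <- s) beta p ^+ 2 =
    4^-1 * (T - t) ^+ 2 - \sum_(p <- s) beta p * (4 * beta p) +
    \sum_(p <- s) \sum_(q <- s) beta p * beta q * (2 * (p == q)%:R).
  have -> : \sum_(p <- s) \sum_(q <- s) beta p * beta q * (2 * (p == q)%:R) =
      2 * \sum_(p <- s) beta p ^+ 2.
    rewrite mulr_sumr big_seq [RHS]big_seq; apply: eq_bigr => p ps.
    rewrite (bigD1_seq p)//= ?(sys_uniq sys)// eqxx big1 ?addr0.
      by rewrite /=; ring.
    by move=> q; rewrite eq_sym => /negbTE ->; rewrite !mulr0.
  have -> : \sum_(p <- s) beta p * (4 * beta p) = 4 * \sum_(p <- s) beta p ^+ 2.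
    by rewrite mulr_sumr; apply: eq_bigr => p _; ring.
  by field.
apply: cvg_eq (cvgD (cvgB C1 C2) C3) => N; rewrite ?fctE /=.
have -> : \sum_(l < N.+1) \sum_(k < N.+1) area_kernel N k l ^+ 2 =
  4^-1 * (\sum_(l < N.+1) \sum_(k < N.+1) sgn_lt k l ^+ 2) -
  \sum_(p <- s) beta p * (\sum_(l < N.+1) \sum_(k < N.+1) sgn_lt k l * e N p k l) +
  \sum_(p <- s) \sum_(q <- s) beta p * beta q *
    (\sum_(l < N.+1) \sum_(k < N.+1) e N p k l * e N q k l).
  have pull0 (I : Type) (r : seq I) (f : I -> nat -> nat -> R) :
      \sum_(i <- r) \sum_(l < N.+1) \sum_(k < N.+1) f i k l =
      \sum_(l < N.+1) \sum_(k < N.+1) \sum_(i <- r) f i k l.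
    by rewrite exchange_big; apply: eq_bigr => l _; rewrite exchange_big.
  have pull (I : Type) (r : seq I) (c : I -> R) (f : I -> nat -> nat -> R) :
      \sum_(i <- r) c i * (\sum_(l < N.+1) \sum_(k < N.+1) f i k l) =
      \sum_(l < N.+1) \sum_(k < N.+1) \sum_(i <- r) c i * f i k l.
    rewrite -(pull0 _ r (fun i k l => c i * f i k l)).
    apply: eq_bigr => i _; rewrite mulr_sumr.
    by apply: eq_bigr => l _; rewrite mulr_sumr.
  rewrite (pull _ s beta (fun p k l => sgn_lt k l * e N p k l)).
  under [X in _ = _ + X]eq_bigr => p _ do
    rewrite (pull _ s (fun q => beta p * beta q) (fun q k l => e N p k l * e N q k l)).
  rewrite (pull0 _ s (fun p k l =>
    \sum_(q <- s) beta p * beta q * (e N p k l * e N q k l))).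
  rewrite [4^-1 * _]mulr_sumr -sumrB -big_split; apply: eq_bigr => l _ /=.
  rewrite [4^-1 * _]mulr_sumr -sumrB -big_split; apply: eq_bigr => k _ /=.
  pose X := skew_sum (phi^~ (node t T N k)) (phi^~ (node t T N l)).
  have -> : \sum_(p <- s) beta p * (sgn_lt k l * e N p k l) = sgn_lt k l * X.
    by rewrite mulr_sumr; apply: eq_bigr => p _; rewrite mulrCA.
  have -> : \sum_(p <- s) \sum_(q <- s) beta p * beta q * (e N p k l * e N q k l) = X ^+ 2.
    rewrite expr2 /X big_distrlr/=; apply: eq_bigr => p _; apply: eq_bigr => q _.
    exact: mulrACA.
  by rewrite /area_kernel -/X; field.
rewrite mulrDr mulrBr; congr (_ - _ + _); first by ring.
  by rewrite [LHS]mulr_sumr; apply: eq_bigr => p _; ring.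
rewrite [LHS]mulr_sumr; apply: eq_bigr => p _.
by rewrite [LHS]mulr_sumr; apply: eq_bigr => q _; ring.
Qed.

End KernelNorm.
Arguments area_system {R} t T phi Phi s beta.
Arguments area_kernel {R} t T phi s beta N k l.

(** * Almost sure convergence and the moments of the error *)

Section AlmostSure.
Context {R : realType} {d : measure_display} {Om : measurableType d}.
Variable P : probability Om R.

Lemma sum_inv_sqr_le n :
  \sum_(0 <= r < n.+1) (r.+1%:R ^- 2 : R) <= 2 - n.+1%:R^-1.
Proof.
elim: n => [|n ih]; first by rewrite big_nat1 expr1n invr1; lra.
rewrite big_nat_recr//=.
apply: (@le_trans _ _ (2 - n.+1%:R^-1 + n.+2%:R ^- 2)); first by rewrite lerD2r.
have n0 : 0 < n.+1%:R :> R by rewrite ltr0n.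
have -> : n.+2%:R = n.+1%:R + 1 :> R by rewrite natr1.
move: (n.+1%:R) n0 => y y0; rewrite -subr_ge0.
rewrite (_ : _ - _ = (y * (y + 1) ^+ 2)^-1); last first.
  by field; rewrite !gt_eqF//; lra.
by rewrite invr_ge0 mulr_ge0 ?exprn_ge0//; lra.
Qed.

(** Summable means force almost sure convergence: the sum of the series has a
    finite mean, hence is almost surely finite. *)
Lemma mean_summable_cvg (Y : nat -> Om -> R) (C : R) :
  (forall r, measurable_fun setT (Y r)) -> (forall r x, 0 <= Y r x) ->
  (forall r, ('E_P[Y r] <= (C * r.+1%:R ^- 2)%:E)%E) ->
  {ae P, forall x, Y r x @[r --> \oo] --> (0 : R)}.
Proof.
move=> mY Y0 EY.
have C0 : 0 <= C.
  have := le_trans (expectation_ge0 P (Y0 0%N)) (EY 0%N).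
  by rewrite lee_fin expr1n invr1 mulr1.
pose S x := (\sum_(0 <= r <oo) (Y r x)%:E)%E.
have mS : measurable_fun setT S.
  apply: ge0_emeasurable_sum; first by move=> r x _ _; rewrite lee_fin.
  by move=> r _; exact/measurable_EFinP.
have S0 x : (0 <= S x)%E by apply: nneseries_ge0 => r _ _; rewrite lee_fin.
have iS : P.-integrable setT S.
  apply/integrableP; split=> //.
  under eq_integral do rewrite gee0_abs//.
  rewrite /S integral_nneseries//; last 2 first.
  - by move=> r; exact/measurable_EFinP.
  - by move=> r x _; rewrite lee_fin.
  apply: (@le_lt_trans _ _ (C * 2)%:E); last by rewrite ltry.
  apply: lime_le.
    by apply: is_cvg_nneseries => r _ _; apply: integral_ge0 => x _; rewrite lee_fin.
  apply: nearW => -[|n]; first by rewrite big_nil lee_fin mulr_ge0.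
  apply: (@le_trans _ _ (\sum_(0 <= r < n.+1) (C * r.+1%:R ^- 2)%:E)%E).
    by apply: lee_sum => r _; have := EY r; rewrite unlock.
  rewrite sumEFin lee_fin -mulr_sumr ler_wpM2l// (le_trans (sum_inv_sqr_le n))//.
  by rewrite gerBl invr_ge0.
have := integrable_ae measurableT iS.
apply: filterS => x /(_ I) finS.
apply: cvg_series_cvg_0; apply: nondecreasing_is_cvgn.
  by apply/nondecreasing_seqP => n; rewrite !seriesEnat/= big_nat_recr//= lerDl.
exists (fine (S x)) => _ [n _ <-].
rewrite -lee_fin fineK// seriesEnat/= -sumEFin.
by apply: nneseries_lim_ge => r _; rewrite lee_fin.
Qed.

Lemma sqr_cvg0 (u : nat -> R) : u r ^+ 2 @[r --> \oo] --> 0 ->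
  u r @[r --> \oo] --> 0.
Proof.
move=> u2; apply/norm_cvg0P.
rewrite -(@sqrtr0 R); under eq_fun do rewrite -sqrtr_sqr.
exact: (cvg_comp _ _ u2 (@sqrt_continuous R 0)).
Qed.

Lemma mean_square_summable_cvg (Z : nat -> Om -> R) (X : Om -> R) (C : R) :
  (forall r, measurable_fun setT (Z r)) -> measurable_fun setT X ->
  (forall r, ('E_P[(fun x => (X x - Z r x) ^+ 2)%R] <=
    (C * r.+1%:R ^- 2)%:E)%E) ->
  {ae P, forall x, Z r x @[r --> \oo] --> X x}.
Proof.
move=> mZ mX EZ.
have := mean_summable_cvg (fun r => measurable_funX 2 (measurable_funB mX (mZ r)))
  (fun r x => sqr_ge0 (X x - Z r x)) EZ.
apply: filterS => x /sqr_cvg0 c; apply/subr_cvg0.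
rewrite -(@oppr0 R); under eq_fun do rewrite -opprB.
exact: cvgN.
Qed.

(** Fatou's lemma concerns the lower limit, which is almost surely the limit. *)
Lemma fatou_expectation_le (Y : nat -> Om -> R) (X : Om -> R) (b : nat -> R) (B : R) :
  (forall r, measurable_fun setT (Y r)) -> (forall r x, 0 <= Y r x) ->
  measurable_fun setT X ->
  {ae P, forall x, Y r x @[r --> \oo] --> X x} ->
  (forall r, ('E_P[Y r] <= (b r)%:E)%E) -> b r @[r --> \oo] --> B ->
  ('E_P[X] <= B%:E)%E.
Proof.
move=> mY Y0 mX YX EY bB; rewrite unlock.
pose f r x := (Y r x)%:E.
have mf r : measurable_fun setT (f r) by exact/measurable_EFinP.
have f0 r x : setT x -> (0 <= f r x)%E by rewrite lee_fin.
have -> : (\int[P]_x (X x)%:E = \int[P]_x limn_einf (f^~ x))%E.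
  apply: ae_eq_integral => //.
  - exact/measurable_EFinP.
  - apply: (@emeasurable_fun_cvg _ _ _ setT (fun n x => einfs (f^~ x) n)).
      by move=> n; exact: measurable_fun_einfs.
    by move=> x _; rewrite limn_einf_lim; exact: is_cvg_einfs.
  - apply: filterS YX => x Yx _; apply/esym.
    have c : f r x @[r --> \oo] --> (X x)%:E by apply: cvg_EFin Yx; exact: nearW.
    by have [] := cvg_limn_einf_sup c.
apply: (le_trans (fatou P measurableT mf f0)).
have c : (b r)%:E @[r --> \oo] --> B%:E by apply: cvg_EFin bB; exact: nearW.
rewrite -(cvg_lim _ c)// limn_einf_lim; apply: lee_lim.
- exact: is_cvg_einfs.
- by apply/cvg_ex; eexists; exact: c.
- apply: nearW => r; apply: le_trans (EY r); rewrite unlock.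
  by apply: ereal_inf_lbound; exists r => //=.
Qed.

End AlmostSure.

(** * The error of the expansion of the Levy area *)

Section GridNodes.
Context {R : realType} {t T : R}.
Hypothesis tT : t < T.
Implicit Types (u : R) (N k l : nat).

Lemma node_le N k l : (k <= l)%N -> node t T N k <= node t T N l.
Proof.
by move=> kl; rewrite /node lerD2l ler_wpM2r ?ler_nat// ltW// mesh_gt0.
Qed.

Lemma node0 N : node t T N 0 = t.
Proof. by rewrite /node mul0r addr0. Qed.

Lemma node_find N u : t <= u -> u < T ->
  exists k : 'I_N.+1, node t T N k <= u < node t T N k.+1.
Proof.
move=> tu uT.
suff H n : (n <= N.+1)%N -> u < node t T N n ->
    exists k : 'I_N.+1, node t T N k <= u < node t T N k.+1.
  by apply: (H N.+1) => //; rewrite node_last.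
elim: n => [|n ih] nN; first by rewrite node0 ltNge tu.
move=> un; have [nu|un'] := leP (node t T N n) u; last by apply: ih => //; exact: ltnW.
by exists (Ordinal nN); rewrite nu.
Qed.

Lemma node_unique N u k l : node t T N k <= u < node t T N k.+1 ->
  node t T N l <= u < node t T N l.+1 -> k = l.
Proof.
move=> /andP[ku uk] /andP[lu ul]; case: (ltngtP k l) => // /(node_le N) h.
- by have := lt_le_trans uk (le_trans h lu); rewrite ltxx.
- by have := lt_le_trans ul (le_trans h ku); rewrite ltxx.
Qed.

Definition grid_block {d} {Om : measurableType d} N (V : nat -> Om -> R) (k : 'I_N.+1) :=
  Block (node t T N k) (node t T N k.+1) (V k).

End GridNodes.
Arguments grid_block {R} t T {d Om} N V k.

Section LevyArea.
Context {R : realType} {d : measure_display} {Om : measurableType d}.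
Context {P : probability Om R} {F : R -> set (set Om)} {m : nat}
  {w : 'I_m -> R -> Om -> R}.
Hypotheses (hF : is_filtration F) (hw : is_wiener P F w).
Context {t T : R}.
Hypotheses (t0 : 0 <= t) (tT : t < T).
Implicit Types (i : 'I_m) (j k l n N : nat).

Let D i N k : Om -> R := grid_incr (w := w) (t := t) (h := mesh t T N) i k.

Lemma grid_block_eval N (V : nat -> Om -> R) (k : 'I_N.+1) u x :
  node t T N k <= u < node t T N k.+1 ->
  block_eval (grid_block t T N V) u x = V k x.
Proof.
move=> ku; rewrite /block_eval (bigD1 k)//= big1 ?addr0.
  by rewrite indicE mem_set ?mulr1//= in_itv.
move=> l lk; rewrite indicE memNset ?mulr0//= in_itv/= => lu.
by move/eqP: lk; apply; apply: val_inj; exact: node_unique tT _ _ _ _ lu ku.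
Qed.

Lemma grid_block_integral N (V : nat -> Om -> R) i x :
  block_integral (w i) (grid_block t T N V) x =
  \sum_(k < N.+1) V k x * D i N k x.
Proof. by []. Qed.

Lemma is_block_grid N (V : nat -> Om -> R) :
  (forall k, (k <= N)%N -> adapted_to (F (node t T N k)) (V k) /\ inL2 P (V k)) ->
  forall k : 'I_N.+1, is_block (P := P) (F := F) t T (grid_block t T N V k).
Proof.
move=> hV k; have [aV iV] := hV k (ltn_ord k).
split => //=.
- by case/andP: (node_itv tT (ltnW (ltn_ord k))).
- exact: node_le.
- by case/andP: (node_itv tT (ltn_ord k)).
Qed.

Let node_ge0 N k : 0 <= node t T N k.
Proof. by rewrite addr_ge0// mulr_ge0// ltW// mesh_gt0. Qed.

Lemma wiener_integral_approx i (phi : R -> R) (L : R) (Z : Om -> R) N :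
  0 <= L ->
  (forall x y, t <= x <= T -> t <= y <= T ->
    `|phi x| <= L /\ `|phi x - phi y| <= L * `|x - y|) ->
  is_ito_integral P F (w i) t T (fun s _ => phi s) Z ->
  ('E_P[(fun x => (Z x - \sum_(k < N.+1) phi (node t T N k) * D i N k x) ^+ 2)%R]
   <= (4 * (L * mesh t T N) ^+ 2 * (T - t))%:E)%E.
Proof.
move=> L0 phiL hZ; have h0 := ltW (mesh_gt0 tT N).
apply: (ito_integral_approx hF hw t0 (ltW tT) _ hZ
  (is_block_grid (V := fun k _ => phi (node t T N k)) _)).
- exact: sqr_ge0.
- move=> k _; split; last exact: inL2_cst.
  by apply: adapted_cst; apply: (filtration_sigma_algebra hF).
- move=> u /andP[tu uT]; have [k ku] := node_find N tu uT.
  have -> : (fun x => (block_eval (grid_block t T N (fun k _ => phi (node t T N k)))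
      u x - phi u) ^+ 2) = cst ((phi (node t T N k) - phi u) ^+ 2) :> (Om -> R).
    by apply/funext => x; rewrite (grid_block_eval _ _ ku).
  rewrite expectation_cst lee_fin -real_normK ?num_real//.
  apply: lerXn2r; rewrite ?nnegrE ?(mulr_ge0 L0 h0)//.
  have hk := node_itv tT (ltnW (ltn_ord k)).
  have hu : t <= u <= T by rewrite tu ltW.
  have [_ h1] := phiL _ _ hk hu; apply: (le_trans h1); rewrite ler_wpM2l//.
  case/andP: ku => ku uk.
  by rewrite ler0_norm ?subr_le0// opprB lerBlDl -nodeS ltW.
Qed.

(** The inner integral is only determined almost surely, at each time
    separately. A single block carries its integrand 1 without error. *)
Lemma levy_inner_integral i u (J : Om -> R) : t <= u ->
  is_ito_integral P F (w i) t u (fun _ _ => 1) J ->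
  ('E_P[(fun x => (J x - incr (w := w) i t u x) ^+ 2)%R] = 0)%E.
Proof.
move=> tu hJ; pose V (k : 'I_1) : block := Block t u (fun _ : Om => 1 : R).
apply/eqP; rewrite eq_le; apply/andP; split; last first.
  by apply: expectation_ge0 => x; exact: sqr_ge0.
have hV (k : 'I_1) : is_block (P := P) (F := F) t u (V k).
  split => //=; last exact: inL2_cst.
  by apply: adapted_cst; apply: (filtration_sigma_algebra hF).
have := ito_integral_approx hF hw t0 tu (lexx 0) hJ hV.
rewrite mulr0 mul0r.
have -> : (fun x => (J x - block_integral (w i) V x) ^+ 2) =
    (fun x => (J x - incr (w := w) i t u x) ^+ 2).
  by apply/funext => x; rewrite /block_integral big_ord1 /V/= mul1r.
apply=> v /andP[tv vu].
have -> : (fun x => (block_eval V v x - 1) ^+ 2) = cst 0 :> (Om -> R).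
  apply/funext => x; rewrite /block_eval big_ord1 /V/= mul1r indicE mem_set/=.
    by rewrite subrr expr0n.
  by rewrite in_itv/= tv.
by rewrite expectation_cst.
Qed.

(** The iterated integral is approximated by the triangular sum of products of
    increments, the inner integral being the increment of the Wiener process. *)
Lemma iterated_integral_approx i1 i2 (X : Om -> R) N :
  is_iterated_ito_integral P F (w i1) (w i2) t T X ->
  ('E_P[(fun x => (X x - \sum_(l < N.+1) (\sum_(k < l) D i1 N k x) * D i2 N l x)
     ^+ 2)%R] <= (8 * mesh t T N * (T - t))%:E)%E.
Proof.
move=> [J [hJ hX]]; have h0 := ltW (mesh_gt0 tT N).
pose V l : Om -> R := incr (w := w) i1 t (node t T N l).
have tnode l : t <= node t T N l by rewrite -[X in X <= _](node0 (T := T) N) (node_le tT).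
have VE l x : V l x = \sum_(k < l) D i1 N k x.
  rewrite /V; elim: l => [|l ih]; first by rewrite big_ord0 /incr node0 subrr.
  by rewrite big_ord_recr/= -ih /D /grid_incr /incr /node; ring.
have hV l : adapted_to (F (node t T N l)) (V l) /\ inL2 P (V l).
  split; first exact: (adapted_incr hF hw).
  have iL2 := inL2_incrM hF hw i1 t0 (tnode l)
    (adapted_cst (k := 1) (filtration_sigma_algebra hF t0)) (inL2_cst P 1).
  by have -> : V l = (fun x => 1 * incr (w := w) i1 t (node t T N l) x)
    by apply/funext => x; rewrite mul1r.
have -> : (fun x => (X x - \sum_(l < N.+1) (\sum_(k < l) D i1 N k x) * D i2 N l x) ^+ 2)
   = (fun x => (X x - block_integral (w i2) (grid_block t T N V) x) ^+ 2).
  apply/funext => x; rewrite grid_block_integral.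
  by under [in RHS]eq_bigr do rewrite VE.
have eps0 : 0 <= 2 * mesh t T N by rewrite mulr_ge0.
have := ito_integral_approx hF hw t0 (ltW tT) eps0 hX
  (is_block_grid (fun k _ => hV k)).
rewrite mulrA (_ : 4 * 2 = 8 :> R); last by ring.
apply=> u /andP[tu uT].
have [k ku] := node_find N tu uT; case/andP: (ku) => ku1 uk.
have u0 : 0 <= u := le_trans t0 tu.
have hJu : is_ito_integral P F (w i1) t u (fun _ _ => 1) (J u).
  by apply: hJ; rewrite tu ltW.
have [_ mJ _] := hJu.
have J0 := levy_inner_integral tu hJu.
have mVk := (hV k).2.1.
have mu : measurable_fun setT (incr (w := w) i1 t u) by exact: (measurable_incr hF hw).
have := expectation_sqrD_le P (measurable_funB mVk mu) (measurable_funB mu mJ).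
have -> : (fun x => ((V k \- incr (w := w) i1 t u) x +
    (incr (w := w) i1 t u \- J u) x) ^+ 2) =
    (fun x => (block_eval (grid_block t T N V) u x - J u x) ^+ 2).
  by apply/funext => x /=; rewrite (grid_block_eval _ _ ku) addrA subrK.
move/le_trans; apply.
have -> : (fun x => (incr (w := w) i1 t u \- J u) x ^+ 2) =
    (fun x => (J u x - incr (w := w) i1 t u x) ^+ 2).
  by apply/funext => x /=; rewrite -sqrrN opprB.
rewrite J0 mule0 adde0.
have -> : (fun x => (V k \- incr (w := w) i1 t u) x ^+ 2) =
    (fun x => incr (w := w) i1 (node t T N k) u x ^+ 2).
  by apply/funext => x; rewrite /V /incr /=; ring.
have [i2' e2'] := incr_moment hF hw i1 2 (node_ge0 N k) ku1.
rewrite meanE// e2' -EFinM lee_fin /= !mul1r mulr1 ler_wpM2l//.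
by rewrite lerBlDl -nodeS ltW.
Qed.

Section Expansion.
Variables (phi Phi : nat -> R -> R) (s : seq (nat * nat)) (beta : nat * nat -> R).
Hypothesis sys : area_system t T phi Phi s beta.
Variables (i1 i2 : 'I_m) (A : Om -> R) (zeta : 'I_m -> nat -> Om -> R).
Hypotheses (i12 : i1 != i2) (hA : is_levy_area P F w t T i1 i2 A)
  (hzeta : forall i j,
     is_ito_integral P F (w i) t T (fun u _ => phi j u) (zeta i j)).

Let err x := A x - skew_sum s beta (zeta i1 ^~ x) (zeta i2 ^~ x).

Let z i N x j := \sum_(k < N.+1) phi j (node t T N k) * D i N k x.
Let tri i i' N x := \sum_(l < N.+1) (\sum_(k < l) D i N k x) * D i' N l x.
Let kernel N := area_kernel t T phi s beta N.
Let Q N := grid_bilinear (w := w) (t := t) (h := mesh t T N) i1 i2 (kernel N) N.+1.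

Lemma kernel_bilinearE N x :
  Q N x = 2^-1 * (tri i1 i2 N x - tri i2 i1 N x) -
    skew_sum s beta (z i1 N x) (z i2 N x).
Proof.
pose D1 k := D i1 N k x; pose D2 k := D i2 N k x.
have tri12 : tri i1 i2 N x = \sum_(l < N.+1) \sum_(k < l) D1 k * D2 l.
  by apply: eq_bigr => l _; rewrite mulr_suml.
have tri21 : tri i2 i1 N x = \sum_(l < N.+1) \sum_(k < l) D2 k * D1 l.
  by apply: eq_bigr => l _; rewrite mulr_suml.
have skewE : skew_sum s beta (z i1 N x) (z i2 N x) =
    \sum_(l < N.+1) \sum_(k < N.+1)
      skew_sum s beta (phi^~ (node t T N k)) (phi^~ (node t T N l)) * (D1 k * D2 l).
  rewrite exchange_big/=.
  transitivity (\sum_(p <- s) \sum_(k < N.+1) \sum_(l < N.+1) beta p *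
     (phi p.1 (node t T N k) * phi p.2 (node t T N l) -
      phi p.2 (node t T N k) * phi p.1 (node t T N l)) * (D1 k * D2 l)).
    apply: eq_bigr => p _; rewrite /z !big_distrlr/= -sumrB mulr_sumr.
    apply: eq_bigr => k _; rewrite -sumrB mulr_sumr; apply: eq_bigr => l _.
    by rewrite /D1 /D2; ring.
  rewrite exchange_big; apply: eq_bigr => k _.
  rewrite exchange_big; apply: eq_bigr => l _.
  by rewrite mulr_suml.
rewrite tri12 tri21 skewE -sum_lt_mul -(sum_gt_mul N D1 D2).
rewrite -sumrB mulr_sumr -sumrB; apply: eq_bigr => l _.
rewrite -sumrB mulr_sumr -sumrB mulr_suml; apply: eq_bigr => k _.
by rewrite /kernel /area_kernel /sgn_lt /D1 /D2 /D; field.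
Qed.

(** The index of the grid with (r + 1)^2 steps: mean-square errors of the order
    of the mesh become summable in r. *)
Let Nr r := (r.+1 ^ 2).-1.

Let mesh_Nr r : mesh t T (Nr r) = (T - t) * r.+1%:R ^- 2.
Proof. by rewrite /mesh /Nr prednK ?expn_gt0// natrX. Qed.

Lemma measurable_grid_linear i (c : nat -> R) N :
  measurable_fun setT (fun x => \sum_(k < N.+1) c k * D i N k x).
Proof.
by case: (grid_sum_all_moments hF hw t0 (mesh_gt0 tT N) i c N.+1).
Qed.

Lemma wiener_integral_cvg i j :
  {ae P, forall x, z i (Nr r) x j @[r --> \oo] --> zeta i j x}.
Proof.
have [_ mZ _] := hzeta i j; have [L L0 phiL] := sys_lipschitz sys j.
have mz r : measurable_fun setT (fun x => z i (Nr r) x j).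
  exact: (measurable_grid_linear i (fun k => phi j (node t T (Nr r) k))).
apply: (mean_square_summable_cvg (C := 4 * (L * (T - t)) ^+ 2 * (T - t)) mz mZ).
move=> r; apply: (le_trans (wiener_integral_approx _ L0 phiL (hzeta i j))).
rewrite lee_fin mesh_Nr; set rho := r.+1%:R ^- 2.
have r0 : 0 <= rho by rewrite invr_ge0 exprn_ge0.
have r1 : rho <= 1.
  by rewrite invf_le1 ?exprn_gt0// exprn_ege1// ler1n.
have -> : 4 * (L * ((T - t) * rho)) ^+ 2 * (T - t) =
    4 * (L * (T - t)) ^+ 2 * (T - t) * rho * rho by ring.
rewrite ler_piMr// mulr_ge0// !mulr_ge0 ?sqr_ge0// subr_ge0 ltW//.
Qed.

Lemma iterated_integral_cvg i i' (X : Om -> R) :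
  is_iterated_ito_integral P F (w i) (w i') t T X ->
  {ae P, forall x, tri i i' (Nr r) x @[r --> \oo] --> X x}.
Proof.
move=> hX; have [J [_ [_ mX _]]] := hX.
have mtri r : measurable_fun setT (tri i i' (Nr r)).
  have aD i3 k := grid_incr_all_moments hF hw t0 (mesh_gt0 tT (Nr r)) i3 k.
  have [] : all_moments P (tri i i' (Nr r)).
    apply: all_moments_sum => l; apply: all_momentsM; last exact: aD.
    by apply: all_moments_sum => k; exact: aD.
  by [].
apply: (mean_square_summable_cvg (C := 8 * (T - t) ^+ 2) mtri mX) => r.
apply: (le_trans (iterated_integral_approx (Nr r) hX)).
by rewrite lee_fin mesh_Nr le_eqVlt; apply/orP; left; apply/eqP; ring.
Qed.

Lemma kernel_bilinear_cvg :
  {ae P, forall x, Q (Nr r) x @[r --> \oo] --> err x}.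
Proof.
have [I12 [I21 [h12 h21 AE]]] := hA.
have c1 := iterated_integral_cvg h12; have c2 := iterated_integral_cvg h21.
have c3 := ae_foralln (wiener_integral_cvg i1).
have c4 := ae_foralln (wiener_integral_cvg i2).
apply: filterS2 (filterI c1 c2) (filterI c3 c4) => x [{}c1 {}c2] [{}c3 {}c4].
rewrite /err AE; rewrite (funext (fun r => kernel_bilinearE (Nr r) x)).
apply: cvgB; first by apply: cvgM; [exact: cvg_cst|exact: cvgB].
apply: (cvg_seq_sum (f := fun p r => _)) => p _; apply: cvgM; first exact: cvg_cst.
by apply: cvgB; exact: cvgM.
Qed.

Lemma measurable_err : measurable_fun setT err.
Proof.
have [I12 [I21 [[J1 [_ [_ m12 _]]] [J2 [_ [_ m21 _]]] AE]]] := hA.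
have mz i j : measurable_fun setT (zeta i j) by have [] := hzeta i j.
rewrite /err AE; apply: measurable_funB.
  by apply: measurable_funM => //; exact: measurable_funB.
apply: measurable_sum => p; apply: measurable_funM => //.
by apply: measurable_funB; exact: measurable_funM.
Qed.

(** By Fatou's lemma the moment bound for the bilinear forms passes to their
    almost sure limit, with the limit of the norms of their kernels. *)
Theorem levy_area_moment_le n :
  ('E_P[(fun x => err x ^+ (2 * n.+1))%R] <=
   (gauss_moment 1 (2 * n.+1) ^+ 2 *
     ((T - t) ^+ 2 / 4 - 2 * \sum_(p <- s) beta p ^+ 2) ^+ n.+1)%:E)%E.
Proof.
have cvgX (u : nat -> R) (l : R) k : u r @[r --> \oo] --> l ->
    u r ^+ k @[r --> \oo] --> l ^+ k.
  by move=> ul; exact: (cvg_comp _ _ ul (@exprn_continuous R k l)).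
have aQ r : all_moments P (fun x => Q (Nr r) x ^+ (2 * n.+1)).
  apply: all_momentsX.
  exact: (grid_bilinear_all_moments hF hw t0 (mesh_gt0 tT (Nr r))).
have Nr_oo : Nr r @[r --> \oo] --> \oo.
  apply/cvgnyPge => M; near=> r.
  have rM : (M <= r)%N by near: r; exact: nbhs_infty_ge.
  by rewrite (leq_trans rM)// /Nr -ltnS prednK ?expn_gt0// -mulnn leq_pmulr.
apply: (fatou_expectation_le (Y := fun r x => Q (Nr r) x ^+ (2 * n.+1))
  (b := fun r => gauss_moment 1 (2 * n.+1) ^+ 2 * (mesh t T (Nr r) ^+ 2 *
    (\sum_(l < (Nr r).+1) \sum_(k < (Nr r).+1) kernel (Nr r) k l ^+ 2)) ^+ n.+1)).
- by move=> r; case: (aQ r).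
- by move=> r x; rewrite exprM exprn_ge0// sqr_ge0.
- exact/measurable_funX/measurable_err.
- by apply: filterS kernel_bilinear_cvg => x; exact: cvgX.
- move=> r; rewrite meanE; last exact/all_moments_inL1.
  by rewrite lee_fin; exact: (grid_bilinear_moment_le hF hw t0 (mesh_gt0 tT (Nr r))).
- apply: cvgM; first exact: cvg_cst.
  apply: cvgX; exact: (cvg_comp _ _ Nr_oo (area_kernel_norm_cvg tT sys)).
Unshelve. all: by end_near. Qed.

End Expansion.
End LevyArea.

(** * The Legendre system *)

Section PolyIntegral.
Context {R : realType}.
Implicit Types (p q G : {poly R}) (a : R).

Definition poly_prim p : {poly R} := \poly_(i < (size p).+1) (p`_i.-1 / i%:R).

Lemma poly_primK p : (poly_prim p)^`() = p.
Proof.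
apply/polyP => i; rewrite coef_deriv coef_poly ltnS.
have [si|si] := ltnP i (size p); last by rewrite mul0rn nth_default.
by rewrite -[LHS]mulr_natr divfK// pnatr_eq0.
Qed.

(** The integral over [-1, 1]. *)
Definition poly_int p : R := (poly_prim p).[1] - (poly_prim p).[-1].

Lemma poly_intE G p : G^`() = p -> poly_int p = G.[1] - G.[-1].
Proof.
move=> Gp; have d0 : (poly_prim p - G)^`() = 0 by rewrite derivB poly_primK Gp subrr.
have c0 i : (poly_prim p - G)`_i.+1 = 0.
  have := congr1 (fun r : {poly R} => r`_i) d0; rewrite coef_deriv coef0.
  by move/eqP; rewrite mulrn_eq0 => /orP[//|/eqP].
have /size1_polyC e : (size (poly_prim p - G)%R <= 1)%N.
  by apply/leq_sizeP => -[//|j] _; exact: c0.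
have ev a : (poly_prim p).[a] = G.[a] + (poly_prim p - G)`_0.
  by rewrite -[in LHS](subrK G (poly_prim p)) addrC hornerD {1}e hornerC.
by rewrite /poly_int !ev; ring.
Qed.

Lemma poly_int_deriv G : poly_int G^`() = G.[1] - G.[-1].
Proof. exact: poly_intE. Qed.

Lemma poly_intD p q : poly_int (p + q) = poly_int p + poly_int q.
Proof.
rewrite (@poly_intE (poly_prim p + poly_prim q)) ?derivD ?poly_primK//.
by rewrite !hornerD /poly_int; ring.
Qed.

Lemma poly_intZ a p : poly_int (a *: p) = a * poly_int p.
Proof.
rewrite (@poly_intE (a *: poly_prim p)) ?derivZ ?poly_primK//.
by rewrite !hornerZ /poly_int; ring.
Qed.

Lemma poly_int0 : poly_int 0 = 0.
Proof. by rewrite -(scale0r 0) poly_intZ mul0r. Qed.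

Lemma poly_intB p q : poly_int (p - q) = poly_int p - poly_int q.
Proof. by rewrite -scaleN1r poly_intD poly_intZ mulN1r. Qed.

Lemma poly_intMB p q r : poly_int (p * (q - r)) = poly_int (p * q) - poly_int (p * r).
Proof. by rewrite mulrBr poly_intB. Qed.

Lemma poly_int_parts p q :
  poly_int (p^`() * q) = p.[1] * q.[1] - p.[-1] * q.[-1] - poly_int (p * q^`()).
Proof.
by rewrite -!hornerM -poly_int_deriv derivM poly_intD addrK.
Qed.

End PolyIntegral.

Section Legendre.
Context {R : realType}.
Implicit Types (p q : {poly R}) (a : R) (i j k : nat).

Let rod j : {poly R} := ('X ^+ 2 - 1) ^+ j.
Notation leg := (@legendre_poly R).
Let nrm j : R := ((2 ^ j * j`!)%N%:R)^-1.

Let nrmS j : nrm j.+1 * (2 * j.+1%:R) = nrm j.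
Proof.
have x0 : (2 ^ j)%:R != 0 :> R by rewrite pnatr_eq0 -lt0n expn_gt0.
have y0 : j`!%:R != 0 :> R by rewrite pnatr_eq0 -lt0n fact_gt0.
have z0 : j.+1%:R != 0 :> R by rewrite pnatr_eq0.
rewrite /nrm expnS factS !natrM; move: x0 y0 z0.
move: (2 ^ j)%:R j`!%:R j.+1%:R => x y z x0 y0 z0.
by field; rewrite x0 y0 z0.
Qed.

Let rodS_deriv j : (rod j.+1)^`() = (2 * j.+1%:R) *: ('X * rod j).
Proof.
rewrite /rod deriv_exp derivB derivXn derivC subr0 /= expr1.
by rewrite -mul_polyC rmorphM !rmorph_nat; ring.
Qed.

Let rod_derivn_factor j k : (k <= j)%N ->
  exists q, (rod j)^`(k) = ('X ^+ 2 - 1) ^+ (j - k) * q.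
Proof.
elim: k => [|k ih] kj; first by exists 1; rewrite subn0 mulr1.
have [q e] := ih (ltnW kj); rewrite derivnS e.
rewrite (_ : (j - k)%N = (j - k.+1).+1); last by rewrite subnSK.
move: ('X ^+ 2 - 1) => p.
exists ((p^`() * q) *+ (j - k.+1).+1 + p * q^`()).
by rewrite derivM deriv_exp/= exprS; ring.
Qed.

(** These derivatives keep a factor X^2 - 1. *)
Let rod_derivn_root j k a : a ^+ 2 = 1 -> (k < j)%N -> ((rod j)^`(k)).[a] = 0.
Proof.
move=> a2 kj; have [q ->] := rod_derivn_factor (ltnW kj).
rewrite hornerM horner_exp !hornerE a2 subrr expr0n subn_eq0 leqNgt kj/=.
by rewrite mul0r.
Qed.

(** Integration by parts k times, the boundary terms being zero. *)
Let rod_orthogonal j k q : (k <= j)%N -> (size q <= k)%N ->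
  poly_int ((rod j)^`(k) * q) = 0.
Proof.
elim: k q => [|k ih] q kj sq.
  by move: sq; rewrite leqn0 size_poly_eq0 => /eqP ->; rewrite mulr0 poly_int0.
rewrite derivnS poly_int_parts !rod_derivn_root ?sqrrN ?expr1n//.
rewrite !mul0r subrr sub0r ih ?oppr0 ?(ltnW kj)//.
have [->|q0] := eqVneq q 0; first by rewrite deriv0 size_poly0.
by rewrite -ltnS (leq_trans _ sq)// lt_size_deriv.
Qed.

Lemma legendre_orthogonal j q : (size q <= j)%N -> poly_int (leg j * q) = 0.
Proof.
by move=> sq; rewrite /legendre_poly -scalerAl poly_intZ rod_orthogonal ?mulr0.
Qed.

Lemma size_legendre j : (size (leg j) <= j.+1)%N.
Proof.
apply: (leq_trans (size_scale_leq _ _)); apply/leq_sizeP => i ji.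
rewrite coef_derivn nth_default ?mul0rn//.
apply: (leq_trans (size_poly_exp_leq _ _)).
have -> : size ('X ^+ 2 - 1 : {poly R}) = 3.
  by rewrite size_polyDl ?size_polyXn// size_polyN size_poly1.
by rewrite /= mul2n -addnn -addnS leq_add2l.
Qed.

Let rodS_derivn j k : (rod j.+1)^`(k.+1) = (2 * j.+1%:R) *: ('X * rod j)^`(k).
Proof. by rewrite derivSn rodS_deriv derivnZ. Qed.

Let derivn_XM p k :
  ('X * p)^`(k) = 'X * p^`(k) + k%:R *: p^`(k.-1).
Proof.
elim: k => [|k ih]; first by rewrite scale0r addr0.
rewrite derivnS ih derivD derivM derivX derivZ mul1r -derivnS.
case: k {ih} => [|k]; first by rewrite !scale0r addr0 scale1r addrC.
by rewrite /= -derivnS -[k.+2%:R]natr1 scalerDl scale1r; ring.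
Qed.

Let legendre_end j a : a ^+ 2 = 1 -> (leg j.+1).[a] = a * (leg j).[a].
Proof.
move=> a2; rewrite /legendre_poly !hornerZ rodS_derivn derivn_XM.
rewrite hornerZ hornerD hornerM hornerX hornerZ -/(nrm _) -/(nrm _).
rewrite mulrA nrmS; case: j => [|j]; first by rewrite mul0r addr0; ring.
by rewrite /= [X in _ + _ * X]rod_derivn_root// mulr0 addr0; ring.
Qed.

Lemma legendre_0 : leg 0 = 1.
Proof. by rewrite /legendre_poly /= expn0 fact0 mul1n invr1 scale1r expr0. Qed.

Lemma legendre_at1 j : (leg j).[1] = 1.
Proof.
elim: j => [|j ih]; first by rewrite legendre_0 hornerC.
by rewrite legendre_end ?expr1n// ih mulr1.
Qed.

Lemma legendre_atN1 j : (leg j).[-1] = (-1) ^+ j.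
Proof.
elim: j => [|j ih]; first by rewrite legendre_0 hornerC.
by rewrite legendre_end ?sqrrN ?expr1n// ih exprS.
Qed.

Definition legendre_pred j : {poly R} := if j is k.+1 then leg k else 0.

(** The classical recurrence P_(j+1)' - P_(j-1)' = (2j+1) P_j, from which the
    antiderivatives and the norms are read off. *)
Lemma legendre_rec j :
  (leg j.+1)^`() = (2 * j + 1)%N%:R *: leg j + (legendre_pred j)^`().
Proof.
have recM : ('X * rod j)^`() =
    (2 * j + 1)%N%:R *: rod j + (2 * j%:R) *: rod j.-1.
  rewrite derivM derivX mul1r; case: j => [|j].
    by rewrite mulr0 scale0r addr0 scale1r /rod expr0 derivC mulr0 addr0.
  rewrite rodS_deriv -scalerAr mulrA -expr2.
  rewrite (_ : 'X ^+ 2 * rod j = rod j.+1 + rod j); last first.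
    by rewrite /rod [in RHS]exprS; ring.
  rewrite scalerDr addrA natrD natrM scalerDl scale1r; congr (_ + _).
  by rewrite addrC.
rewrite /legendre_poly derivZ -derivnS rodS_derivn -/(nrm _) scalerA nrmS.
rewrite derivSn recM derivnD !derivnZ scalerDr !scalerA -/(nrm _) mulrC.
congr (_ + _); case: j {recM} => [|j] /=.
  by rewrite !mulr0 scale0r deriv0.
by rewrite nrmS derivZ -derivnS.
Qed.

Lemma legendre_norm j : poly_int (leg j * leg j) = 2 / (2 * j + 1)%N%:R.
Proof.
have n0 : (2 * j + 1)%N%:R != 0 :> R by rewrite pnatr_eq0 addn1.
apply: (mulfI n0); rewrite [RHS]mulrCA divff// mulr1.
rewrite -poly_intZ scalerAl -[_ *: _](addrK (legendre_pred j)^`()) -legendre_rec.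
rewrite mulrBl poly_intB poly_int_parts !legendre_at1 !legendre_atN1.
have sd q k : (size q <= k)%N -> (size q^`() <= k)%N.
  move=> sq; have [->|q0] := eqVneq q 0; first by rewrite deriv0 size_poly0.
  by rewrite (leq_trans _ sq)// ltnW// lt_size_deriv.
rewrite [poly_int (leg j.+1 * _)]legendre_orthogonal; last first.
  exact/sd/size_legendre.
rewrite [(legendre_pred j)^`() * _]mulrC legendre_orthogonal; last first.
  by apply: sd; case: (j) => [|k] /=; [rewrite size_poly0|exact: size_legendre].
rewrite !subr0 mul1r exprS -mulrA -expr2 sqrr_sign; ring.
Qed.

Definition legendre_prim j : {poly R} :=
  ((2 * j + 1)%N%:R)^-1 *: (leg j.+1 - legendre_pred j).

Lemma legendre_primK j : (legendre_prim j)^`() = leg j.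
Proof.
by rewrite /legendre_prim derivZ derivB legendre_rec addrK scalerA mulVf ?scale1r//.
Qed.

End Legendre.

Section LegendreSystem.
Context {R : realType} {t T : R}.
Hypothesis tT : t < T.
Implicit Types (p G : {poly R}) (i j q : nat).
Notation leg := (@legendre_poly R).

Definition to_unit (x : R) : R := (x - t - (T - t) / 2) * (2 / (T - t)).

Let u0 : T - t != 0.
Proof. by rewrite subr_eq0 gt_eqF. Qed.

Lemma to_unit_left : to_unit t = -1.
Proof. by rewrite /to_unit; field. Qed.

Lemma to_unit_right : to_unit T = 1.
Proof. by rewrite /to_unit; field. Qed.

Lemma to_unit_is_derive G p : G^`() = p -> forall x : R,
  is_derive x 1 (fun x => (T - t) / 2 * G.[to_unit x]) p.[to_unit x].
Proof.
move=> Gp x.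
have dy : is_derive x 1 to_unit (2 / (T - t)).
  apply: is_derive_eq; rewrite /GRing.scale/=; ring.
have dG := is_derive_poly G (to_unit x).
have dGy := @is_derive1_comp _ (horner G) to_unit x _ _ dG dy.
have := is_deriveZ ((T - t) / 2) dGy.
move/is_derive_eq; apply; rewrite Gp /GRing.scale/=; field.
exact: u0.
Qed.

Lemma is_integral_poly p :
  is_integral t T (fun x => p.[to_unit x]) ((T - t) / 2 * poly_int p).
Proof.
exists (fun x => (T - t) / 2 * (poly_prim p).[to_unit x]).
  exact/to_unit_is_derive/poly_primK.
by rewrite to_unit_left to_unit_right /poly_int; ring.
Qed.

Lemma lipschitz_bounded_poly p : lipschitz_bounded t T (fun x => p.[to_unit x]).
Proof.
have ly : lipschitz_bounded t T to_unit.
  apply: lipschitz_boundedM; last exact: lipschitz_bounded_cst.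
  apply: (lipschitz_boundedD (f := fun x => x - t)); last exact: lipschitz_bounded_cst.
  apply: lipschitz_boundedD; last exact: lipschitz_bounded_cst.
  exact: lipschitz_bounded_id.
elim/poly_ind: p => [|p c ih].
  by under eq_fun do rewrite horner0; exact: lipschitz_bounded_cst.
under eq_fun do rewrite hornerMXaddC.
apply: lipschitz_boundedD; last exact: lipschitz_bounded_cst.
exact: lipschitz_boundedM.
Qed.

Let c j : R := Num.sqrt ((2 * j + 1)%N%:R / (T - t)).

Definition legendre_primitive j (x : R) : R :=
  c j * ((T - t) / 2 * (legendre_prim j).[to_unit x]).

Definition legendre_pairs q : seq (nat * nat) := [seq (i, i.-1) | i <- iota 1 q].

(** The sign is negative because the pairs are decreasing, whereas the
    coefficient of index i - 1 of the first component comes first in the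
    expansion. *)
Definition legendre_coef (p : nat * nat) : R :=
  - ((T - t) / 2 * (Num.sqrt (4 * p.1%:R ^+ 2 - 1))^-1).

Let legE j x : legendre_system t T j x = c j * (leg j).[to_unit x].
Proof. by []. Qed.

Let c_sqr j : c j ^+ 2 = (2 * j + 1)%N%:R / (T - t).
Proof. by rewrite sqr_sqrtr// divr_ge0// subr_ge0 ltW. Qed.

Let c_mul j : c j * c j.+1 = Num.sqrt (4 * j.+1%:R ^+ 2 - 1) / (T - t).
Proof.
rewrite /c -sqrtrM; last by rewrite divr_ge0// subr_ge0 ltW.
rewrite (_ : _ * _ = (4 * j.+1%:R ^+ 2 - 1) * (T - t) ^- 2).
  rewrite sqrtrM; last first.
    by rewrite subr_ge0 -natrX -natrM ler1n muln_gt0 expn_gt0.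
  by rewrite sqrtrV ?sqr_ge0// sqrtr_sqr ger0_norm// subr_ge0 ltW.
rewrite !natrD !natrM -natr1; field; exact: u0.
Qed.

Lemma legendre_is_integral (f : R -> R) p (k : R) :
  (forall x, f x = k * p.[to_unit x]) ->
  is_integral t T f (k * ((T - t) / 2 * poly_int p)).
Proof.
move=> e; apply: (eq_is_integral (fun x => esym (e x))).
exact/is_integralZ/is_integral_poly.
Qed.

(** By the recurrence the antiderivative of P_j only involves P_(j-1) and
    P_(j+1), so the sign kernel has coefficients on neighbouring pairs only. *)
Lemma legendre_area_system q :
  area_system t T (legendre_system t T) legendre_primitive
    (legendre_pairs q) legendre_coef.
Proof.
split.
- move=> j; apply: lipschitz_boundedM; first exact: lipschitz_bounded_cst.
  exact: lipschitz_bounded_poly.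
- move=> j x.
  exact: (is_deriveZ (c j) (to_unit_is_derive (legendre_primK j) x)).
- move=> i j.
  have h := @legendre_is_integral
    (fun x => legendre_system t T i x * legendre_system t T j x)
    (leg i * leg j) (c i * c j).
  have {}h : is_integral t T (fun x => legendre_system t T i x * legendre_system t T j x)
      (c i * c j * ((T - t) / 2 * poly_int (leg i * leg j))).
    by apply: h => x; rewrite hornerM !legE; ring.
  have -> : (i == j)%:R = c i * c j * ((T - t) / 2 * poly_int (leg i * leg j)) :> R; last by [].
  have [<-|ij] := eqVneq i j.
    have a0 : (2 * i + 1)%N%:R != 0 :> R by rewrite pnatr_eq0 addn1.
    rewrite legendre_norm -expr2 c_sqr /=; move: a0.
    by move: (2 * i + 1)%N%:R => a a0; field; rewrite u0 a0.
  rewrite (_ : poly_int _ = 0) ?mulr0//.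
  move: ij; rewrite neq_ltn => /orP[ij|ji].
    by rewrite mulrC legendre_orthogonal// (leq_trans (size_legendre _)).
  by rewrite legendre_orthogonal// (leq_trans (size_legendre _)).
- rewrite map_inj_uniq ?iota_uniq// => i j [].
  by [].
- by move=> p /mapP[i]; rewrite mem_iota => /andP[i0 _] -> /=; case: i i0.
- move=> p /mapP[[|i]]; rewrite mem_iota// => _ -> /=.
  have e1 : poly_int (leg i * legendre_prim i.+1) =
      - ((2 * i.+1 + 1)%N%:R^-1 * (2 / (2 * i + 1)%N%:R)).
    rewrite /legendre_prim -scalerAr poly_intZ poly_intMB legendre_norm.
    rewrite [leg i * _]mulrC legendre_orthogonal; last first.
      by rewrite (leq_trans (size_legendre _)).
    by rewrite sub0r mulrN.
  pose cst0 := (legendre_prim i).[-1] : R.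
  have e2 : poly_int (leg i.+1 * (legendre_prim i - cst0%:P)) =
      (2 * i + 1)%N%:R^-1 * (2 / (2 * i.+1 + 1)%N%:R).
    rewrite poly_intMB [poly_int (_ * cst0%:P)]legendre_orthogonal; last first.
      by rewrite (leq_trans (size_polyC_leq1 _)).
    rewrite subr0 /legendre_prim -scalerAr poly_intZ poly_intMB legendre_norm.
    rewrite [poly_int (_ * legendre_pred i)]legendre_orthogonal ?subr0//.
    by case: (i) => [|k] /=; [rewrite size_poly0|rewrite (leq_trans (size_legendre _))// ltnS ltnW].
  exists (c i * c i.+1 * ((T - t) / 2) * ((T - t) / 2 * poly_int (leg i * legendre_prim i.+1))),
    (c i * c i.+1 * ((T - t) / 2) * ((T - t) / 2 *
       poly_int (leg i.+1 * (legendre_prim i - cst0%:P)))).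
  split.
  + apply: legendre_is_integral => x; rewrite hornerM legE /legendre_primitive.
    have -> : (legendre_prim i.+1).[to_unit t] = 0.
      rewrite to_unit_left /legendre_prim hornerZ hornerD hornerN /=.
      by rewrite !legendre_atN1 !exprS; ring.
    by ring.
  + apply: legendre_is_integral => x.
    by rewrite hornerM legE /legendre_primitive hornerD hornerN hornerC to_unit_left -/cst0; ring.
  + rewrite e1 e2 c_mul /legendre_coef /=.
    set S := Num.sqrt _.
    have S2 : S ^+ 2 = (2 * i + 1)%N%:R * (2 * i.+1 + 1)%N%:R.
      rewrite sqr_sqrtr.
        by rewrite !natrD !natrM -natr1; ring.
      by rewrite subr_ge0 -natrX -natrM ler1n muln_gt0 expn_gt0.
    have a0 : (2 * i + 1)%N%:R != 0 :> R by rewrite pnatr_eq0 addn1.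
    have b0 : (2 * i.+1 + 1)%N%:R != 0 :> R by rewrite pnatr_eq0 addn1.
    move: S2 a0 b0; move: (2 * i + 1)%N%:R (2 * i.+1 + 1)%N%:R => a b S2 a0 b0.
    have S0 : S != 0 by rewrite -(sqrf_eq0 S) S2 mulf_neq0.
    have -> : a = S ^+ 2 / b by rewrite S2 mulfK.
    by field; rewrite u0 S0 b0.
Qed.

Let big_pairs q (f : nat * nat -> R) :
  \sum_(p <- legendre_pairs q) f p = \sum_(1 <= i < q.+1) f (i, i.-1).
Proof. by rewrite big_map /index_iota subn1. Qed.

(** The sum telescopes, since 2 / (4 i^2 - 1) = 1 / (2 i - 1) - 1 / (2 i + 1). *)
Lemma legendre_coef_sum q :
  (T - t) ^+ 2 / 4 - 2 * \sum_(p <- legendre_pairs q) legendre_coef p ^+ 2 =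
  (T - t) ^+ 2 / 4 / (2 * q + 1)%N%:R.
Proof.
rewrite big_pairs; elim: q => [|q ih].
  by rewrite big_geq// mulr0 subr0 muln0 add0n divr1.
rewrite big_nat_recr//= mulrDr opprD addrA ih /legendre_coef /= sqrrN exprMn exprVn.
rewrite sqr_sqrtr; last by rewrite subr_ge0 -natrX -natrM ler1n muln_gt0 expn_gt0.
have a0 : (2 * q + 1)%N%:R != 0 :> R by rewrite pnatr_eq0 addn1.
have b0 : (2 * q.+1 + 1)%N%:R != 0 :> R by rewrite pnatr_eq0 addn1.
have -> : 4 * q.+1%:R ^+ 2 - 1 = (2 * q + 1)%N%:R * (2 * q.+1 + 1)%N%:R :> R.
  by rewrite !natrD !natrM -natr1; ring.
have e : (2 * q.+1 + 1)%N%:R = (2 * q + 1)%N%:R + 2 :> R.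
  by rewrite !natrD !natrM -natr1; ring.
by move: a0 b0; rewrite e; move: (2 * q + 1)%N%:R => a a0 b0; field; rewrite a0 b0.
Qed.

Lemma legendre_skew_sum q (Om : Type) m (zeta : 'I_m -> nat -> Om -> R)
    (i1 i2 : 'I_m) (x : Om) :
  skew_sum (legendre_pairs q) legendre_coef (zeta i1 ^~ x) (zeta i2 ^~ x) =
  levy_area_legendre t T zeta i1 i2 q x.
Proof.
rewrite /skew_sum big_pairs /levy_area_legendre mulr_sumr.
by apply: eq_bigr => i _; rewrite /legendre_coef /=; ring.
Qed.

End LegendreSystem.

(** * The sum of the inverse squares *)

Section Basel.
Context {R : realType}.
Implicit Types (f g : R -> R) (x : R) (n : nat).

Lemma is_derive_mul f g x (df dg : R) :
  is_derive x 1 f df -> is_derive x 1 g dg ->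
  is_derive x 1 (fun y => f y * g y) (df * g x + f x * dg).
Proof.
move=> hf hg; have := is_deriveM hf hg; move/is_derive_eq; apply.
by rewrite /GRing.scale/= addrC mulrC.
Qed.

Lemma is_derive_pow f n x (df : R) : is_derive x 1 f df ->
  is_derive x 1 (fun y => f y ^+ n) (n%:R * f x ^+ n.-1 * df).
Proof.
move=> hf; elim: n => [|n ih].
  rewrite mul0r mul0r; have := is_derive_cst (1 : R) x (1 : R).
  by under [X in _ -> is_derive _ _ X _]eq_fun do rewrite expr0.
under eq_fun do rewrite exprS.
have := is_derive_mul hf ih; move/is_derive_eq; apply.
case: n {ih} => [|n] /=; first by rewrite expr0 mul0r; ring.
by rewrite -[n.+2%:R]natr1 exprS; ring.
Qed.

Let half_pi : R := pi / 2.

(** The integral of cos^(2n) over [0, pi/2]. *)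
Fixpoint wallis n : R :=
  if n is k.+1 then (2 * k%:R + 1) / (2 * k%:R + 2) * wallis k else half_pi.

(** The quotient of the integrals of x^2 cos^(2n) x and cos^(2n) x over
    [0, pi/2]. *)
Let basel n : R := pi ^+ 2 / 12 - 2^-1 * \sum_(1 <= k < n.+1) k%:R ^- 2.

Let pos1 n : 0 < 2 * n%:R + 1 :> R.
Proof. by rewrite ltr_wpDl// mulr_ge0. Qed.

Let pos2 n : 0 < 2 * n%:R + 2 :> R.
Proof. by rewrite ltr_wpDl// mulr_ge0. Qed.

Lemma wallis_gt0 n : 0 < wallis n.
Proof.
elim: n => [|n ih] /=; first by rewrite divr_gt0// pi_gt0.
by rewrite mulr_gt0// divr_gt0.
Qed.

Let dcos n x : is_derive x 1 (fun y => cos y ^+ n)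
  (n%:R * cos x ^+ n.-1 * (- sin x)).
Proof. exact: is_derive_pow. Qed.

Let cos_half_pi : cos half_pi = 0 :> R.
Proof. exact: cos_pihalf. Qed.

Let cos2D x : sin x ^+ 2 = 1 - cos x ^+ 2.
Proof. by rewrite -(cos2Dsin2 x); ring. Qed.

Lemma wallis_integral n :
  is_integral 0 half_pi (fun x => cos x ^+ (2 * n)) (wallis n).
Proof.
elim: n => [|n ih] /=.
  have := is_integral_cst 0 half_pi 1; rewrite subr0 mul1r.
  by apply: eq_is_integral => x; rewrite muln0 expr0.
have dG : is_integral 0 half_pi (fun x => cos x * cos x ^+ (2 * n).+1 +
    sin x * ((2 * n).+1%:R * cos x ^+ (2 * n) * (- sin x))) 0.
  exists (fun x => sin x * cos x ^+ (2 * n).+1); last first.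
    by rewrite cos_half_pi sin0 mul0r expr0n mulr0 subrr.
  by move=> x; exact: (is_derive_mul (is_derive_sin x) (dcos (2 * n).+1 x)).
have := is_integralZ ((2 * n%:R + 2)^-1)
  (is_integralD dG (is_integralZ (2 * n%:R + 1) ih)).
rewrite add0r mulrA [_^-1 * _]mulrC; apply: eq_is_integral => x.
have -> : (2 * n.+1)%N = (2 * n).+2 by rewrite mulnS.
have -> : (2 * n).+1%:R = 2 * n%:R + 1 :> R by rewrite -natr1 natrM.
apply: (mulfI (lt0r_neq0 (pos2 n))); rewrite mulVKf ?gt_eqF//.
have -> : sin x * ((2 * n%:R + 1) * cos x ^+ (2 * n) * - sin x) =
    - ((2 * n%:R + 1) * cos x ^+ (2 * n) * sin x ^+ 2) by ring.
by rewrite cos2D !exprS; ring.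
Qed.

(** Integrating the derivative of x cos^(2n) x + n x^2 sin x cos^(2n-1) x over
    [0, pi/2] shows that the quotient of the integrals of x^2 cos^(2n) x and
    cos^(2n) x decreases by 1/(2 n^2) at each step. *)
Lemma basel_integral n :
  is_integral 0 half_pi (fun x => x ^+ 2 * cos x ^+ (2 * n)) (wallis n * basel n).
Proof.
elim: n => [|n ih].
  rewrite /basel big_geq// mulr0 subr0 /=.
  exists (fun x => 3^-1 * x ^+ 3).
    move=> x; have := is_deriveZ 3^-1 (is_derive_pow 3 (is_derive_id x 1)).
    move/is_derive_eq; apply; rewrite /GRing.scale/= muln0 expr0.
    by rewrite !mulr1 mulrA mulVf ?mul1r.
  by rewrite /half_pi; field.
set N : R := n%:R + 1.
have dG : is_integral 0 half_pi (fun x =>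
    (1 * cos x ^+ (2 * n).+2 + x * ((2 * n).+2%:R * cos x ^+ (2 * n).+1 * - sin x)) +
    N * ((2 * x) * (sin x * cos x ^+ (2 * n).+1) +
     x ^+ 2 * (cos x * cos x ^+ (2 * n).+1 +
       sin x * ((2 * n).+1%:R * cos x ^+ (2 * n) * (- sin x))))) 0.
  exists (fun x => x * cos x ^+ (2 * n).+2 +
      N * (x ^+ 2 * (sin x * cos x ^+ (2 * n).+1))); last first.
    by rewrite cos_half_pi !expr0n/= sin0 !(mul0r, mulr0, addr0, subr0).
  move=> x; have d2 : is_derive x 1 (fun y : R => y ^+ 2) (2 * x).
    have := is_derive_pow 2 (is_derive_id x 1).
    by move/is_derive_eq; apply; rewrite /= expr1 mulr1.
  have dsc := is_derive_mul (is_derive_sin x) (dcos (2 * n).+1 x).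
  exact: (is_deriveD (is_derive_mul (is_derive_id x 1) (dcos (2 * n).+2 x))
    (is_deriveZ N (is_derive_mul d2 dsc))).
have iw := wallis_integral n.+1.
have i1 := is_integralZ ((2 * N ^+ 2)^-1) (is_integralD (is_integralD dG
  (is_integralZ (-1) iw)) (is_integralZ (N * (2 * n%:R + 1)) ih)).
have N0 : N != 0 by rewrite /N natr1 pnatr_eq0.
have -> : wallis n.+1 * basel n.+1 = (2 * N ^+ 2)^-1 * (0 + -1 * wallis n.+1 +
    N * (2 * n%:R + 1) * (wallis n * basel n)).
  have -> : basel n.+1 = basel n - 2^-1 * N ^- 2.
    by rewrite /basel big_nat_recr//= /N natr1; ring.
  rewrite /= -/N; have p2 := lt0r_neq0 (pos2 n).
  have -> : 2 * n%:R + 2 = 2 * N by rewrite /N; ring.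
  by field; exact: N0.
apply: eq_is_integral i1 => x.
have -> : (2 * n.+1)%N = (2 * n).+2 by rewrite mulnS.
have -> : (2 * n).+2%:R = 2 * N :> R.
  by rewrite /N -addn2 natrD natrM; ring.
have -> : (2 * n).+1%:R = 2 * N - 1 :> R by rewrite /N -addn1 natrD natrM; ring.
have -> : 2 * n%:R + 1 = 2 * N - 1 :> R by rewrite /N; ring.
have -> : sin x * ((2 * N - 1) * cos x ^+ (2 * n) * - sin x) =
    - ((2 * N - 1) * cos x ^+ (2 * n) * sin x ^+ 2) by ring.
rewrite cos2D !exprS; field.
exact: N0.
Qed.

Lemma mul_cos_le_sin x : 0 <= x <= half_pi -> x * cos x <= sin x.
Proof.
move=> /andP[x0 xp].
have dF (y : R) : is_derive y 1 (fun z : R => sin z - z * cos z) (y * sin y).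
  have := is_deriveB (is_derive_sin y)
    (is_derive_mul (is_derive_id y 1) (is_derive_cos y)).
  by move/is_derive_eq; apply; ring.
have [c /andP[c0 cx]] := is_derive_MVT x0 dF.
rewrite sin0 mul0r !subr0 -subr_ge0 => ->.
rewrite !mulr_ge0// sin_ge0_pi// c0 (le_trans cx)// (le_trans xp)//.
by rewrite ler_pdivrMr// ler_peMr ?pi_ge0// ler1n.
Qed.

(** The inequality x cos x <= sin x bounds the integral of x^2 cos^(2n+2) x by
    that of sin^2 x cos^(2n) x, the difference of two consecutive integrals of
    even powers of the cosine. Hence the quotient of [basel_integral] is
    O(1/n). *)
Lemma sum_inv_sqr_ge n :
  pi ^+ 2 / 6 - 2 / (2 * n%:R + 1) <= \sum_(1 <= k < n.+2) k%:R ^- 2 :> R.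
Proof.
have i1 := basel_integral n.+1.
have i2 := is_integralD (wallis_integral n) (is_integralZ (-1) (wallis_integral n.+1)).
have hp : 0 <= half_pi by rewrite divr_ge0// pi_ge0.
have h : wallis n.+1 * basel n.+1 <= wallis n + -1 * wallis n.+1.
  apply: (is_integral_le hp _ i1 i2) => x hx.
  have -> : (2 * n.+1)%N = (2 * n).+2 by rewrite mulnS.
  have -> : cos x ^+ (2 * n) + -1 * cos x ^+ (2 * n).+2 =
      sin x ^+ 2 * cos x ^+ (2 * n) by rewrite cos2D !exprS; ring.
  have -> : x ^+ 2 * cos x ^+ (2 * n).+2 = (x * cos x) ^+ 2 * cos x ^+ (2 * n).
    by rewrite exprMn !exprS; ring.
  have C0 : 0 <= cos x ^+ (2 * n) by rewrite exprM exprn_ge0// sqr_ge0.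
  rewrite ler_wpM2r//; have xs := mul_cos_le_sin hx.
  have cos0 : 0 <= cos x.
    case/andP: hx => x0 xp; apply: cos_ge0_pihalf; rewrite (le_trans _ x0)//.
    by rewrite oppr_le0.
  have x0 : 0 <= x by case/andP: hx.
  by apply: lerXn2r; rewrite // nnegrE ?(le_trans _ xs)// mulr_ge0.
have w0 := wallis_gt0 n.+1.
have e : wallis n = (2 * n%:R + 2) / (2 * n%:R + 1) * wallis n.+1.
  by rewrite /= mulrA mulrCA; have := pos1 n; have := pos2 n; move=> *; field; rewrite !gt_eqF.
have : basel n.+1 <= (2 * n%:R + 1)^-1.
  rewrite -(ler_pM2l w0) (le_trans h)// e le_eqVlt; apply/orP; left; apply/eqP.
  by field; rewrite gt_eqF.
rewrite /basel; set S := \sum_(_ <= _ < _) _.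
by move: ((2 * n%:R + 1)^-1) => y; lra.
Qed.

End Basel.

(** * The trigonometric system *)

Section TrigSystem.
Context {R : realType} {t T : R}.
Hypothesis tT : t < T.
Implicit Types (i j r q : nat) (a b x k : R).

Let u : R := T - t.
Let omega : R := 2 * pi / u.

Let u0 : u != 0.
Proof. by rewrite subr_eq0 gt_eqF. Qed.

Let pi0 : pi != 0 :> R.
Proof. by rewrite gt_eqF// pi_gt0. Qed.

Let u_gt0 : 0 < u.
Proof. by rewrite subr_gt0. Qed.

Let omega0 : omega != 0.
Proof. by rewrite mulf_neq0 ?invr_neq0// mulf_neq0// gt_eqF// pi_gt0. Qed.

Let omega_u : omega * u = pi *+ 2.
Proof. by rewrite /omega divfK// mulr_natl. Qed.

(** The frequencies for which the sine and the cosine have period T - t. *)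
Let periodic a : Prop := sin (a * (omega * u)) = 0 /\ cos (a * (omega * u)) = 1.

Let periodic_nat r : periodic r%:R.
Proof.
elim: r => [|r [ihs ihc]]; first by rewrite /periodic mul0r sin0 cos0.
rewrite /periodic -natr1 mulrDl mul1r sinD cosD ihs ihc omega_u.
by rewrite sin2pi cos2pi; split; ring.
Qed.

Let periodicD a b : periodic a -> periodic b -> periodic (a + b).
Proof.
move=> [sa ca] [sb cb]; rewrite /periodic mulrDl sinD cosD sa ca sb cb.
by split; ring.
Qed.

Let periodicB a b : periodic a -> periodic b -> periodic (a - b).
Proof.
move=> [sa ca] [sb cb]; rewrite /periodic mulrBl sinB cosB sa ca sb cb.
by split; ring.
Qed.

Let angle a x := a * (omega * (x - t)).

Let d_angle a x : is_derive x 1 (angle a) (a * omega).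
Proof.
have := is_deriveB (is_derive_id x 1) (is_derive_cst t x 1).
move=> /(is_deriveZ (a * omega)); move/is_derive_eq => H.
rewrite (_ : angle a = (fun y => (a * omega) *: (y - t))); last first.
  by apply/funext => y; rewrite /angle /GRing.scale/=; ring.
by apply: H; rewrite /GRing.scale/= subr0 mulr1.
Qed.

Let d_sin a x : is_derive x 1 (fun y => sin (angle a y)) (a * omega * cos (angle a x)).
Proof.
have := @is_derive1_comp _ sin (angle a) x _ _ (is_derive_sin _) (d_angle a x).
by move/is_derive_eq; apply; rewrite mulrC.
Qed.

Let d_cos a x : is_derive x 1 (fun y => cos (angle a y)) (- (a * omega * sin (angle a x))).
Proof.
have := @is_derive1_comp _ cos (angle a) x _ _ (is_derive_cos _) (d_angle a x).
by move/is_derive_eq; apply; ring.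
Qed.

Let angle_left a : angle a t = 0.
Proof. by rewrite /angle subrr !mulr0. Qed.

Let sin_right a : periodic a -> sin (angle a T) = 0.
Proof. by case. Qed.

Let cos_right a : periodic a -> cos (angle a T) = 1.
Proof. by case. Qed.

Let int_cos a : periodic a ->
  is_integral t T (fun x => cos (angle a x)) (if a == 0 then u else 0).
Proof.
move=> pa; have [->|a0] := eqVneq a 0.
  have := is_integral_cst t T 1; rewrite mul1r; apply: eq_is_integral => x.
  by rewrite /angle mul0r cos0.
have ao : a * omega != 0 by rewrite mulf_neq0.
exists (fun x => (a * omega)^-1 * sin (angle a x)).
  move=> x; have := is_deriveZ (a * omega)^-1 (d_sin a x).
  by move/is_derive_eq; apply; rewrite /GRing.scale/= mulKf.
by rewrite sin_right// angle_left sin0 mulr0 subrr.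
Qed.

Let int_sin a : periodic a -> is_integral t T (fun x => sin (angle a x)) 0.
Proof.
move=> pa; have [->|a0] := eqVneq a 0.
  have := is_integral_cst t T 0; rewrite mul0r; apply: eq_is_integral => x.
  by rewrite /angle mul0r sin0.
have ao : a * omega != 0 by rewrite mulf_neq0.
exists (fun x => - (a * omega)^-1 * cos (angle a x)).
  move=> x; have := is_deriveZ (- (a * omega)^-1) (d_cos a x).
  by move/is_derive_eq; apply; rewrite /GRing.scale/= mulNr mulrN opprK mulKf.
by rewrite cos_right// angle_left cos0 subrr.
Qed.

Let amp j : R := if j == 0%N then (Num.sqrt u)^-1 else Num.sqrt 2 / Num.sqrt u.
Let freq j : R := (uphalf j)%:R.
Let wave j x : R := if odd j then sin (angle (freq j) x) else cos (angle (freq j) x).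

Lemma trig_systemE j x : trig_system t T j x = amp j * wave j x.
Proof.
rewrite /trig_system /amp /wave.
have -> : 2 * pi * (uphalf j)%:R * (x - t) / (T - t) = angle (freq j) x.
  by rewrite /angle /omega /freq -/u; field.
case: j => [|j] //=.
by rewrite /angle /freq mul0r cos0 mulr1.
Qed.

Definition trig_primitive j x : R :=
  amp j * (if j == 0%N then x - t else
    if odd j then - (freq j * omega)^-1 * cos (angle (freq j) x)
    else (freq j * omega)^-1 * sin (angle (freq j) x)).

(** The cosine and the sine of each frequency, and the sine with the
    constant. *)
Definition trig_pairs q : seq (nat * nat) :=
  [seq ((2 * r)%N, (2 * r).-1) | r <- iota 1 q] ++
  [seq ((2 * r).-1, 0%N) | r <- iota 1 q].

Definition trig_coef (p : nat * nat) : R :=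
  (if p.2 == 0%N then Num.sqrt 2 else 1) * (T - t) / (2 * pi * (uphalf p.1)%:R).

Let freq0 j : (0 < j)%N -> freq j * omega != 0.
Proof.
by move=> j0; rewrite mulf_neq0// pnatr_eq0 -lt0n uphalf_gt0.
Qed.

Let amp_sqr j : (0 < j)%N -> amp j ^+ 2 = 2 / u.
Proof.
case: j => // j _; rewrite /amp/= exprMn exprVn !sqr_sqrtr ?ltW//.
Qed.

Let amp0_sqr : amp 0 ^+ 2 = u^-1.
Proof. by rewrite /amp/= exprVn sqr_sqrtr// ltW. Qed.

Let lip_wave j : lipschitz_bounded t T (wave j).
Proof.
have l1 (f g : R -> R) : (forall x, is_derive x 1 f (g x)) ->
    (forall x, `|g x| <= `|freq j * omega|) ->
    (forall x, `|f x| <= 1) -> lipschitz_bounded t T f.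
  move=> df gb fb; exists (1 + `|freq j * omega|); first exact: addr_ge0.
  move=> x y _ _; split; first by rewrite (le_trans (fb x))// lerDl.
  wlog yx : x y / y <= x.
    move=> H; have [|/ltW] := leP y x; first exact: H.
    by move=> xy; rewrite distrC [`|x - y|]distrC; exact: H.
  have [c _ ->] := is_derive_MVT yx df.
  by rewrite normrM ler_wpM2r// (le_trans (gb c))// lerDr.
rewrite /wave; case: (odd j).
- apply: (l1 _ (fun x => freq j * omega * cos (angle (freq j) x))).
  + by move=> x; exact: d_sin.
  + by move=> x; rewrite normrM ler_piMr// ler_norml cos_geN1 cos_le1.
  + by move=> x; rewrite ler_norml sin_geN1 sin_le1.
- apply: (l1 _ (fun x => - (freq j * omega * sin (angle (freq j) x)))).
  + by move=> x; exact: d_cos.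
  + by move=> x; rewrite normrN normrM ler_piMr// ler_norml sin_geN1 sin_le1.
  + by move=> x; rewrite ler_norml cos_geN1 cos_le1.
Qed.

Let d_primitive j x : is_derive x 1 (trig_primitive j) (trig_system t T j x).
Proof.
rewrite trig_systemE /trig_primitive.
case: j => [|j] /=.
  have := is_deriveZ (amp 0) (is_deriveB (is_derive_id x 1) (is_derive_cst t x 1)).
  move/is_derive_eq; apply; rewrite /wave /angle /freq /= !mul0r cos0 /GRing.scale/=.
  by rewrite subr0.
have f0 := freq0 (ltn0Sn j).
rewrite /wave /=; case: (odd j) => /=; last first.
- have := is_deriveZ (amp j.+1) (is_deriveZ (- (freq j.+1 * omega)^-1) (d_cos (freq j.+1) x)).
  move/is_derive_eq; apply; rewrite /GRing.scale/=; move: f0.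
  by move: (freq j.+1 * omega) => k k0; field.
- have := is_deriveZ (amp j.+1) (is_deriveZ (freq j.+1 * omega)^-1 (d_sin (freq j.+1) x)).
  by move/is_derive_eq; apply; rewrite /GRing.scale/= mulKf.
Qed.

Let int_cos_cos i j : is_integral t T
  (fun x => cos (angle (freq i) x) * cos (angle (freq j) x))
  (2^-1 * (if freq i == freq j then u else 0) +
   2^-1 * (if freq i + freq j == 0 then u else 0)).
Proof.
have := is_integralD (is_integralZ 2^-1 (int_cos
    (periodicB (periodic_nat (uphalf i)) (periodic_nat (uphalf j)))))
  (is_integralZ 2^-1 (int_cos
    (periodicD (periodic_nat (uphalf i)) (periodic_nat (uphalf j))))).
rewrite subr_eq0; apply: eq_is_integral => x.
by rewrite /angle mulrBl mulrDl cosB cosD; field.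
Qed.

Let int_sin_sin i j : is_integral t T
  (fun x => sin (angle (freq i) x) * sin (angle (freq j) x))
  (2^-1 * (if freq i == freq j then u else 0) -
   2^-1 * (if freq i + freq j == 0 then u else 0)).
Proof.
have := is_integralD (is_integralZ 2^-1 (int_cos
    (periodicB (periodic_nat (uphalf i)) (periodic_nat (uphalf j)))))
  (is_integralZ (- 2^-1) (int_cos
    (periodicD (periodic_nat (uphalf i)) (periodic_nat (uphalf j))))).
rewrite subr_eq0 mulNr; apply: eq_is_integral => x.
by rewrite /angle mulrBl mulrDl cosB cosD; field.
Qed.

Let int_sin_cos i j : is_integral t T
  (fun x => sin (angle (freq i) x) * cos (angle (freq j) x)) 0.
Proof.
have := is_integralD (is_integralZ 2^-1 (int_sin
    (periodicB (periodic_nat (uphalf i)) (periodic_nat (uphalf j)))))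
  (is_integralZ 2^-1 (int_sin
    (periodicD (periodic_nat (uphalf i)) (periodic_nat (uphalf j))))).
rewrite !mulr0 addr0; apply: eq_is_integral => x.
by rewrite /angle mulrBl mulrDl sinB sinD; field.
Qed.

Let trig_orthonormal i j :
  is_integral t T (fun x => trig_system t T i x * trig_system t T j x) (i == j)%:R.
Proof.
suff [v iv vE] : exists2 v, is_integral t T (fun x => wave i x * wave j x) v &
    amp i * amp j * v = (i == j)%:R.
  rewrite -vE; apply: eq_is_integral (is_integralZ _ iv) => x.
  by rewrite !trig_systemE; ring.
have freqE : (freq i == freq j) = (uphalf i == uphalf j) by rewrite eqr_nat.
have freqD0 : (freq i + freq j == 0) = (i == 0%N) && (j == 0%N).
  rewrite -natrD pnatr_eq0 addn_eq0; congr (_ && _).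
    by case: (i) => [|k] //=; rewrite uphalf_half.
  by case: (j) => [|k] //=; rewrite uphalf_half.
have i0 (k : nat) : odd k -> (k == 0%N) = false by case: k.
have neq (k l : nat) : odd k != odd l -> (k == l) = false.
  by move=> kl; apply: contraNF kl => /eqP ->.
have uphalf_eq (k l : nat) : odd k = odd l -> (uphalf k == uphalf l) = (k == l).
  move=> kl; apply/eqP/eqP => [e|->//].
  have [ok|ok] := boolP (odd k).
    by apply: succn_inj; rewrite -(odd_uphalfK ok) e odd_uphalfK// -kl.
  by rewrite -(even_uphalfK ok) e even_uphalfK// -kl.
rewrite /wave; case: (boolP (odd i)) => oi; case: (boolP (odd j)) => oj.
- eexists; first exact: int_sin_sin.
  rewrite freqD0 (i0 i)//= mulr0 subr0 freqE uphalf_eq ?oi ?oj//.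
  have [<-|_] := eqVneq i j; last by rewrite !mulr0.
  rewrite -expr2 amp_sqr; last by rewrite lt0n i0.
  by rewrite -[true%:R]/(1 : R); field.
- eexists; first exact: int_sin_cos.
  by rewrite mulr0 neq// oi (negbTE oj).
- exists 0; last by rewrite mulr0 neq// oj (negbTE oi).
  by apply: eq_is_integral (int_sin_cos j i) => x; rewrite mulrC.
- eexists; first exact: int_cos_cos.
  rewrite freqE uphalf_eq ?(negbTE oi) ?(negbTE oj)// freqD0.
  have [<-|ij] := eqVneq i j; last first.
    case: (boolP (_ && _)) => [/andP[/eqP ei /eqP ej]|]; last by rewrite !mulr0 addr0 mulr0.
    by move: ij; rewrite ei ej eqxx.
  have [->|i_gt0] := posnP i; first by rewrite -expr2 amp0_sqr /= -[true%:R]/(1 : R); field.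
  by rewrite -expr2 amp_sqr//= mulr0 addr0 -[true%:R]/(1 : R); field.
Qed.

Let int_sin_id a : a != 0 -> periodic a ->
  is_integral t T (fun x => sin (angle a x) * (x - t)) (- (u / (a * omega))).
Proof.
move=> a0 pa; have ao : a * omega != 0 by rewrite mulf_neq0.
exists (fun x => (a * omega)^-1 * ((a * omega)^-1 * sin (angle a x)
    - (x - t) * cos (angle a x))); last first.
  by rewrite sin_right// cos_right// angle_left sin0 cos0 -/u; move: ao;
    move: (a * omega) => k k0; field.
move=> x; have dx : is_derive x 1 (fun y => y - t) 1.
  by have := is_deriveB (is_derive_id x 1) (is_derive_cst t x 1); rewrite subr0.
have := is_deriveZ (a * omega)^-1 (is_deriveB (is_deriveZ (a * omega)^-1 (d_sin a x))
  (is_derive_mul dx (d_cos a x))).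
move/is_derive_eq; apply; rewrite /GRing.scale/=; move: ao.
by move: (a * omega) => k k0; field.
Qed.

Let amp_mul j : (0 < j)%N -> amp 0 * amp j = Num.sqrt 2 / u.
Proof.
case: j => // j _; rewrite -[in RHS](sqr_sqrtr (ltW u_gt0)) /amp/=; field.
by rewrite sqrtr_eq0 -ltNge.
Qed.

Let trig_odd j x : odd j -> trig_system t T j x = amp j * sin (angle (freq j) x).
Proof. by rewrite trig_systemE /wave => ->. Qed.

Let trig_even j x : ~~ odd j -> trig_system t T j x = amp j * cos (angle (freq j) x).
Proof. by rewrite trig_systemE /wave => /negbTE ->. Qed.

Let primitive_odd j x : odd j -> trig_primitive j x - trig_primitive j t =
  amp j * (freq j * omega)^-1 * (1 - cos (angle (freq j) x)).
Proof.
case: j => // j oj; rewrite /trig_primitive/= -/(odd j.+1) oj angle_left cos0.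
ring.
Qed.

Let primitive_even j x : (0 < j)%N -> ~~ odd j ->
  trig_primitive j x - trig_primitive j t =
  amp j * (freq j * omega)^-1 * sin (angle (freq j) x).
Proof.
case: j => // j _ oj; rewrite /trig_primitive/= -/(odd j.+1) (negbTE oj) angle_left sin0.
ring.
Qed.

Let primitive_0 x : trig_primitive 0 x - trig_primitive 0 t = amp 0 * (x - t).
Proof. by rewrite /trig_primitive/= subrr; ring. Qed.

Let odd_pred_double r : (0 < r)%N -> odd (2 * r).-1.
Proof. by case: r => // r _; rewrite mulnS /= mul2n odd_double. Qed.

Let even_double r : ~~ odd (2 * r).
Proof. by rewrite mul2n odd_double. Qed.

Let uphalf_pred_double r : (0 < r)%N -> uphalf (2 * r).-1 = r.
Proof. by case: r => // r _; rewrite mulnS /= mul2n doubleK. Qed.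

Let uphalf_dbl r : uphalf (2 * r) = r.
Proof. by rewrite mul2n uphalf_double. Qed.

Let trig_coef_cos_sin r : (0 < r)%N -> exists c1 c2,
  [/\ is_integral t T (fun y => trig_system t T (2 * r).-1 y *
        (trig_primitive (2 * r) y - trig_primitive (2 * r) t)) c1,
      is_integral t T (fun y => trig_system t T (2 * r) y *
        (trig_primitive (2 * r).-1 y - trig_primitive (2 * r).-1 t)) c2
    & c1 - c2 = 2 * trig_coef ((2 * r)%N, (2 * r).-1)].
Proof.
move=> r0; have ok := odd_pred_double r0; have oj := even_double r.
have k0 : (0 < (2 * r).-1)%N by case: (2 * r).-1 ok.
have j0 : (0 < 2 * r)%N by rewrite muln_gt0.
have ak := amp_sqr k0; have aj := amp_sqr j0.
have akj : amp (2 * r).-1 = amp (2 * r)%N by rewrite /amp !eqn0Ngt k0 j0.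
have rr0 : r%:R != 0 :> R by rewrite pnatr_eq0 -lt0n.
have ro : r%:R * omega != 0 by rewrite mulf_neq0.
have i1 := int_sin_sin (2 * r).-1 (2 * r).-1.
have i2 := int_cos_cos (2 * r) (2 * r); have i3 := int_cos (periodic_nat r).
move: i1 i2; rewrite /freq uphalf_dbl uphalf_pred_double// eqxx -natrD pnatr_eq0.
rewrite addn_eq0 eqn0Ngt r0 /= mulr0 subr0 addr0 => i1 i2.
rewrite (negbTE rr0) in i3.
exists (2 / u * (r%:R * omega)^-1 * (2^-1 * u)),
  (2 / u * (r%:R * omega)^-1 * (0 + (-1) * (2^-1 * u))); split.
- apply: eq_is_integral (is_integralZ (2 / u * (r%:R * omega)^-1) i1) => x.
  rewrite trig_odd// primitive_even// /freq uphalf_dbl uphalf_pred_double// akj -aj.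
  by ring.
- apply: eq_is_integral (is_integralZ (2 / u * (r%:R * omega)^-1)
    (is_integralD i3 (is_integralZ (-1) i2))) => x.
  rewrite trig_even// primitive_odd// /freq uphalf_dbl uphalf_pred_double// akj -aj.
  by ring.
- rewrite /trig_coef /= eqn0Ngt k0/= uphalf_dbl -/u /omega.
  by move: (@pi R) pi0 => p p0; field; rewrite u0 rr0 p0.
Qed.

Let trig_coef_sin_0 r : (0 < r)%N -> exists c1 c2,
  [/\ is_integral t T (fun y => trig_system t T 0 y *
        (trig_primitive (2 * r).-1 y - trig_primitive (2 * r).-1 t)) c1,
      is_integral t T (fun y => trig_system t T (2 * r).-1 y *
        (trig_primitive 0 y - trig_primitive 0 t)) c2
    & c1 - c2 = 2 * trig_coef ((2 * r).-1, 0%N)].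
Proof.
move=> r0; have ok := odd_pred_double r0.
have k0 : (0 < (2 * r).-1)%N by case: (2 * r).-1 ok.
have ak := amp_mul k0.
have rr0 : r%:R != 0 :> R by rewrite pnatr_eq0 -lt0n.
have ro : r%:R * omega != 0 by rewrite mulf_neq0.
have i1 := int_sin_id rr0 (periodic_nat r).
have i2 := is_integral_cst t T 1; have i3 := int_cos (periodic_nat r).
rewrite (negbTE rr0) in i3.
exists (Num.sqrt 2 / u * (r%:R * omega)^-1 * (1 * u + (-1) * 0)),
  (Num.sqrt 2 / u * (- (u / (r%:R * omega)))); split.
- apply: eq_is_integral (is_integralZ (Num.sqrt 2 / u * (r%:R * omega)^-1)
    (is_integralD i2 (is_integralZ (-1) i3))) => x.
  rewrite trig_even// primitive_odd// /freq uphalf_pred_double//= /angle mul0r cos0 -ak.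
  by ring.
- apply: eq_is_integral (is_integralZ (Num.sqrt 2 / u) i1) => x.
  rewrite trig_odd// primitive_0 /freq uphalf_pred_double// -ak.
  by ring.
- rewrite /trig_coef /= uphalf_pred_double// -/u /omega.
  by move: (@pi R) pi0 => p p0; field; rewrite u0 rr0 p0.
Qed.

(** The antiderivative of a wave of positive frequency that vanishes at t combines
    the conjugate wave and, for a sine, a constant. *)
Lemma trig_area_system q :
  area_system t T (trig_system t T) trig_primitive (trig_pairs q) trig_coef.
Proof.
have mem (f : nat -> nat * nat) p : p \in [seq f r | r <- iota 1 q] ->
    exists2 r, (0 < r)%N & p = f r.
  by move=> /mapP[r]; rewrite mem_iota => /andP[r0 _] ->; exists r.
split.
- move=> j; have -> : trig_system t T j = (fun x => amp j * wave j x).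
    by apply/funext => x; rewrite trig_systemE.
  apply: lipschitz_boundedM; first exact: lipschitz_bounded_cst.
  exact: lip_wave.
- exact: d_primitive.
- exact: trig_orthonormal.
- rewrite cat_uniq !map_inj_in_uniq ?iota_uniq/=; last 2 first.
  + move=> r r' /[!mem_iota]/andP[r0 _] /andP[r'0 _] [] e.
    by rewrite -(uphalf_pred_double r0) e uphalf_pred_double.
  + by move=> r r' _ _ [] /eqP; rewrite eqn_pmul2l// => /eqP ->.
  rewrite andbT; apply/hasPn => p /mem[r r0 ->]; apply/negP => /mem[r' r'0 [_]].
  by move=> e; have := odd_pred_double r'0; rewrite -e.
- move=> p; rewrite mem_cat => /orP[] /mem[r r0 ->] /=.
    by rewrite prednK// muln_gt0.
  by case: (2 * r).-1 (odd_pred_double r0).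
- move=> p; rewrite mem_cat => /orP[] /mem[r r0 ->].
    exact: trig_coef_cos_sin.
  exact: trig_coef_sin_0.
Qed.

Let big_pairs q (f : nat * nat -> R) :
  \sum_(p <- trig_pairs q) f p =
  \sum_(1 <= r < q.+1) (f ((2 * r)%N, (2 * r).-1) + f ((2 * r).-1, 0%N)).
Proof. by rewrite big_cat !big_map big_split /= /index_iota subn1. Qed.

(** The left-hand side is (T - t)^2 / 4 minus 3 (T - t)^2 / (2 pi^2) times a
    partial sum of the series for zeta(2); it tends to zero at the rate at which
    that series converges. *)
Lemma trig_coef_sum_le q : (0 < q)%N ->
  (T - t) ^+ 2 / 4 - 2 * \sum_(p <- trig_pairs q) trig_coef p ^+ 2 <=
  (T - t) ^+ 2 / q%:R.
Proof.
case: q => // q _; rewrite big_pairs.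
have p0 : pi != 0 :> R by rewrite gt_eqF// pi_gt0.
have -> : \sum_(1 <= r < q.+2) (trig_coef ((2 * r)%N, (2 * r).-1) ^+ 2 +
      trig_coef ((2 * r).-1, 0%N) ^+ 2) =
    3 * u ^+ 2 / (4 * pi ^+ 2) * \sum_(1 <= r < q.+2) r%:R ^- 2.
  rewrite mulr_sumr; apply: eq_big_nat => r /andP[r0 _].
  have rr0 : r%:R != 0 :> R by rewrite pnatr_eq0 -lt0n.
  rewrite /trig_coef /= uphalf_dbl uphalf_pred_double//.
  have -> : ((2 * r).-1 == 0)%N = false by case: r r0 {rr0} => // r _; rewrite mulnS.
  rewrite -/u !exprMn sqr_sqrtr// !exprVn !exprMn.
  by move: (@pi R) p0 => p p0; field; rewrite p0 rr0.
have := @sum_inv_sqr_ge R q; set S := \sum_(_ <= _ < _) _ => HS.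
have n0 : 0 <= q%:R :> R by [].
have p2 : 4 <= pi ^+ 2 :> R.
  by have := @pi_ge2 R; move: (@pi R) => p p_ge2; nra.
have c0 : 0 <= 3 * u ^+ 2 / (2 * pi ^+ 2).
  by apply: divr_ge0; apply: mulr_ge0 => //; exact: sqr_ge0.
have := ler_wpM2l c0 HS => {}HS; rewrite -/u -[q.+1%:R]natr1.
set n : R := q%:R in HS n0 *.
have -> : u ^+ 2 / 4 - 2 * (3 * u ^+ 2 / (4 * pi ^+ 2) * S) =
  u ^+ 2 / 4 - 3 * u ^+ 2 / (2 * pi ^+ 2) * S by move: (@pi R) p0 => p p0; field.
apply: (@le_trans _ _ (u ^+ 2 * (3 / (pi ^+ 2 * (2 * n + 1))))).
  rewrite lerBlDl -lerBlDr; apply: le_trans HS.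
  rewrite le_eqVlt; apply/orP; left; apply/eqP.
  have n1 : 2 * n + 1 != 0 by rewrite gt_eqF// ltr_wpDl// mulr_ge0.
  by move: (@pi R) p0 => p p0; field; rewrite n1 p0.
rewrite ler_wpM2l ?sqr_ge0// ler_pdivrMr; last first.
  by rewrite mulr_gt0 ?exprn_gt0 ?pi_gt0// ltr_wpDl// mulr_ge0.
rewrite mulrC ler_pdivlMr; last by rewrite ltr_wpDl.
nra.
Qed.

Lemma trig_skew_sum q (Om : Type) m (zeta : 'I_m -> nat -> Om -> R)
    (i1 i2 : 'I_m) (x : Om) :
  skew_sum (trig_pairs q) trig_coef (zeta i1 ^~ x) (zeta i2 ^~ x) =
  levy_area_trig t T zeta i1 i2 q x.
Proof.
have p0 : pi != 0 :> R by rewrite gt_eqF// pi_gt0.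
rewrite /skew_sum big_pairs /levy_area_trig mulr_sumr.
apply: eq_big_nat => r /andP[r0 _].
have rr0 : r%:R != 0 :> R by rewrite pnatr_eq0 -lt0n.
rewrite /trig_coef /= uphalf_dbl uphalf_pred_double//.
have -> : ((2 * r).-1 == 0)%N = false by case: r r0 {rr0} => // r _; rewrite mulnS.
by move: (@pi R) p0 => p p0; field; rewrite p0 rr0.
Qed.

End TrigSystem.

(** * Convergence of the two expansions *)

Section Convergence.
Context {R : realType} {d : measure_display} {Om : measurableType d}.
Context {P : probability Om R} {F : R -> set (set Om)} {m : nat}
  {w : 'I_m -> R -> Om -> R}.
Hypotheses (hF : is_filtration F) (hw : is_wiener P F w).
Context {t T : R}.
Hypotheses (t0 : 0 <= t) (tT : t < T).
Variables (phi Phi : nat -> R -> R) (s : nat -> seq (nat * nat))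
  (beta : nat * nat -> R).
Hypothesis sys : forall q, area_system t T phi Phi (s q) beta.
Hypothesis sqr_le : forall q, (0 < q)%N ->
  (T - t) ^+ 2 / 4 - 2 * \sum_(p <- s q) beta p ^+ 2 <= (T - t) ^+ 2 / q%:R.
Variables (i1 i2 : 'I_m) (A : Om -> R) (zeta : 'I_m -> nat -> Om -> R).
Hypothesis i12 : i1 != i2.
Hypothesis hA : is_levy_area P F w t T i1 i2 A.
Hypothesis hzeta : forall i j,
  is_ito_integral P F (w i) t T (fun s _ => phi j s) (zeta i j).
Variable Aq : nat -> Om -> R.
Hypothesis AqE : forall q x,
  skew_sum (s q) beta (zeta i1 ^~ x) (zeta i2 ^~ x) = Aq q x.

(** A limit of squared norms of kernels. *)
Let coef_sum_ge0 q : 0 <= (T - t) ^+ 2 / 4 - 2 * \sum_(p <- s q) beta p ^+ 2.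
Proof.
have c := area_kernel_norm_cvg tT (sys q).
rewrite -(cvg_lim _ c)//; apply: limr_ge; first by apply/cvg_ex; eexists; exact: c.
apply: nearW => N; rewrite mulr_ge0 ?sqr_ge0// sumr_ge0// => l _.
by rewrite sumr_ge0// => k _; exact: sqr_ge0.
Qed.

Let C n : R := gauss_moment 1 (2 * n.+1) ^+ 2 * (T - t) ^+ (2 * n.+1).

Lemma expansion_moment_le n q :
  ('E_P[(fun x => (A x - Aq q.+1 x) ^+ (2 * n.+1))%R] <=
   (C n * q.+1%:R ^- n.+1)%:E)%E.
Proof.
under eq_fun do rewrite -AqE.
apply: (le_trans (levy_area_moment_le hF hw t0 tT (sys q.+1) i12 hA hzeta n)).
rewrite lee_fin /C -mulrA ler_wpM2l ?sqr_ge0// exprM -exprVn -exprMn.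
by rewrite lerXn2r ?nnegrE// ?sqr_le// divr_ge0 ?sqr_ge0.
Qed.

Lemma expansion_moment_cvg n : (0 < n)%N ->
  ('E_P[(fun x => (A x - Aq q x) ^+ (2 * n))%R] @[q --> \oo] --> 0)%E.
Proof.
case: n => // n _; rewrite -cvg_shiftS.
have inv0 : q.+1%:R^-1 @[q --> \oo] --> (0 : R) by exact: cvg_harmonic.
have C0 : C n * q.+1%:R ^- n.+1 @[q --> \oo] --> (0 : R).
  have /= H := cvg_comp _ _ inv0 (@exprn_continuous R n.+1 0).
  rewrite expr0n/= in H; rewrite -(mulr0 (C n)).
  apply: cvgM; first exact: cvg_cst.
  by under eq_fun do rewrite -exprVn.
have Cn : (C n * q.+1%:R ^- n.+1)%:E @[q --> \oo] --> 0%:E.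
  by apply: cvg_EFin C0; exact: nearW.
apply: (squeeze_cvge _ (cvg_cst 0%E) Cn); apply: nearW => q.
rewrite expansion_moment_le andbT.
by apply: expectation_ge0 => x; rewrite exprM exprn_ge0// sqr_ge0.
Qed.

(** The fourth moments are O(q^(-2)), hence summable. *)
Lemma expansion_ae_cvg : {ae P, forall x, Aq q x @[q --> \oo] --> A x}.
Proof.
have mE q : measurable_fun setT (fun x => (A x - Aq q.+1 x) ^+ (2 * 2)).
  apply: measurable_funX; under eq_fun do rewrite -AqE.
  exact: (measurable_err (s q.+1) beta hA hzeta).
have := mean_summable_cvg mE _ (expansion_moment_le 1).
have E0 q x : 0 <= (A x - Aq q.+1 x) ^+ (2 * 2) by rewrite exprM sqr_ge0.
move=> /(_ E0); apply: filterS => x c4.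
have /sqr_cvg0/sqr_cvg0 c : (A x - Aq q.+1 x) ^+ 2 ^+ 2 @[q --> \oo] --> (0 : R).
  by under eq_fun do rewrite -exprM.
rewrite -cvg_shiftS; apply/subr_cvg0.
rewrite -(@oppr0 R); under eq_fun do rewrite -opprB.
exact: cvgN.
Qed.

End Convergence.

Theorem mainTheorem3 (R : realType) (d : measure_display)
    (Om : measurableType d) (P : probability Om R)
    (F : R -> set (set Om)) (m : nat) (w : 'I_m -> R -> Om -> R)
    (t T : R) (i1 i2 : 'I_m)
    (A : Om -> R) (zeta zetah : 'I_m -> nat -> Om -> R)
    (hP : measure_is_complete P)
    (hF : is_filtration F)
    (hw : is_wiener P F w)
    (ht : 0 <= t) (htT : t < T)
    (hi : i1 != i2)
    (hA : is_levy_area P F w t T i1 i2 A)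
    (hzeta : forall i j,
       is_ito_integral P F (w i) t T
         (fun s _ => legendre_system t T j s) (zeta i j))
    (hzetah : forall i j,
       is_ito_integral P F (w i) t T
         (fun s _ => trig_system t T j s) (zetah i j)) :
  (forall n : nat, (0 < n)%N ->
     (('E_P[(fun x => (A x - levy_area_legendre t T zeta i1 i2 q x)
                       ^+ (2 * n))%R])%E @[q --> \oo] --> 0%E) /\
     (('E_P[(fun x => (A x - levy_area_trig t T zetah i1 i2 q x)
                       ^+ (2 * n))%R])%E @[q --> \oo] --> 0%E)) /\
  ({ae P, forall x,
     levy_area_legendre t T zeta i1 i2 q x @[q --> \oo] --> A x} /\
   {ae P, forall x,
     levy_area_trig t T zetah i1 i2 q x @[q --> \oo] --> A x}).
Proof.
have legendre_le q : (0 < q)%N ->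
    (T - t) ^+ 2 / 4 - 2 * \sum_(p <- legendre_pairs q) @legendre_coef R t T p ^+ 2 <=
    (T - t) ^+ 2 / q%:R :> R.
  move=> q0; rewrite legendre_coef_sum//.
  rewrite -mulrA ler_wpM2l ?sqr_ge0// -invfM lef_pV2 ?posrE ?mulr_gt0 ?ltr0n ?addn1//.
  by rewrite -natrM ler_nat; lia.
have cl := expansion_moment_cvg hF hw ht htT (legendre_area_system htT)
  legendre_le hi hA hzeta (fun q => legendre_skew_sum q zeta i1 i2).
have ct := expansion_moment_cvg hF hw ht htT (trig_area_system htT)
  (@trig_coef_sum_le R t T) hi hA hzetah (fun q => trig_skew_sum q zetah i1 i2).
split=> [n n0|]; first by split; [exact: cl|exact: ct].
split.
- exact: (expansion_ae_cvg hF hw ht htT (legendre_area_system htT)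
    legendre_le hi hA hzeta (fun q => legendre_skew_sum q zeta i1 i2)).
- exact: (expansion_ae_cvg hF hw ht htT (trig_area_system htT)
    (@trig_coef_sum_le R t T) hi hA hzetah (fun q => trig_skew_sum q zetah i1 i2)).
Qed.
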